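(* Let $n\geqslant 2$, $p>n$, $x_0\in\mathbb{R}^n$, and let $Q:\mathbb{R}^n\to[0,\infty]$ be a Lebesgue measurable function. Suppose that $f:\mathbb{R}^n\to\mathbb{R}^n$ is a ring $Q$-homeomorphism with respect to $p$-modulus at the point $x_0$, and that for some numbers $r_0>0$, $K>0$ the condition $$q_{x_0}(t)\leqslant K\,t^{\alpha}$$ holds for a.e. $t\in[r_0,+\infty)$. If $\alpha\in[0,p-n)$, then $$\liminf_{R\to\infty}\frac{L(x_0,f,R)}{R^{\frac{p-n-\alpha}{p-n}}}\geqslant K^{\frac{1}{n-p}}\left(\frac{p-n}{p-n-\alpha}\right)^{\frac{p-1}{p-n}}>0.$$ If $\alpha=p-n$, then $$\liminf_{R\to\infty}\frac{L(x_0,f,R)}{(\ln R)^{\frac{p-1}{p-n}}}\geqslant K^{\frac{1}{n-p}}\left(\frac{p-n}{p-1}\right)^{\frac{p-1}{p-n}}>0.$$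
   Context: Notation. $m$ is Lebesgue measure on $\mathbb{R}^n$, $n\geqslant2$. $S(x_0,r)=\{x\in\mathbb{R}^n:|x-x_0|=r\}$. $\mathbb{A}(x_0,r_1,r_2)=\{x\in\mathbb{R}^n:r_1<|x-x_0|<r_2\}$. $\omega_{n-1}$ is the surface area of the unit sphere in $\mathbb{R}^n$. A homeomorphism $f:D\to\mathbb{R}^n$ means a homeomorphism of $D$ onto its image $fD=f(D)\subset\mathbb{R}^n$. $p$-modulus. Let $\Gamma$ be a family of curves in $\mathbb{R}^n$. A Borel measurable function $\rho:\mathbb{R}^n\to[0,\infty]$ is admissible for $\Gamma$, written $\rho\in\mathrm{adm}\,\Gamma$, if $\int_\gamma\rho(x)\,ds\geqslant1$ for every (locally rectifiable) curve $\gamma\in\Gamma$, where $ds$ is arc length. For $p\in(1,\infty)$ the $p$-modulus of $\Gamma$ is $$M_p(\Gamma)=\inf_{\rho\in\mathrm{adm}\,\Gamma}\int_{\mathbb{R}^n}\rho^p(x)\,dm(x).$$ Curve families. For sets $E,F,G\subset\mathbb{R}^n$, $\Delta(E,F,G)$ is the set of all continuous curves $\gamma:[a,b]\to\mathbb{R}^n$ with $\gamma(a)\in E$, $\gamma(b)\in F$ and $\gamma(t)\in G$ for $a<t<b$. Ring $Q$-homeomorphism. Let $D\subset\mathbb{R}^n$ be a domain, $x_0\in D$, $d_0=\mathrm{dist}(x_0,\partial D)$ (with $d_0=\infty$ when $D=\mathbb{R}^n$), and let $Q:D\to[0,\infty]$ be Lebesgue measurable. A homeomorphism $f:D\to\mathbb{R}^n$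 is called a ring $Q$-homeomorphism with respect to $p$-modulus at $x_0$ if, for all $0<r_1<r_2<d_0$, writing $S_i=S(x_0,r_i)$ for $i=1,2$ and $\mathbb{A}=\mathbb{A}(x_0,r_1,r_2)$, the inequality $$M_p(\Delta(fS_1,fS_2,fD))\leqslant\int_{\mathbb{A}}Q(x)\,\eta^p(|x-x_0|)\,dm(x)$$ holds for every measurable function $\eta:(r_1,r_2)\to[0,\infty]$ with $\int_{r_1}^{r_2}\eta(r)\,dr=1$. Spherical mean. $q_{x_0}(r)=\frac{1}{\omega_{n-1}r^{n-1}}\int_{S(x_0,r)}Q(x)\,d\mathcal{A}$, where $d\mathcal{A}$ is the element of surface area. Maximal distortion. $L(x_0,f,R)=\sup_{|x-x_0|\leqslant R}|f(x)-f(x_0)|$. *)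

(* Defs.v *)
From HB Require Import structures.
From mathcomp Require Import all_boot all_order all_algebra.
From mathcomp Require Import all_classical all_reals all_analysis.
From mathcomp Require Import measurable_realfun.
Set Implicit Arguments.
Unset Strict Implicit.
Unset Printing Implicit Defensive.
Import Order.TTheory GRing.Theory Num.Theory.
Import numFieldNormedType.Exports.
Local Open Scope classical_set_scope.
Local Open Scope ring_scope.

(* [R^n] is ['rV[R]_n]. Its library norm [`|x|] is the sup norm, which is used
   only for its topology; all metric notions below are stated with [enorm]. *)
Section euclidean.
Context {R : realType} {n : nat}.
Implicit Types (x y : 'rV[R]_n) (r : R).

Definition enorm x : R := Num.sqrt (\sum_(i < n) x ord0 i ^+ 2).

Definition sphere x0 r : set 'rV[R]_n := [set x | enorm (x - x0) = r].

Definition annulus x0 r1 r2 : set 'rV[R]_n :=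
  [set x | r1 < enorm (x - x0) < r2].

(* [+oo] when [A] is empty *)
Definition dist_to_set x (A : set 'rV[R]_n) : \bar R :=
  ereal_inf [set (enorm (y - x))%:E | y in A].

Definition frontier (A : set 'rV[R]_n) : set 'rV[R]_n :=
  closure A `\` A°.

Definition domain (D : set 'rV[R]_n) : Prop :=
  [/\ open D, connected D & D !=set0].

End euclidean.

Section lebesgue.
Context {R : realType} (n : nat).
Local Open Scope ereal_scope.

Definition box (ab : 'rV[R]_n * 'rV[R]_n) : set 'rV[R]_n :=
  [set x | forall i, (ab.1 ord0 i < x ord0 i <= ab.2 ord0 i)%R].

Definition box_volume (ab : 'rV[R]_n * 'rV[R]_n) : R :=
  (\prod_(i < n) Num.max 0 (ab.2 ord0 i - ab.1 ord0 i))%R.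

Definition lebesgue_outer (A : set 'rV[R]_n) : \bar R :=
  ereal_inf [set \esum_(ab in C) (box_volume ab)%:E |
             C in [set C | countable C /\ A `<=` \bigcup_(ab in C) box ab]].

Let box_volume_ge0 ab : 0 <= (box_volume ab)%:E.
Proof. by rewrite lee_fin prodr_ge0// => i _; rewrite le_max lexx. Qed.

#[local] Hint Extern 0 (is_true (0 <= (box_volume _)%:E)) =>
  exact: box_volume_ge0 : core.

Let lebesgue_outer_ge0 A : 0 <= lebesgue_outer A.
Proof. by apply: le_ereal_inf_tmp => _ [C _ <-]; apply: esum_ge0. Qed.

Let lebesgue_outer0 : lebesgue_outer set0 = 0.
Proof.
apply/eqP; rewrite eq_le lebesgue_outer_ge0 andbT.
apply: ereal_inf_lbound; exists set0; last by rewrite esum_set0.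
by split; [exact: countable0|exact: sub0set].
Qed.

Let le_lebesgue_outer :
  {homo lebesgue_outer : A B / A `<=` B >-> A <= B}.
Proof.
move=> A B AB; apply/ereal_inf_le_tmp => _ [C [cC BC] <-].
by exists C => //; split=> //; exact: subset_trans BC.
Qed.

Let lebesgue_outer_sigma_subadditive : sigma_subadditive lebesgue_outer.
Proof.
move=> A; have [[i ioo]|] := pselect (exists i, lebesgue_outer (A i) = +oo).
  rewrite (eseries_pinfty _ _ ioo) ?leey// => k _.
  by rewrite -ltNye (lt_le_trans _ (lebesgue_outer_ge0 _)).
rewrite -forallNE => Aoo.
apply/lee_addgt0Pr => e e0.
rewrite (le_trans _ (epsilon_trick _ _ (ltW e0)))//.
have [G PG] : {G : nat -> set ('rV[R]_n * 'rV[R]_n) & forall k,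
    [/\ countable (G k), A k `<=` \bigcup_(ab in G k) box ab &
     \esum_(ab in G k) (box_volume ab)%:E <=
       lebesgue_outer (A k) + (e / (2 ^ k.+1)%:R)%:E]}.
  apply: (@choice _ _ (fun k C => [/\ countable C,
    A k `<=` \bigcup_(ab in C) box ab & \esum_(ab in C) (box_volume ab)%:E <=
       lebesgue_outer (A k) + (e / (2 ^ k.+1)%:R)%:E])) => k.
  have ek : (0 < e / (2 ^ k.+1)%:R)%R by rewrite divr_gt0// ltr0n expn_gt0.
  have Ak : lebesgue_outer (A k) \is a fin_num.
    by rewrite ge0_fin_numE// ltey; apply/eqP/Aoo.
  have [_ [C [cC AC] <-] /ltW CA] := lb_ereal_inf_adherent ek Ak.
  by exists C.
have cG : countable (\bigcup_k G k).
  by apply: bigcup_countable => // k _; have [] := PG k.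
apply: (@le_trans _ _ (\esum_(ab in \bigcup_k G k) (box_volume ab)%:E)).
  apply: ereal_inf_lbound; exists (\bigcup_k G k) => //; split=> //.
  move=> x [k _ /=]; have [_ + _] := PG k => /[apply] -[ab Gab xab].
  by exists ab => //; exists k.
rewrite seqDU_bigcup_eq esum_bigcupT//.
rewrite -nneseries_esumT; last by move=> k; apply: esum_ge0.
apply: lee_nneseries => [k _ _|k _]; first by apply: esum_ge0.
have [_ _] := PG k; apply: le_trans.
rewrite [leLHS]esum_mkcond [leRHS]esum_mkcond; apply: le_esum => ab _.
case: ifPn => [/set_mem[Gab _]|_]; first by rewrite mem_set.
by case: ifPn.
Qed.

HB.instance Definition _ := isOuterMeasure.Build R 'rV[R]_n lebesgue_outer
  lebesgue_outer0 lebesgue_outer_ge0 le_lebesgue_outer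
  lebesgue_outer_sigma_subadditive.

End lebesgue.

(* [R^n] with its Caratheodory, i.e., Lebesgue, measurable sets *)
Notation lebRn R n := (caratheodory_type (@lebesgue_outer R n)).

Notation borelRn R n := (g_sigma_algebraType (@open 'rV[R]_n)).

(* domain of the library's [completed_lebesgue_measure] *)
Notation lebR R := (caratheodory_type ((@wlength R idfun)^*)%mu).

Definition lebesgue_Rn (R : realType) (n : nat) : set (lebRn R n) -> \bar R :=
  @lebesgue_outer R n.
HB.instance Definition _ (R : realType) (n : nat) :=
  isMeasure.Build _ _ _ (@lebesgue_Rn R n)
    (@caratheodory_measure0 R _ (@lebesgue_outer R n))
    (@caratheodory_measure_ge0 R _ (@lebesgue_outer R n))
    (@caratheodory_measure_sigma_additive R _ (@lebesgue_outer R n)).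

Section surface.
Context {R : realType} {n : nat}.
Local Open Scope ereal_scope.

(* [(y_1, ..., y_(n-1), h)] *)
Definition snoc (y : 'rV[R]_n.-1) (h : R) : 'rV[R]_n :=
  \row_(i < n) (if insub (val i) is Some j then y ord0 j else h).

(* Surface integral over [S(x0, r)], [n >= 2]. Up to the equator, which has zero
   area, the sphere is the union of the graphs [x0 + (y, +-h y)], [|y| < r], of
   [h y = sqrt (r^2 - |y|^2)], whose area element is
   [sqrt (1 + |grad h y|^2) dy = (r / h y) dy]. *)
Definition sphere_integral (x0 : 'rV[R]_n) (r : R) (g : 'rV[R]_n -> \bar R) :
    \bar R :=
  \int[@lebesgue_Rn R n.-1]_(y in [set y | (enorm y < r)%R])
    (let h := Num.sqrt (r ^+ 2 - enorm y ^+ 2) in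
     (g (x0 + snoc y h)%R + g (x0 + snoc y (- h))%R) * (r / h)%:E).

Definition unit_sphere_area : \bar R := sphere_integral 0 1 (cst 1).

Definition spherical_mean (Q : 'rV[R]_n -> \bar R) (x0 : 'rV[R]_n) (r : R) :
    \bar R :=
  sphere_integral x0 r Q / (unit_sphere_area * (r ^+ n.-1)%:E).

End surface.

Section curves.
Context {R : realType} {n : nat}.

(* A continuous curve [[a, b] -> R^n]; the values of [cfun] outside [[a, b]] are
   irrelevant. *)
Record curve := Curve {
  cfun :> R -> 'rV[R]_n;
  cleft : R;
  cright : R;
  cleft_lt_right : cleft < cright;
  curve_continuous : {within `[cleft, cright], continuous cfun} }.

(* Euclidean counterpart of [total_variation] *)
Definition arc_length (g : R -> 'rV[R]_n) (a b : R) : \bar R :=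
  ereal_sup [set (\sum_(0 <= i < size s)
      enorm (g (nth b (a :: s) i.+1) - g (nth b (a :: s) i)))%:E |
    s in itv_partition a b].

Definition rectifiable (g : curve) : Prop :=
  (arc_length g (cleft g) (cright g) < +oo)%E.

(* The parametrization by arc length, on [[0, l]] with [l] the length of the
   curve: [g] is constant on the set of all [t] such that [g] has length [s] on
   [[cleft g, t]], so that the choice of [t] does not matter. *)
Definition arc_param (g : curve) (s : R) : 'rV[R]_n :=
  g (xget (cleft g) [set t | cleft g <= t <= cright g /\
                             arc_length g (cleft g) t = s%:E]).

Definition curve_integral (g : curve) (rho : 'rV[R]_n -> \bar R) : \bar R :=
  (\int[lebesgue_measure]_(s in
     `[0%R, fine (arc_length g (cleft g) (cright g))]) rho (arc_param g s))%E.

(* On a compact parameter interval, locally rectifiable means rectifiable. *)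
Definition admissible (Gamma : set curve) (rho : 'rV[R]_n -> \bar R) : Prop :=
  [/\ measurable_fun [set: borelRn R n] (rho : borelRn R n -> \bar R),
      forall x, (0 <= rho x)%E &
      forall g, Gamma g -> rectifiable g -> (1 <= curve_integral g rho)%E].

Definition modulus (p : R) (Gamma : set curve) : \bar R :=
  ereal_inf [set (\int[@lebesgue_Rn R n]_x (rho x `^ p))%E |
             rho in admissible Gamma].

Definition joining (E F G : set 'rV[R]_n) : set curve :=
  [set g : curve | [/\ E (g (cleft g)), F (g (cright g)) &
               forall t, cleft g < t < cright g -> G (g t)]].

End curves.

Section ring_homeomorphisms.
Context {R : realType} {n : nat}.

Definition homeomorphism_onto_image (D : set 'rV[R]_n)
    (f : 'rV[R]_n -> 'rV[R]_n) : Prop :=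
  {within D, continuous f} /\
  exists g : 'rV[R]_n -> 'rV[R]_n,
    (forall x, D x -> g (f x) = x) /\ {within f @` D, continuous g}.

Definition ring_homeomorphism (p : R) (D : set 'rV[R]_n) (x0 : 'rV[R]_n)
    (Q : 'rV[R]_n -> \bar R) (f : 'rV[R]_n -> 'rV[R]_n) : Prop :=
  [/\ domain D, D x0, homeomorphism_onto_image D f &
   forall r1 r2 : R, 0 < r1 -> r1 < r2 -> (r2%:E < dist_to_set x0 (frontier D))%E ->
   forall eta : R -> \bar R,
     measurable_fun (`]r1, r2[ : set (lebR R)) eta ->
     (forall r, r1 < r < r2 -> (0 <= eta r)%E) ->
     (\int[completed_lebesgue_measure]_(r in `]r1, r2[) eta r = 1)%E ->
     (modulus p (joining (f @` sphere x0 r1) (f @` sphere x0 r2) (f @` D)) <=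
      \int[@lebesgue_Rn R n]_(x in annulus x0 r1 r2)
        (Q x * eta (enorm (x - x0)%R) `^ p))%E].

Definition max_distortion (x0 : 'rV[R]_n) (f : 'rV[R]_n -> 'rV[R]_n) (r : R) :
    \bar R :=
  ereal_sup [set (enorm (f x - f x0))%:E | x in [set x | enorm (x - x0) <= r]].

End ring_homeomorphisms.

(* Main.v *)
(* Put [L = L(x0, f, R)], and let [G] be the family of curves joining [f S(x0, r0)] to
   [f S(x0, R)]. Both bounds on [M_p(G)] are extremal length
   estimates. Above, the test function [eta(t)] proportional to
   [t^(-(n - 1 + alpha) / (p - 1))] gives [M_p(G) <= omega K J^(1 - p)], where [J] is
   the integral of this power over [(r0, R)]. Below, every ray from [f x0] crosses
   [f S(x0, r0)] and then [f S(x0, R)] before the distance [L], because the sets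
   [f B(x0, r)] are open (invariance of domain), so that an admissible [rho] has
   integral at least [1] along the part of the ray in [[e, L]], for some [e > 0];
   Young's inequality on each ray and polar coordinates then give
   [M_p(G) >= omega ((p - n) / (p - 1))^(p - 1) L^(n - p)]. Comparing the two bounds
   yields [L >= K^(1 / (n - p)) ((p - n) / (p - 1) J)^((p - 1) / (p - n))], and [J] is
   explicit. *)

From HB Require Import structures.
Require Import Defs.
From mathcomp Require Import all_boot all_order all_algebra.
From mathcomp Require Import all_classical all_reals all_analysis.
From mathcomp Require Import measurable_realfun.
From mathcomp Require Import ring lra.
Set Implicit Arguments.
Unset Strict Implicit.
Unset Printing Implicit Defensive.
Import Order.TTheory GRing.Theory Num.Theory.
Import numFieldNormedType.Exports.
Local Open Scope classical_set_scope.
Local Open Scope ring_scope.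

(** * The Poincare-Miranda theorem *)

(** The lower bound can depend on [L] alone because [p > n] makes [s^(-(n - 1) / (p - 1))]
    integrable at [0]. With [gam = (p - n) / (p - 1)] its integral over [(0, L)] is [L^gam / gam],
    and the power [1 - p] of this is the constant [gam^(p - 1) L^(n - p)]; starting at [e > 0] only
    keeps the powers of [s] away from [0]. Invariance of domain is reached by elementary means: a
    mod 2 count on a grid gives the Poincare-Miranda theorem, and a perturbation argument reduces to
    it the fact that [f] covers a neighborhood of each of its values. The other obstacle is
    measurability. An admissible [rho] is Borel, and polar coordinates hold for it as an equality.
    But [Q] is only Lebesgue measurable, and its restriction to a given sphere may fail to be
    measurable, so that for [Q] only the inequality that is used gets proved. *)

Section cubical_cochains.
Local Open Scope ring_scope.
Implicit Types (D E : seq nat) (q r x : nat -> nat) (i j : nat).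

(** In this section [bool] is the field with two elements: [+] is exclusive or and [*] is
    conjunction. A cell of the grid is given by its lower corner [q] and the list [D] of its
    directions. *)
Definition upd q j (t : nat) : nat -> nat := fun i => if i == j then t else q i.

Definition stp j q : nat -> nat := upd q j (q j).+1.

Definition del j D := [seq i <- D | i != j].

(* The cup product of the mod 2 coboundaries of the labels in [ls], evaluated on the
   unit cube with lower corner [q] and directions [D]. This is
   a cocycle ([cup_closed]), so that Stokes' formula evaluates its sum over the grid
   to [1] ([grid_sum_cup]); a cell where it is [1] is one on which every label
   changes ([cup_witness]). *)
Fixpoint cup (ls : seq ((nat -> nat) -> bool)) D q : bool :=
  if ls is l :: ls' then
    \sum_(j <- D) (l (stp j q) + l q) * cup ls' (del j D) (stp j q)
  else 1.

Lemma addbb0 (b : bool) : b + b = 0. Proof. by case: b. Qed.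

(** The ordered pairs [(i, j)] and [(j, i)] cancel mod 2. Such a pair will stand for a face of
    codimension two, which lies on two faces of codimension one. *)
Lemma sum_symm_offdiag (D : seq nat) (F : nat -> nat -> bool) :
  (forall i j, F i j = F j i) ->
  \sum_(j <- D) \sum_(i <- del j D) F j i = 0.
Proof.
move=> Fs; under eq_bigr do rewrite big_filter.
elim: D => [|x D IH]; first by rewrite big_nil.
rewrite big_cons big_cons eqxx /=.
under [X in _ + X]eq_bigr do rewrite big_cons.
rewrite [X in _ + X](eq_bigr (fun j => (if x != j then F j x else 0) +
  \sum_(i <- D | i != j) F j i)); last first.
  by move=> j _; case: ifP => //; rewrite add0r.
rewrite big_split /= IH addr0 -[X in _ + X]big_mkcond/=.
under [X in _ + X]eq_bigl do rewrite eq_sym.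
under [X in _ + X]eq_bigr do rewrite Fs.
exact: addbb0.
Qed.

Lemma delC i j D : del i (del j D) = del j (del i D).
Proof. by rewrite /del -!filter_predI; apply: eq_filter => k /=; rewrite andbC. Qed.

Lemma stpC i j q : stp i (stp j q) = stp j (stp i q).
Proof.
have [->//|ij] := eqVneq i j; apply: boolp.funext => k.
rewrite /stp /upd /= (negbTE ij) (eq_sym j) (negbTE ij).
by case: eqVneq => // ->; rewrite (negbTE ij).
Qed.

(** The two sides are the sums over the far and over the near faces of a cube, so that their
    equality says that the coboundary vanishes mod 2. It is the Leibniz rule: the induction
    hypothesis handles [cup ls], and symmetric pairs of directions cancel. *)
Lemma cup_closed (ls : seq ((nat -> nat) -> bool)) D q :
  \sum_(j <- D) cup ls (del j D) (stp j q) = \sum_(j <- D) cup ls (del j D) q.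
Proof.
elim: ls D q => [//|l ls IH] D q /=.
pose w i j q := cup ls (del i (del j D)) q.
have wC i j r : w i j r = w j i r by rewrite /w delC.
(* Far faces: the terms with [l (stp i (stp j q))] are symmetric in [i] and [j]. In the others the
   induction hypothesis, on the face with corner [stp j q], moves the argument of [w] back to that
   corner. *)
have e1 : \sum_(j <- D) \sum_(i <- del j D)
    (l (stp i (stp j q)) + l (stp j q)) * w i j (stp i (stp j q)) =
    \sum_(j <- D) \sum_(i <- del j D) l (stp j q) * w i j (stp j q).
  rewrite (eq_bigr (fun j => \sum_(i <- del j D)
      l (stp i (stp j q)) * w i j (stp i (stp j q)) +
      \sum_(i <- del j D) l (stp j q) * w i j (stp i (stp j q)))); last first.
    by move=> j _; rewrite -big_split /=; apply: eq_bigr => i _ /=; rewrite -mulrDl.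
  rewrite big_split /= sum_symm_offdiag ?add0r; last first.
    by move=> i j; rewrite stpC wC.
  by apply: eq_bigr => j _; rewrite -!mulr_sumr /w IH.
(* Near faces: here the terms with [l q] become symmetric, once the induction hypothesis has moved
   the argument of [w] back to [q]. *)
have e2 : \sum_(j <- D) \sum_(i <- del j D)
    (l (stp i q) + l q) * w i j (stp i q) =
    \sum_(j <- D) \sum_(i <- del j D) l (stp i q) * w i j (stp i q).
  rewrite (eq_bigr (fun j => \sum_(i <- del j D) l (stp i q) * w i j (stp i q) +
      \sum_(i <- del j D) l q * w i j (stp i q))); last first.
    by move=> j _; rewrite -big_split /=; apply: eq_bigr => i _ /=; rewrite -mulrDl.
  rewrite big_split /= -[RHS]addr0; congr (_ + _).
  under eq_bigr do rewrite -mulr_sumr IH mulr_sumr.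
  by apply: sum_symm_offdiag => i j; rewrite delC.
(* The two sums that remain differ by the exchange of [i] and [j], so that their difference is
   symmetric as well. *)
rewrite e1 e2; apply/eqP; rewrite -subr_eq0; apply/eqP.
rewrite -sumrB.
under eq_bigr do rewrite -sumrB.
apply: sum_symm_offdiag => i j. rewrite !(wC j i).
by case: (_ * _); case: (_ * _).
Qed.

Variable p : nat.

Fixpoint grid_sum D (H : (nat -> nat) -> bool) r : bool :=
  if D is j :: D' then \sum_(t < p) grid_sum D' H (upd r j t) else H r.

Lemma grid_sum_ext D (H H' : (nat -> nat) -> bool) r :
  (forall q, (forall i, i \notin D -> q i = r i) -> H q = H' q) ->
  grid_sum D H r = grid_sum D H' r.
Proof.
elim: D r => [|j D IH] r HH /=; first exact: HH.
apply: eq_bigr => t _; apply: IH => q qr; apply: HH => i.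
by rewrite inE negb_or => /andP[ij iD]; rewrite qr// /upd (negbTE ij).
Qed.

Lemma grid_sumD D (H H' : (nat -> nat) -> bool) r :
  grid_sum D (fun q => H q + H' q) r = grid_sum D H r + grid_sum D H' r.
Proof.
elim: D r => [|j D IH] r //=; rewrite -big_split /=; apply: eq_bigr => t _.
exact: IH.
Qed.

Lemma grid_sum0 D r : grid_sum D (fun=> 0) r = 0.
Proof. by elim: D r => [|j D IH] r //=; apply: big1 => t _; apply: IH. Qed.

Lemma grid_sum_sum D (s : seq nat) (H : nat -> (nat -> nat) -> bool) r :
  grid_sum D (fun q => \sum_(j <- s) H j q) r = \sum_(j <- s) grid_sum D (H j) r.
Proof.
elim: s => [|j s IH].
  rewrite big_nil -[RHS](grid_sum0 D r).
  by apply: grid_sum_ext => q _; rewrite big_nil.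
rewrite big_cons -IH -grid_sumD; apply: grid_sum_ext => q _.
by rewrite big_cons.
Qed.

Lemma updC q i j s t : i != j -> upd (upd q i s) j t = upd (upd q j t) i s.
Proof.
move=> ij; apply: boolp.funext => k; rewrite /upd.
by case: eqVneq => // ->; case: eqVneq ij => // ->; rewrite eqxx.
Qed.

Lemma grid_sum_stp D H r j : j \notin D ->
  grid_sum D (fun q => H (stp j q)) r = grid_sum D H (stp j r).
Proof.
elim: D r => [//|i D IH] r /=; rewrite inE negb_or => /andP[ji jD].
apply: eq_bigr => t _; rewrite IH//; congr grid_sum.
by rewrite /stp updC 1?eq_sym// [upd r i t j]/upd (negbTE ji).
Qed.

(** In direction [j] every inner layer is counted twice and cancels mod 2, which leaves the two
    outer faces of the grid. *)
Lemma grid_sum_telescope D H r j : uniq D -> j \in D ->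
  grid_sum D (fun q => H (stp j q) + H q) r =
  grid_sum (del j D) H (upd r j 0) + grid_sum (del j D) H (upd r j p).
Proof.
elim: D r => [//|i D IH] r /= /andP[iD uD]; rewrite inE.
have [-> _|ij /= jD] := eqVneq j i.
  rewrite /= (_ : del i D = D); last first.
    by apply/all_filterP/allP => k kD /=; apply: contraNneq iD => <-.
  under eq_bigr do rewrite grid_sumD grid_sum_stp//.
  rewrite -[\sum_(t < p) _](big_mkord predT (fun t =>
    grid_sum D H (stp i (upd r i t)) + grid_sum D H (upd r i t))).
  have uu t : stp i (upd r i t) = upd r i t.+1.
    by apply: boolp.funext => k; rewrite /stp /upd eqxx; case: eqP.
  under eq_bigr do rewrite uu.
  elim: p => [|k IHk]; first by rewrite big_geq// addbb0.
  rewrite big_nat_recr //= IHk.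
  by case: (grid_sum D H _); case: (grid_sum D H _); case: (grid_sum D H _).
rewrite -big_split; apply: eq_bigr => t _ /=.
by rewrite IH// !(updC _ _ _ ij).
Qed.

(** As [i] is not a direction of the cell, all its vertices share their coordinate [i], hence the
    label [i], and the coboundary of this label vanishes there. *)
Lemma cup_eq0 (l : nat -> (nat -> nat) -> bool) E D q i b :
  i \in E -> i \notin D -> (forall x, x i = q i -> l i x = b) ->
  cup (map l E) D q = 0.
Proof.
elim: E D q => [//|e E IH] D q /=; rewrite inE => ieE iD lb.
have stpi j : j \in D -> stp j q i = q i.
  by move=> jD; rewrite /stp /upd; case: eqVneq jD iD => // -> ->.
rewrite big_seq; apply: big1 => j jD.
have [<-|ei] := eqVneq i e; first by rewrite !lb ?stpi// addbb0 mul0r.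
rewrite IH ?mulr0//.
- by move: ieE; rewrite (negbTE ei).
- by rewrite mem_filter negb_and iD orbT.
- by move=> x xi; apply: lb; rewrite xi stpi.
Qed.

(** Stokes' formula by induction on the dimension. Only the faces of the grid contribute. On those
    orthogonal to a direction [i != e] the label [i] is constant and the cochain vanishes. On the
    face [x e = 0] the factor [l e] is [0]; on the face [x e = p] it is [1], which leaves the same
    sum in one dimension less. *)
Lemma grid_sum_cup (l : nat -> (nat -> nat) -> bool) D r :
  (forall i x, x i = 0%N -> ~~ l i x) -> (forall i x, x i = p -> l i x) ->
  uniq D -> grid_sum D (cup (map l D) D) r.
Proof.
move=> l0 lp; elim: D r => [//|e D IH] r uD.
have /andP[eD uD'] := uD.
have delD : del e (e :: D) = D.
  rewrite /del/= eqxx/=; apply/all_filterP/allP => k kD /=.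
  by apply: contraNneq eD => <-.
(* By [cup_closed], the cochain on [e :: D] is the coboundary of the product of the label [e] with
   [cup (map l D)]; [H j] is the value of this product on the face orthogonal to [j]. *)
pose H j q := l e q * cup (map l D) (del j (e :: D)) q.
have -> : grid_sum (e :: D) (cup (map l (e :: D)) (e :: D)) r =
    \sum_(j <- e :: D) grid_sum (e :: D) (fun q => H j (stp j q) + H j q) r.
  rewrite -grid_sum_sum; apply: grid_sum_ext => q _.
  rewrite big_split/= /H -mulr_sumr -cup_closed mulr_sumr -big_split.
  by apply: eq_bigr => j _ /=; rewrite -mulrDl.
rewrite big_seq (eq_bigr (fun j => grid_sum (del j (e :: D)) (H j) (upd r j 0) +
  grid_sum (del j (e :: D)) (H j) (upd r j p))); last first.
  by move=> j jD; rewrite grid_sum_telescope.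
rewrite -big_seq big_cons delD [X in _ + X]big_seq.
rewrite [X in _ + X]big1 ?addr0; last first.
  move=> i iD; have ie : i != e by apply: contraNneq eD => <-.
  have idel : i \notin del i (e :: D) by rewrite mem_filter eqxx.
  rewrite !(@grid_sum_ext _ _ (fun=> 0)) ?grid_sum0 ?addr0// => q qr; rewrite /H.
    rewrite (@cup_eq0 _ _ _ _ i true) ?mulr0// => x xq; apply: lp.
    by rewrite xq qr// /upd eqxx.
  rewrite (@cup_eq0 _ _ _ _ i false) ?mulr0// => x xq; apply/negbTE/l0.
  by rewrite xq qr// /upd eqxx.
rewrite (@grid_sum_ext _ (H e) (fun=> 0)) ?grid_sum0 ?add0r; last first.
  by move=> q qr; rewrite /H (negbTE (l0 _ _ _)) ?mul0r// qr// /upd eqxx.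
rewrite (@grid_sum_ext _ (H e) (cup (map l D) D)); first exact: IH.
by move=> q qr; rewrite /H (lp e) ?delD ?mul1r// qr// /upd eqxx.
Qed.

Lemma grid_sum_witness D H r : grid_sum D H r ->
  exists q, [/\ forall i, i \in D -> (q i < p)%N,
                forall i, i \notin D -> q i = r i & H q].
Proof.
elim: D r => [|j D IH] r /=; first by move=> Hr; exists r.
have [[t gt]|no] := boolp.pselect (exists t : 'I_p, grid_sum D H (upd r j t)).
  have [q [qp qr Hq]] := IH _ gt => _; exists q; split => // i.
    rewrite inE; have [iD _|iD] := boolP (i \in D); first exact: qp.
    by rewrite orbF qr// /upd => /eqP ->; rewrite eqxx.
  rewrite inE negb_or => /andP[ij iD]; rewrite qr// /upd (negbTE ij)//.
rewrite big1// => t _; apply/negbTE/negP => gt; apply: no; by exists t.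
Qed.

Lemma cup_witness (l : nat -> (nat -> nat) -> bool) E D q i :
  cup (map l E) D q -> i \in E ->
  exists x y, [/\ forall c, (q c <= x c <= (q c).+1)%N,
                  forall c, (q c <= y c <= (q c).+1)%N,
                  l i x & ~~ l i y].
Proof.
(* The stronger claim records that only the directions in [D] are used. Without it, the induction on
   the face at [stp j q] could step in direction [j] twice and leave the cell. *)
suff: cup (map l E) D q -> i \in E ->
  exists x y, [/\ forall c, x c = q c \/ (c \in D /\ x c = (q c).+1),
                  forall c, y c = q c \/ (c \in D /\ y c = (q c).+1),
                  l i x & ~~ l i y].
  move=> + cq iE => /(_ cq iE)[x [y [xq yq lx ly]]].
  exists x, y; split => // c.
    by case: (xq c) => [|[_]] ->; rewrite !leqnn !leqnSn.
  by case: (yq c) => [|[_]] ->; rewrite !leqnn !leqnSn.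
elim: E D q => [//|e E IH] D q /=.
have [[j [jD lj cj]]|no] := boolp.pselect (exists j, [/\ j \in D,
   is_true (l e (stp j q) + l e q)%R & cup (map l E) (del j D) (stp j q)]).
  move=> _; rewrite inE; have sj c : stp j q c = q c \/ c \in D /\ stp j q c = (q c).+1.
    by rewrite /stp /upd; case: eqP => [->|]; [right|left].
  have qq c : q c = q c \/ c \in D /\ q c = (q c).+1 by left.
  case/predU1P => [->|iE].
    case l1: (l e (stp j q)); last first.
      exists q, (stp j q); split => //; last by rewrite l1.
      by move: lj; rewrite l1.
    by exists (stp j q), q; split => //; move: lj; rewrite l1; case: (l e q).
  have [x [y [xq yq lx ly]]] := IH _ _ cj iE.
  have key z : (forall c, z c = stp j q c \/ c \in del j D /\ z c = (stp j q c).+1) ->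
      forall c, z c = q c \/ (c \in D /\ z c = (q c).+1).
    move=> zq c; case: (zq c) => [->|[]]; first exact: sj.
    rewrite mem_filter => /andP[cj' cD] ->; right; split => //.
    by rewrite /stp /upd (negbTE cj').
  by exists x, y; split => //; apply: key.
rewrite big_seq big1// => j jD; apply/negbTE/negP => /andP[lj cj].
by apply: no; exists j.
Qed.

Lemma discrete_miranda (n : nat) (l : nat -> (nat -> nat) -> bool) :
  (forall i x, x i = 0%N -> ~~ l i x) -> (forall i x, x i = p -> l i x) ->
  exists q, (forall i, i < n -> q i < p)%N /\
    forall i, (i < n)%N -> exists x y,
      [/\ forall c, (q c <= x c <= (q c).+1)%N,
          forall c, (q c <= y c <= (q c).+1)%N, l i x & ~~ l i y].
Proof.
move=> l0 lp.
have [q [qp _ cq]] := grid_sum_witness (grid_sum_cup (fun=> 0%N) l0 lp (iota_uniq 0 n)).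
exists q; split => [i ni|i ni]; first by apply: qp; rewrite mem_iota.
by apply: (cup_witness cq); rewrite mem_iota.
Qed.

End cubical_cochains.

(** * From the grid to continuous maps *)

Section miranda.
Context {R : realType} {n : nat}.
Implicit Types (a x y : 'rV[R]_n) (d : R).

Lemma normr_coord_le x i : `|x ord0 i| <= `|x|.
Proof.
rewrite [leRHS]/Num.norm /= mx_normrE; apply/bigmax_geP; right => /=.
by exists (ord0, i).
Qed.

Lemma normr_rV_le x d : 0 <= d -> (forall i, `|x ord0 i| <= d) -> `|x| <= d.
Proof.
move=> d0 xd; rewrite [leLHS]/Num.norm /= mx_normrE; apply/bigmax_leP => /=.
by split => // -[i j] _ /=; rewrite (ord1 i).
Qed.

Lemma compact_cube a d : compact [set x | `|x - a| <= d].
Proof.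
apply: bounded_closed_compact.
  exists (`|a| + d); split; first exact: num_real.
  move=> M aM x /= xd; rewrite -(subrK a x) (le_trans (ler_normD _ _))//.
  by rewrite addrC (le_trans _ (ltW aM))// lerD2l.
have := @closed_closed_ball_ _ _ a d; rewrite /closed_ball_.
by under eq_set do rewrite distrC.
Qed.

(** The cells given by [discrete_miranda] on finer and finer grids accumulate at a point near which
    every coordinate of [F] takes both weak signs. *)
Lemma poincare_miranda a d (F : 'rV[R]_n -> 'rV[R]_n) : 0 < d ->
  {within [set x | `|x - a| <= d], continuous F} ->
  (forall x i, `|x - a| <= d -> x ord0 i = a ord0 i - d -> F x ord0 i <= 0) ->
  (forall x i, `|x - a| <= d -> x ord0 i = a ord0 i + d -> 0 <= F x ord0 i) ->
  exists2 x, `|x - a| <= d & F x = 0.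
Proof.
move=> d0 cF F0 F1.
pose C : set 'rV[R]_n := [set x | `|x - a| <= d].
pose pt p (q : nat -> nat) : 'rV[R]_n :=
  \row_(i < n) (a ord0 i - d + 2 * d * ((q i)%:R / p%:R)).
have Cpt p q : (0 < p)%N -> (forall i, (i < n)%N -> q i <= p)%N -> C (pt p q).
  move=> p0 qp; apply: normr_rV_le; first exact: ltW.
  move=> i; rewrite !mxE.
  have : 0 <= (q i)%:R / p%:R :> R by rewrite divr_ge0.
  have : (q i)%:R / p%:R <= 1 :> R.
    by rewrite ler_pdivrMr ?ltr0n// mul1r ler_nat qp.
  move: (_ / _) => s s1 s0.
  rewrite (_ : _ - _ = d * (2 * s - 1)); last by ring.
  rewrite normrM (gtr0_norm d0) ler_piMr ?(ltW d0)// ler_norml; lra.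
(* The label is the sign of a coordinate of [F], except on the two faces, where it is prescribed
   because [F] may vanish there; [true] for [i >= n] is a default value. *)
pose l (p i : nat) (q : nat -> nat) : bool :=
  if q i == 0%N then false else if q i == p then true else
  if insub i is Some j then 0 < F (pt p q) ord0 j else true.
have lF0 p (i : 'I_n) q : (0 < p)%N -> (forall i, (i < n)%N -> q i <= p)%N ->
    l p i q -> 0 <= F (pt p q) ord0 i.
  move=> p0 qp; rewrite /l; case: ifP => // _; case: ifPn => [/eqP qip _|_].
    apply: F1; first exact: Cpt.
    by rewrite mxE qip divff ?pnatr_eq0 -?lt0n//; ring.
  by rewrite valK => /ltW.
have lF1 p (i : 'I_n) q : (0 < p)%N -> (forall i, (i < n)%N -> q i <= p)%N ->
    ~~ l p i q -> F (pt p q) ord0 i <= 0.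
  move=> p0 qp; rewrite /l; case: ifPn => [/eqP qi0 _|_].
    apply: F0; first exact: Cpt.
    by rewrite mxE qi0 mul0r mulr0 addr0.
  by case: ifP => // _; rewrite valK -leNgt.
have ptd p (q x : nat -> nat) : (0 < p)%N -> (forall c, q c <= x c <= (q c).+1)%N ->
    `|pt p x - pt p q| <= 2 * d / p%:R.
  move=> p0 qx; apply: normr_rV_le; first by rewrite divr_ge0// mulr_ge0// ltW.
  move=> i; rewrite !mxE.
  rewrite (_ : _ - _ = 2 * d / p%:R * ((x i)%:R - (q i)%:R)); last by ring.
  have /andP[qx1 qx2] := qx i.
  have dp0 : 0 <= 2 * d / p%:R by rewrite divr_ge0// mulr_ge0// ltW.
  rewrite normrM (ger0_norm dp0) ler_piMr//.
  by rewrite -natrB// ger0_norm// lern1 leq_subLR addn1.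
have [z zP] : {z : nat -> 'rV[R]_n & forall p, C (z p) /\ forall i, exists x y,
   [/\ C x, C y, `|x - z p| <= 2 * d / p.+1%:R,
       `|y - z p| <= 2 * d / p.+1%:R & 0 <= F x ord0 i /\ F y ord0 i <= 0] }.
  apply: (@choice _ _ (fun p zp => C zp /\ forall i, exists x y,
   [/\ C x, C y, `|x - zp| <= 2 * d / p.+1%:R,
       `|y - zp| <= 2 * d / p.+1%:R & 0 <= F x ord0 i /\ F y ord0 i <= 0])) => p.
  have [i x x0|i x xp|q [qp qP]] := @discrete_miranda p.+1 n (l p.+1).
  - by rewrite /l x0.
  - by rewrite /l xp eqxx.
  have le_xp (x : nat -> nat) i : (forall c, q c <= x c <= (q c).+1)%N -> (i < n)%N ->
      (x i <= p.+1)%N.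
    by move=> qx ni; have /andP[_ /leq_trans] := qx i; apply; exact: qp.
  exists (pt p.+1 q); split.
    by apply: Cpt => // i ni; exact/ltnW/qp.
  move=> i; have [x [y [qx qy lx ly]]] := qP i (ltn_ord i).
  exists (pt p.+1 x), (pt p.+1 y); split.
  - by apply: Cpt => // j; exact: le_xp.
  - by apply: Cpt => // j; exact: le_xp.
  - exact: ptd.
  - exact: ptd.
  - split; [apply: lF0|apply: lF1] => // j; exact: le_xp.
have [c [Cc clc]] : C `&` cluster (z @ \oo) !=set0.
  apply: compact_cube; by exists 0%N => // p _; have [] := zP p.
exists c => //; apply/rowP => i; rewrite mxE.
(* If a coordinate of [F c] were not [0], it would keep a strict sign on a ball around [c], which
   contains points [x] and [y] of opposite weak signs. *)
apply/eqP; apply: contraT => Fc0.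
have e0 : 0 < `|F c ord0 i| by rewrite normr_gt0.
move/subspace_continuousP : cF => /(_ c Cc) cF.
have : \forall x \near within C (nbhs c), `|F c ord0 i - F x ord0 i| < `|F c ord0 i|.
  have : (fun x => F x ord0 i) @ within C (nbhs c) --> F c ord0 i.
    exact: (cvg_comp _ _ cF (@coord_continuous _ _ _ ord0 i (F c))).
  by move/cvgrPdist_lt => /(_ _ e0).
rewrite near_withinE => /nbhs_ballP[r /= r0 rF].
have rC x : C x -> `|c - x| < r -> `|F c ord0 i - F x ord0 i| < `|F c ord0 i|.
  by move=> Cx cx; apply: rF => //; rewrite -ball_normE.
have [p0 _ p0P] : \forall p \near \oo, 2 * d / p.+1%:R < r / 2.
  have := @cvg_harmonic R => /cvgrPdist_lt.
  have re : 0 < r / 2 / (2 * d) by rewrite !divr_gt0// mulr_gt0.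
  move=> /(_ _ re) [p0 _ p0P]; exists p0 => // p /p0P /=.
  rewrite sub0r normrN gtr0_norm// ltr_pdivlMr ?mulr_gt0//.
  by rewrite mulrC.
have [_ /= [[p pp0 <-] cz]] : (z @` [set p | (p0 <= p)%N]) `&` ball c (r / 2) !=set0.
  apply: clc; last by apply: nbhsx_ballx; rewrite divr_gt0.
  by exists p0 => // p /= pp; exists p.
have [_ /(_ i)[x [y [Cx Cy xz yz [Fx Fy]]]]] := zP p.
have close w : `|w - z p| <= 2 * d / p.+1%:R -> `|c - w| < r.
  move=> wz; rewrite -(subrK (z p) c) -addrA (le_lt_trans (ler_normD _ _))//.
  rewrite [ltRHS]splitr ltrD//; first by move: cz; rewrite -ball_normE.
  by rewrite distrC (le_lt_trans wz)//; exact: p0P.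
have := rC _ Cx (close _ xz); have := rC _ Cy (close _ yz).
have [F0'|F0'|F0'] := ltrgtP (F c ord0 i) 0.
- rewrite (ltr0_norm F0') !ltr_norml; lra.
- rewrite (gtr0_norm F0') !ltr_norml; lra.
- by move: Fc0; rewrite F0' eqxx.
Qed.

End miranda.

(** * Invariance of domain *)

Section lipschitz_maps.
Context {R : realType}.

Lemma cvg_row {T : Type} (F : set_system T) {FF : Filter F} n
    (f : T -> 'rV[R]_n) (l : 'rV[R]_n) :
  (forall i, (fun x => f x ord0 i) @ F --> l ord0 i) -> f @ F --> l.
Proof.
move=> fl; apply/cvgrPdist_lt => e e0.
have e20 : 0 < e / 2 by rewrite divr_gt0.
have : \forall x \near F, forall i, `|l ord0 i - f x ord0 i| < e / 2.
  apply: filter_forall => i.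
  by move/cvgrPdist_lt : (fl i); exact.
apply: filterS => x xP; rewrite (@le_lt_trans _ _ (e / 2))//; last first.
  by rewrite ltr_pdivrMr// ltr_pMr// ltr1n.
by apply: normr_rV_le; [exact: ltW|move=> i; rewrite !mxE ltW].
Qed.

Lemma exists_grid_cell (N : nat) (s : R) : (0 < N)%N -> 0 <= s <= N%:R ->
  exists t : 'I_N, (t%:R <= s <= t.+1%:R).
Proof.
case: N => // N _ /andP[s0 sN].
have [sltN|Ns] := ltP s N%:R.
  have tN : (Num.truncn s < N)%N by rewrite truncn_lt_nat.
  exists (Ordinal (leq_trans tN (leqnSn N))) => /=.
  by have /andP[-> /ltW ->] := truncn_itv s0.
by exists ord_max => /=; rewrite Ns sN.
Qed.

(* The image of the boundary of a cube is too small to contain a cube: [M^n]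
   points of a cube that are [delta / M] apart would need to lie in the images of
   [O(M^(n-1))] cells with images of smaller diameter. *)
Lemma lipschitz_sphere_avoids n (P : 'rV[R]_n.+1 -> 'rV[R]_n.+1) (k : R)
    (c : 'rV[R]_n.+1) (eps delta : R) :
  0 < eps -> 0 < delta -> (forall x y, `|P x - P y| <= k * `|x - y|) ->
  exists2 v, `|v| <= delta & forall y, `|y - c| = eps -> P y <> v.
Proof.
move=> eps0 delta0 Plip; apply: contrapT => noav.
have hit v : `|v| <= delta -> exists y, `|y - c| = eps /\ P y = v.
  move=> vd; apply: contrapT => nov; apply: noav; exists v => // y yc Pyv.
  by apply: nov; exists y.
(* There are [M^(n+1)] target points and [2 (n+1) (kk M)^n] boundary cells. The choice of [kk] makes
   the image of a cell of side [2 eps / (kk M)] smaller than [delta / M], and that of [M] makes the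
   cells fewer than the points. *)
pose kk := (Num.truncn (2 * eps * `|k| / delta)).+1.
have kkP : 2 * eps * `|k| < kk%:R * delta.
  rewrite -ltr_pdivrMr//.
  have : 0 <= 2 * eps * `|k| / delta by rewrite divr_ge0 ?mulr_ge0// ltW.
  by move/truncn_itv => /andP[].
pose M := (2 * n.+1 * kk ^ n).+1.
pose N := (kk * M)%N.
have N0 : (0 < N)%N by rewrite muln_gt0.
pose v (j : {ffun 'I_n.+1 -> 'I_M}) : 'rV[R]_n.+1 :=
  \row_i (delta * ((j i)%:R / M%:R)).
have vd j : `|v j| <= delta.
  apply: normr_rV_le; first exact: ltW.
  move=> i; rewrite mxE ger0_norm ?mulr_ge0 ?divr_ge0 ?(ltW delta0)//.
  rewrite ler_piMr ?(ltW delta0)// ler_pdivrMr ?ltr0n// mul1r ler_nat.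
  exact: ltnW.
have [y yP] := choice (fun j => hit (v j) (vd j)).
(* A cell of the boundary of the cube: the coordinate that attains the norm, its sign, and the
   position in the face. *)
pose piece := ('I_n.+1 * bool * {ffun 'I_n -> 'I_N})%type.
pose inp (q : piece) (x : 'rV[R]_n.+1) : Prop :=
  x ord0 q.1.1 = c ord0 q.1.1 + (-1) ^+ q.1.2 * eps /\
  forall l, (q.2 l)%:R <= (x ord0 (lift q.1.1 l) - c ord0 (lift q.1.1 l) + eps) /
     (2 * eps) * N%:R <= (q.2 l).+1%:R.
have ex_piece x : `|x - c| = eps -> exists q, inp q x.
  move=> xc.
  have : mx_norm (x - c) != 0 by rewrite [mx_norm _]xc gt_eqF.
  move=> /mx_norm_neq0[[i0 i]]; rewrite [mx_norm _]xc /= (ord1 i0) => xi {i0}.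
  have xl l : 0 <= (x ord0 l - c ord0 l + eps) / (2 * eps) * N%:R <= N%:R.
    have : `|(x - c) ord0 l| <= eps by rewrite -xc normr_coord_le.
    rewrite !mxE ler_norml => /andP[xl1 xl2].
    rewrite mulr_ge0 ?divr_ge0 ?mulr_ge0 ?(ltW eps0)//=; last by lra.
    rewrite ler_piMl// ler_pdivrMr ?mulr_gt0//; lra.
  have [t tP] := choice (fun l => exists_grid_cell N0 (xl (lift i l))).
  exists (i, (x ord0 i < c ord0 i), [ffun l => t l]); split => /=.
    move: xi; rewrite !mxE; have [xc0|xc0] := ltP.
      by rewrite ltr0_norm ?subr_lt0// expr1 => ->; ring.
    by rewrite ger0_norm ?subr_ge0// expr0 => ->; ring.
  by move=> l; rewrite ffunE; exact: tP.
have [q qP] := choice (fun j => ex_piece (y j) (yP j).1).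
(* Two target points with preimages in the same cell would be less than [delta / M] apart. *)
have qinj : injective q.
  move=> j j' qjj'; apply/ffunP => i; apply/val_inj => /=; apply/eqP.
  apply: contraT => jj'.
  have yy : `|y j - y j'| <= 2 * eps / N%:R.
    apply: normr_rV_le; first by rewrite divr_ge0// mulr_ge0// ltW.
    move=> l; rewrite !mxE.
    have [e1 e2] := qP j; have := qP j'; rewrite -qjj' => -[e1' e2'].
    case: (unliftP (q j).1.1 l) => [l' ->|->]; last first.
      rewrite e1 e1' subrr normr0.
      by rewrite divr_ge0// mulr_ge0// ltW.
    move: (e2 l') (e2' l'); set A := _ * N%:R; set A' := _ * N%:R.
    move=> tA tA'; have AA' : `|A - A'| <= 1.
      by move: tA tA'; rewrite ler_norml -natr1; lra.
    have N1 : N%:R != 0 :> R by rewrite pnatr_eq0 -lt0n.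
    have -> : y j ord0 (lift (q j).1.1 l') - y j' ord0 (lift (q j).1.1 l') =
        2 * eps / N%:R * (A - A').
      by rewrite /A /A'; field; rewrite gt_eqF.
    have eN : 0 <= 2 * eps / N%:R by rewrite divr_ge0// mulr_ge0// ltW.
    by rewrite normrM (ger0_norm eN) ler_piMr.
  have vv : `|v j - v j'| <= `|k| * (2 * eps / N%:R).
    rewrite -(yP j).2 -(yP j').2 (le_trans (Plip _ _))//.
    by rewrite (le_trans (ler_norm _))// normrM normr_id ler_wpM2l.
  have : delta / M%:R <= `|k| * (2 * eps / N%:R).
    apply: le_trans vv; apply: le_trans (normr_coord_le _ i).
    have -> : (v j - v j') ord0 i = delta / M%:R * ((j i)%:R - (j' i)%:R).
      by rewrite !mxE; ring.
    have dM : 0 <= delta / M%:R by rewrite divr_ge0// ltW.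
    rewrite normrM (ger0_norm dM) ler_peMr//.
    wlog : j j' {qjj' yy} jj' / (j i < j' i)%N.
      move=> wlg; have := jj'; rewrite neq_ltn => /orP[|] jltj'; first exact: wlg.
      by rewrite distrC; apply: wlg => //; rewrite eq_sym.
    by move=> jltj'; rewrite distrC -natrB 1?ltnW// normr_nat ler1n subn_gt0.
  have M0 : 0 < M%:R :> R by rewrite ltr0n.
  have kk0 : 0 < kk%:R :> R by rewrite ltr0n.
  rewrite ler_pdivrMr// /N natrM (_ : _ * M%:R = 2 * eps * `|k| / kk%:R).
    by rewrite ler_pdivlMr// mulrC leNgt kkP.
  by field; rewrite !gt_eqF.
have := leq_card q qinj.
rewrite card_prod card_prod !card_ffun !card_ord card_bool.
by rewrite /N expnMn expnS mulnA leq_pmul2r ?expn_gt0// (mulnC n.+1) ltnn.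
Qed.

(** The approximation is the infimal convolution of [g] with [k |y - z|] over the ball [B]. It is
    [k]-Lipschitz everywhere and at most [g] on [B]. If no [k] were good enough, there would be
    points of [B], closer and closer to each other, at which [g] differs by more than [eta]. *)
Lemma lipschitz_approximation n (g : 'rV[R]_n -> R) (c : 'rV[R]_n) (rho eta : R) :
  continuous g -> 0 <= rho -> 0 < eta ->
  exists (h : 'rV[R]_n -> R) (k : R),
    (forall x y, `|h x - h y| <= k * `|x - y|) /\
    forall y, `|y - c| <= rho -> `|h y - g y| <= eta.
Proof.
move=> cg rho0 eta0.
pose B : set 'rV[R]_n := [set z | `|z - c| <= rho].
have Bc : B c by rewrite /B/= subrr normr0.
have cB : compact B by exact: compact_cube.
have [M M0 gM] : exists2 M, 0 < M & forall z, B z -> `|g z| <= M.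
  have : bounded_set (g @` B).
    by apply/compact_bounded/continuous_compact => //; exact: continuous_subspaceT.
  by move=> /ex_strict_bound_gt0[M M0 gM]; exists M => // z Bz; apply/ltW/gM; exists z.
pose S (k : nat) y : set R := [set g z + k%:R * `|y - z| | z in B].
have S0 k y : S k y !=set0 by exists (g c + k%:R * `|y - c|), c.
have Slb k y : has_lbound (S k y).
  exists (- M) => _ [z Bz <-]; have := gM z Bz; rewrite ler_norml => /andP[gz _].
  by rewrite (le_trans gz)// lerDl mulr_ge0.
pose h k y := inf (S k y).
have h1 k x y : h k x - h k y <= k%:R * `|x - y|.
  rewrite lerBlDr -lerBlDl; apply: lb_le_inf => // _ [z Bz <-].
  rewrite lerBlDl (le_trans (ge_inf (Slb k x) (ex_intro2 _ _ z Bz erefl)))//.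
  by rewrite addrCA lerD2l -mulrDr ler_wpM2l// ler_distD.
have hlip k x y : `|h k x - h k y| <= k%:R * `|x - y|.
  by rewrite ler_norml h1 andbT lerNl opprB (le_trans (h1 _ _ _))// distrC.
have [[k kP]|nok] :=
    pselect (exists k, forall y, B y -> `|h k y - g y| <= eta).
  by exists (h k), k%:R; split => //; exact: hlip.
have bad k : exists yz : 'rV[R]_n * 'rV[R]_n,
    [/\ B yz.1, B yz.2 & g yz.2 + k%:R * `|yz.1 - yz.2| < g yz.1 - eta].
  apply: contrapT => nobad; apply: nok; exists k => y By.
  have hg : h k y <= g y.
    by apply: ge_inf => //; exists y => //; rewrite subrr normr0 mulr0 addr0.
  rewrite ler0_norm ?subr_le0// opprB lerBlDr -lerBlDl.
  apply: lb_le_inf => // _ [z Bz <-]; rewrite leNgt; apply/negP => gz.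
  by apply: nobad; exists (y, z).
have [w wP] := choice bad.
have [y0 [By0 cly0]] : B `&` cluster ((fst \o w) @ \oo) !=set0.
  by apply: cB; exists 0%N => // p _; have [] := wP p.
have [r /= r0 rP] : exists2 r, 0 < r &
    forall z, `|y0 - z| < r -> `|g y0 - g z| < eta / 2.
  have := cg y0 => /cvgrPdist_lt/(_ (eta / 2)).
  rewrite divr_gt0// => /(_ isT) /nbhs_ballP[r /= r0 rP].
  by exists r => // z y0z; apply: rP; rewrite -ball_normE.
(* For [p >= p0] the bad points satisfy [p |y - z| < 2 M], hence [|y - z| < r / 2]. *)
pose p0 := (Num.truncn (4 * M / r)).+1.
have p0P : 4 * M / r < p0%:R.
  have : 0 <= 4 * M / r by rewrite divr_ge0 ?mulr_ge0// ltW.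
  by move/truncn_itv => /andP[].
have [_ /= [[p pp0 <-] cz]] :
    ((fst \o w) @` [set p | (p0 <= p)%N]) `&` ball y0 (r / 2) !=set0.
  apply: cly0; last by apply: nbhsx_ballx; rewrite divr_gt0.
  by exists p0 => // p /= pp; exists p.
have [By Bz /= wp] := wP p.
move: cz; rewrite -ball_normE /= => cz.
have gy := rP (w p).1 ltac:(lra).
have yz : `|(w p).1 - (w p).2| < r / 2.
  have pM : 4 * M / r < p%:R by rewrite (lt_le_trans p0P)// ler_nat.
  have p_gt0 : 0 < p%:R :> R.
    by apply: le_lt_trans pM; rewrite divr_ge0 ?mulr_ge0// ltW.
  rewrite -(ltr_pM2l p_gt0).
  have rM : 2 * M < p%:R * (r / 2) by move: pM; rewrite ltr_pdivrMr//; lra.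
  by move: (gM _ By) (gM _ Bz); rewrite !ler_norml; lra.
have gz := rP (w p).2 _.
have {}gz : `|g y0 - g (w p).2| < eta / 2.
  apply: gz; rewrite (le_lt_trans (ler_distD (w p).1 _ _))//; lra.
have : 0 <= p%:R * `|(w p).1 - (w p).2| by rewrite mulr_ge0.
by move: gy gz; rewrite !ltr_norml; lra.
Qed.

End lipschitz_maps.

(** * Local surjectivity and openness *)

Section invariance_of_domain.
Context {R : realType} {n : nat}.
Implicit Types (f g : 'rV[R]_n.+1 -> 'rV[R]_n.+1) (x y : 'rV[R]_n.+1).

Lemma continuous_dist c : continuous (fun y : 'rV[R]_n.+1 => `|y - c|).
Proof.
move=> y; apply: (@cvg_norm _ _ _ (nbhs y) _ (fun x => x - c)).
by apply: (@cvgB _ _ _ (nbhs y) _ id (cst c)); [exact: cvg_id|exact: cvg_cst].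
Qed.

Lemma continuous_of_lipschitz f k :
  (forall x y, `|f x - f y| <= k * `|x - y|) -> continuous f.
Proof.
move=> flip z; apply: (@cvgrPdist_lt _ _ _ (nbhs z) _ f (f z)).2 => e e0.
near=> t.
rewrite (le_lt_trans (flip _ _))// (@le_lt_trans _ _ ((`|k| + 1) * `|z - t|))//.
  by rewrite ler_wpM2r// (le_trans (ler_norm _))// lerDl.
rewrite mulrC -ltr_pdivlMr ?ltr_wpDl//.
near: t; apply: (@cvgr_dist_lt _ _ _ (nbhs z) _ id); first exact: cvg_id.
by rewrite divr_gt0// ltr_wpDl.
Unshelve. all: by end_near. Qed.

(** Tietze's theorem, one coordinate at a time, on the image of the cube [C]: it is compact, hence
    closed, and [g] is continuous on it. *)
Lemma continuous_extension_rV f g x1 d : continuous f ->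
  (forall x, g (f x) = x) -> {within range f, continuous g} -> 0 < d ->
  exists G : 'I_n.+1 -> 'rV[R]_n.+1 -> R, (forall i, continuous (G i)) /\
    forall i x, `|x - x1| <= d -> G i (f x) = x ord0 i - x1 ord0 i.
Proof.
move=> cf gf cg d0.
pose C : set 'rV[R]_n.+1 := [set x | `|x - x1| <= d].
have cK : compact (f @` C).
  apply: continuous_compact; last exact: compact_cube.
  exact: continuous_subspaceT.
have clK : closed (f @` C) by apply: compact_closed => //; exact: norm_hausdorff.
have ext i : exists h : 'rV[R]_n.+1 -> R, continuous h /\
    forall x, C x -> h (f x) = x ord0 i - x1 ord0 i.
  pose h0 : 'rV[R]_n.+1 -> R^o := fun y => g y ord0 i - x1 ord0 i.
  have ch0 : {within f @` C, continuous h0}.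
    have {}cg : {within f @` C, continuous g}.
      by apply: continuous_subspaceW cg => _ [x _ <-]; exists x.
    move=> y; apply: cvgB; last exact: cvg_cst.
    exact: (cvg_comp _ _ (cg y) (@coord_continuous _ _ _ ord0 i (g y))).
  have h0d y : (f @` C) y -> `|h0 y| <= d.
    move=> [x Cx <-]; rewrite /h0 gf; apply: le_trans Cx.
    by have := normr_coord_le (x - x1) i; rewrite !mxE.
  have [h [hh0 ch _]] :=
    continuous_bounded_extension pseudometric_normal clK d0 ch0 h0d.
  exists h; split => // x Cx; rewrite -hh0 ?inE; last by exists x.
  by rewrite /h0 gf.
have [G GP] := choice ext.
by exists G; split => [i|i x xd]; [exact: (GP i).1|exact: (GP i).2].
Qed.

(* Let [G] extend [x - x1 = G (f x)] continuously. If [f] missed a point [c] close to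
   [f x1], one could push the image of [f] radially out of the ball [B(c, eps)] and
   replace [G] by a Lipschitz approximation [P], moved off [0] on the sphere
   [S(c, eps)] by a small vector [v]. The result would be a map [F] without zeros
   that is within [d] of [x - x1] on the cube of radius [d], against
   Poincare-Miranda. *)
Lemma local_surjectivity f g x1 d : continuous f ->
  (forall x, g (f x) = x) -> {within range f, continuous g} -> 0 < d ->
  exists2 e, 0 < e & forall y, `|y - f x1| < e ->
    exists2 x, `|x - x1| <= d & f x = y.
Proof.
move=> cf gf cg d0.
have [G0 [cG0 G0f]] := continuous_extension_rV x1 cf gf cg d0.
pose G y : 'rV[R]_n.+1 := \row_i G0 i y.
have cG : continuous G.
  move=> y; apply: (cvg_row (F := nbhs y)) => i; rewrite mxE.
  under eq_fun do rewrite mxE.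
  exact: cG0.
have Gf x : `|x - x1| <= d -> G (f x) = x - x1.
  by move=> xd; apply/rowP => i; rewrite !mxE G0f.
pose C : set 'rV[R]_n.+1 := [set x | `|x - x1| <= d].
have Cx1 : C x1 by rewrite /C/= subrr normr0 ltW.
have cK : compact (f @` C).
  apply: continuous_compact; last exact: compact_cube.
  exact: continuous_subspaceT.
apply: contrapT => nosurj.
have d10 : 0 < d / 10 by rewrite divr_gt0.
have [r r0 Gr] : exists2 r, 0 < r & forall y, `|y - f x1| < r -> `|G y| <= d / 10.
  have := cG (f x1) => /cvgrPdist_lt/(_ _ d10)/nbhs_ballP[r /= r0 rP].
  exists r => // y yr; have : ball (f x1) r y by rewrite -ball_normE /= distrC.
  by move=> /rP /=; rewrite Gf// subrr sub0r normrN => /ltW.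
(* With [eps = r / 2] and [c] within [eps] of [f x1], the whole ball [B(c, eps)] lies where
   [|G| <= d / 10]. *)
have [eps eps0 epsr] : exists2 eps, 0 < eps & r = eps + eps.
  by exists (r / 2); [rewrite divr_gt0|exact: splitr].
have [c ceps cK'] : exists2 c, `|c - f x1| < eps & forall x, C x -> f x <> c.
  apply: contrapT => noc; apply: nosurj; exists eps => // y yeps.
  apply: contrapT => nox; apply: noc; exists y => // x Cx fxy.
  by apply: nox; exists x.
have Geps y : `|y - c| <= eps -> `|G y| <= d / 10.
  move=> yc; apply: Gr; rewrite -(subrK c y) -addrA.
  rewrite (le_lt_trans (ler_normD _ _))// epsr.
  by rewrite ler_ltD.
have [rho rho0 Krho] : exists2 rho, eps <= rho & forall x, C x -> `|f x - c| <= rho.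
  have [M M0 KM] := ex_strict_bound_gt0 (compact_bounded cK).
  exists (eps + M + `|c|); first by rewrite -addrA lerDl addr_ge0// ltW.
  move=> x Cx; rewrite (le_trans (ler_normB _ _))// lerD2r.
  rewrite (@le_trans _ _ M) ?lerDr ?(ltW eps0)//; apply/ltW/KM; by exists x.
(* Where [f x] is at distance at least [eps] from [c], [x] differs from [x1], and [G (f x) = x - x1]
   is bounded away from [0] by compactness. *)
have [delta delta0 [deltad Gdelta]] : exists2 delta, 0 < delta & delta <= d / 10 /\
    forall x, C x -> eps <= `|f x - c| -> delta <= `|G (f x)|.
  pose S1 := C `&` [set x | eps <= `|f x - c|].
  have [S10|S1N] := pselect (S1 !=set0); last first.
    exists (d / 10) => //; split => // x Cx xe.
    by exfalso; apply: S1N; exists x.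
  have cS1 : compact S1.
    apply: compact_closedI; first exact: compact_cube.
    apply: (@preimage_closed _ _ (fun x => `|f x - c|) [set r | eps <= r]);
      last exact: closed_ge.
    by move=> x _; exact: (continuous_comp (cf x) (@continuous_dist c (f x))).
  have : {within S1, continuous (fun x => `|x - x1|)}.
    by apply: continuous_subspaceT; exact: continuous_dist.
  move=> /(compact_EVT_min S10 cS1)[x2]; rewrite inE => -[Cx2 x2e] x2P.
  have x20 : 0 < `|x2 - x1|.
    rewrite normr_gt0 subr_eq0; apply: contraTneq x2e => ->.
    by rewrite /= -ltNge distrC.
  exists (Num.min (d / 10) `|x2 - x1|); first by rewrite lt_min d10.
  split; first by rewrite ge_min lexx.
  by move=> x Cx xe; rewrite Gf// ge_min x2P ?orbT// inE.
have delta40 : 0 < delta / 4 by rewrite divr_gt0.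
have [P [k [Plip PG]]] : exists (P : 'rV[R]_n.+1 -> 'rV[R]_n.+1) (k : R),
    (forall x y, `|P x - P y| <= k * `|x - y|) /\
    forall y, `|y - c| <= rho -> `|P y - G y| <= delta / 4.
  have rho_ge0 : 0 <= rho by exact: le_trans (ltW eps0) rho0.
  have lip i := lipschitz_approximation c (cG0 i) rho_ge0 delta40.
  have [h hP] := choice lip.
  have [k kP] := choice hP.
  exists (fun y => \row_i h i y), (\sum_i `|k i|); split.
    move=> x y; apply: normr_rV_le; first by rewrite mulr_ge0// sumr_ge0.
    move=> i; rewrite !mxE (le_trans ((kP i).1 x y))// ler_wpM2r//.
    rewrite (le_trans (ler_norm _))// (bigD1 i)//= lerDl sumr_ge0//.
  move=> y yc; apply: normr_rV_le; first exact: ltW.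
  by move=> i; rewrite !mxE; exact: (kP i).2.
have [v vd vP] := lipschitz_sphere_avoids c eps0 delta40 Plip.
(* The identity outside [B(c, eps)], the radial projection onto its boundary inside. It is
   continuous at every point but [c], and [f] misses [c] on [C]. *)
pose Phi y : 'rV[R]_n.+1 := c + Num.max (eps / `|y - c|) 1 *: (y - c).
have Phi1 y : eps <= `|y - c| -> Phi y = y.
  move=> ey; rewrite /Phi max_r ?scale1r ?subrKC//.
  by rewrite ler_pdivrMr ?mul1r// (lt_le_trans eps0).
have Phi2 y : y != c -> `|y - c| < eps -> `|Phi y - c| = eps.
  rewrite -subr_eq0 -normr_gt0 => yc ye; rewrite /Phi addrAC subrr add0r normrZ.
  rewrite max_l; last by rewrite ler_pdivlMr// mul1r ltW.
  have ey : 0 <= eps / `|y - c| by rewrite divr_ge0// ltW.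
  by rewrite (ger0_norm ey) divfK// gt_eqF.
have cP := continuous_of_lipschitz Plip.
pose F x := P (Phi (f x)) - v.
have cF : {within C, continuous F}.
  apply/subspace_continuousP => x Cx.
  have fxc0 : {for f x, continuous (fun y => y - c)}.
    by apply: (@cvgB _ _ _ (nbhs (f x)) _ id (cst c)); [exact: cvg_id|exact: cvg_cst].
  have cPhi : {for f x, continuous Phi}.
    have cs : {for f x, continuous (fun y => Num.max (eps / `|y - c|) 1)}.
      apply: (@continuous_max _ _ (fun y => eps / `|y - c|) (cst 1)).
        apply: (@cvgM _ _ (nbhs (f x)) _ (cst eps)); first exact: cvg_cst.
        apply: (@cvgV _ _ (nbhs (f x)) _ (fun y => `|y - c|)).
          by rewrite normr_eq0 subr_eq0; apply/eqP/cK'.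
        exact: continuous_dist.
      exact: (@cvg_cst (R : numFieldType)^o 1 _ (nbhs (f x)) _).
    apply: (@cvgD _ _ _ (nbhs (f x)) _ (cst c)); first exact: cvg_cst.
    exact: (@cvgZ _ _ _ (nbhs (f x)) _ _ _ _ _ cs fxc0).
  apply: cvg_within_filter.
  have cPf := continuous_comp (cf x) cPhi.
  have cPPf := continuous_comp cPf (cP _).
  by apply: (@cvgB _ _ _ (nbhs x) _ _ (cst v) _ _ cPPf); exact: cvg_cst.
(* Outside the ball the error is at most [delta / 4] from [P] and [delta / 4] from [v]; inside, [P],
   [v] and [G] are all small compared with [d]. *)
have Fx x : C x -> `|F x - (x - x1)| <= d.
  move=> Cx; rewrite -Gf//.
  have [fxe|fxe] := leP eps `|f x - c|.
    rewrite /F Phi1// addrAC (le_trans (ler_normB _ _))//.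
    have := PG _ (Krho _ Cx); lra.
  rewrite /F.
  have fxc : f x != c by apply/eqP/cK'.
  have e1 := Phi2 _ fxc fxe.
  have e2 : `|P (Phi (f x)) - G (Phi (f x))| <= delta / 4.
    by apply: PG; rewrite e1.
  have e3 : `|G (Phi (f x))| <= d / 10 by apply: Geps; rewrite e1.
  have e4 : `|G (f x)| <= d / 10 by apply: Geps; exact: ltW.
  have e5 := ler_normB (P (Phi (f x)) - v) (G (f x)).
  have e6 := ler_normB (P (Phi (f x))) v.
  have e7 := ler_normD (P (Phi (f x)) - G (Phi (f x))) (G (Phi (f x))).
  rewrite subrK in e7; lra.
have [x Cx Fx0] : exists2 x, C x & F x = 0.
  apply: poincare_miranda => // x i Cx xi.
    have := le_trans (normr_coord_le _ i) (Fx _ Cx); rewrite !mxE xi ler_norml; lra.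
  have := le_trans (normr_coord_le _ i) (Fx _ Cx); rewrite !mxE xi ler_norml; lra.
(* A zero of [F] outside the ball would give [|G (f x)| <= delta / 2], against the choice of
   [delta]; inside, [P] would take the value [v] on the sphere. *)
have [fxe|fxe] := leP eps `|f x - c|.
  move: Fx0; rewrite /F Phi1// => /eqP; rewrite subr_eq0 => /eqP Pv.
  have := PG _ (Krho _ Cx); rewrite Pv.
  have := Gdelta _ Cx fxe; have := ler_normB v (v - G (f x)).
  rewrite opprB subrKC; lra.
have fxc : f x != c by apply/eqP/cK'.
apply: (vP _ (Phi2 _ fxc fxe)).
by apply/eqP; rewrite -subr_eq0 -/(F x) Fx0.
Qed.

Theorem invariance_of_domain f g (U : set 'rV[R]_n.+1) : continuous f ->
  (forall x, g (f x) = x) -> {within range f, continuous g} ->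
  open U -> open (f @` U).
Proof.
move=> cf gf cg; rewrite !openE => oU _ [x1 Ux1 <-].
have /nbhs_ballP[r /= r0 rU] := oU _ Ux1.
have r20 : 0 < r / 2 by rewrite divr_gt0.
have [e e0 eP] := local_surjectivity x1 cf gf cg r20.
apply/nbhs_ballP; exists e => //= y; rewrite -ball_normE /= distrC => /eP[x xr <-].
exists x => //; apply: rU; rewrite -ball_normE /= distrC (le_lt_trans xr)//.
by rewrite ltr_pdivrMr// ltr_pMr// ltr1n.
Qed.

End invariance_of_domain.

(** * Lebesgue measure and polar coordinates *)

Section countable_subadditivity.
Context {R : realType} {X : Type}.
Local Open Scope ereal_scope.

(** The class [M] allows two uses: all sets for an outer measure, and the measurable sets for a
    measure. *)
Lemma esum_subadditive (I : pointedType) (C : set I) (F : I -> set X)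
    (M : set (set X)) (m : set X -> \bar R) :
  countable C -> M set0 -> m set0 = 0 -> (forall A, 0 <= m A) ->
  (forall G : nat -> set X, (forall k, M (G k)) ->
    m (\bigcup_k G k) <= \sum_(k <oo) m (G k)) ->
  (forall c, C c -> M (F c)) ->
  m (\bigcup_(c in C) F c) <= \esum_(c in C) m (F c).
Proof.
move=> /countable_bijP[B]; rewrite card_eq_sym => CB M0 m0 mge0 msub MF.
have [->|/set0P[c0 Cc0]] := eqVneq C set0.
  by rewrite bigcup_set0 m0 esum_set0.
have [e [eC einj eB]] := card_set_bijP CB.
rewrite (reindex_esum B _ e)//.
rewrite esum_mkcond -nneseries_esumT; last by move=> n; case: ifP.
pose G k := if k \in B then F (e k) else set0.
have -> : \bigcup_(c in C) F c = \bigcup_k G k.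
  apply/seteqP; split => [x [c /eB[k Bk <-] Fx]|x [k _]].
    by exists k => //; rewrite /G mem_set.
  by rewrite /G; case: ifPn => // /set_mem Bk Fx; exists (e k) => //; exact: eC.
apply: (le_trans (msub G _)).
  by move=> k; rewrite /G; case: ifPn => // /set_mem Bk; apply/MF/eC.
apply: lee_nneseries => k _; first by [].
by rewrite /G; case: ifPn => // _; rewrite m0.
Qed.

End countable_subadditivity.

(** * Boxes are Caratheodory measurable *)

Section boxes.
Context {R : realType} {n : nat}.
Implicit Types (ab : 'rV[R]_n * 'rV[R]_n) (x : 'rV[R]_n) (i : 'I_n) (c : R).
Local Open Scope ereal_scope.

Lemma box_volume_ge0 ab : (0 <= box_volume ab)%R.
Proof. by rewrite prodr_ge0// => i _; rewrite le_max lexx. Qed.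

Definition setc x i c : 'rV[R]_n := \row_j (if j == i then c else x ord0 j).

Lemma setcE x i c : setc x i c ord0 i = c.
Proof. by rewrite mxE eqxx. Qed.

Lemma lebesgue_outer_box_le ab : lebesgue_outer (box ab) <= (box_volume ab)%:E.
Proof.
apply: ereal_inf_lbound; exists [set ab]; last first.
  by rewrite esum_set1// lee_fin box_volume_ge0.
by split; [exact: countable1|move=> x abx; exists ab].
Qed.

(** The definition of [lebesgue_outer] takes sets of boxes. An indexed family may repeat a box,
    which can happen when the boxes of a cover are cut by a hyperplane. *)
Lemma lebesgue_outer_cover (I : pointedType) (C : set I)
    (F : I -> 'rV[R]_n * 'rV[R]_n) A : countable C ->
  A `<=` \bigcup_(c in C) box (F c) ->
  lebesgue_outer A <= \esum_(c in C) (box_volume (F c))%:E.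
Proof.
move=> cC AF; apply: (le_trans (le_outer_measure _ _ _ AF)).
apply: (@le_trans _ _ (\esum_(c in C) lebesgue_outer (box (F c)))).
  apply: (esum_subadditive (M := setT) (m := @lebesgue_outer R n)) => //.
  - exact: outer_measure_ge0.
  - by move=> G _; exact: outer_measure_sigma_subadditive.
by apply: le_esum => c _; exact: lebesgue_outer_box_le.
Qed.

(** As side lengths are clipped at [0], the [min] and the [max] also cover the hyperplanes that miss
    the box. *)
Lemma box_volume_split ab i c :
  (box_volume (ab.1, setc ab.2 i (Num.min (ab.2 ord0 i) c)) +
   box_volume (setc ab.1 i (Num.max (ab.1 ord0 i) c), ab.2) = box_volume ab)%R.
Proof.
rewrite /box_volume (bigD1 i)//= [X in (_ + X)%R](bigD1 i)//= [RHS](bigD1 i)//=.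
have eqr (b1 b2 b1' b2' : 'rV[R]_n) : (forall j, j != i -> b1 ord0 j = b1' ord0 j) ->
    (forall j, j != i -> b2 ord0 j = b2' ord0 j) ->
  (\prod_(j < n | j != i) Num.max 0 (b2 ord0 j - b1 ord0 j) =
   \prod_(j < n | j != i) Num.max 0 (b2' ord0 j - b1' ord0 j) :> R)%R.
  by move=> h1 h2; apply: eq_bigr => j ji; rewrite h1// h2.
have setc_ne x d j : j != i -> setc x i d ord0 j = x ord0 j.
  by move=> ji; rewrite mxE (negbTE ji).
rewrite (eqr _ _ ab.1 ab.2)//; last by move=> j ji; exact: setc_ne.
rewrite [X in (_ + _ * X)%R](eqr _ _ ab.1 ab.2)//; last by move=> j ji; exact: setc_ne.
rewrite -mulrDl !setcE; congr (_ * _)%R.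
rewrite /Num.max /Num.min; move: (ab.1 ord0 i) (ab.2 ord0 i) => a b.
by case: (ltP b c) => ?; case: (ltP a c) => ?; do 3? case: ifPn;
  rewrite -?leNgt; lra.
Qed.

(** Cutting every box of a cover of [X] along the hyperplane gives covers of the two parts of [X]
    with the same total volume. *)
Lemma halfspace_caratheodory i c :
  (@lebesgue_outer R n).-caratheodory [set x : 'rV[R]_n | (x ord0 i <= c)%R].
Proof.
apply: le_caratheodory_measurable => X.
apply: le_ereal_inf_tmp => _ [C [cC XC] <-].
under eq_esum do rewrite -(box_volume_split _ i c) EFinD.
rewrite esumD; last 2 first.
- by move=> ab _; rewrite lee_fin box_volume_ge0.
- by move=> ab _; rewrite lee_fin box_volume_ge0.
apply: leeD.
  apply: (lebesgue_outer_cover (F := fun ab =>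
    (ab.1, setc ab.2 i (Num.min (ab.2 ord0 i) c)))) => //.
  move=> x [Xx /= xc]; have [ab Cab abx] := XC x Xx.
  exists ab => // j; rewrite /= mxE; case: eqVneq => [ji|_]; last exact: abx.
  by have := abx j; rewrite ji le_min xc andbT.
apply: (lebesgue_outer_cover (F := fun ab =>
  (setc ab.1 i (Num.max (ab.1 ord0 i) c), ab.2))) => //.
move=> x [Xx /= xc]; have [ab Cab abx] := XC x Xx.
exists ab => // j; rewrite /= mxE; case: eqVneq => [ji|_]; last exact: abx.
by have := abx j; rewrite ji gt_max => /andP[-> ->]; rewrite ltNge; rewrite !andbT; apply/negP.
Qed.

Lemma box_caratheodory ab : measurable (box ab : set (lebRn R n)).
Proof.
have -> : box ab = \bigcap_(i in setT)
   ([set x : lebRn R n | (x ord0 i <= ab.2 ord0 i)%R] `\`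
    [set x : lebRn R n | (x ord0 i <= ab.1 ord0 i)%R]).
  apply/seteqP; split => x abx i.
    by move=> _; have /andP[x1 x2] := abx i; split => //; apply/negP; rewrite -ltNge.
  by have [x2 /negP] := abx i I; rewrite /= -ltNge => ->.
apply: fin_bigcap_measurable => // i _.
by apply: measurableD; exact: halfspace_caratheodory.
Qed.

End boxes.

(** Boxes are stable under intersection, so that a measure finite on boxes is determined on this
    sigma-algebra by its values on them. It contains the open sets and consists of Lebesgue
    measurable sets, which makes it the place for uniqueness arguments and for products. *)
Notation boxRn R n := (g_sigma_algebraType (range (@box R n))).

Section box_sigma_algebra.
Context {R : realType} {n : nat}.
Local Open Scope ereal_scope.

Lemma measurable_box (ab : 'rV[R]_n * 'rV[R]_n) : measurable (box ab : set (boxRn R n)).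
Proof. by apply: sub_sigma_algebra; exists ab. Qed.

Lemma box_measurable_lebesgue (A : set (boxRn R n)) : measurable A ->
  measurable (A : set (lebRn R n)).
Proof.
move=> mA; apply: mA; split => //; last by move=> _ [ab _ <-]; exact: box_caratheodory.
exact: sigma_algebra_measurable.
Qed.

Definition lebesgue_box : set (boxRn R n) -> \bar R := @lebesgue_outer R n.

Let lebesgue_box0 : lebesgue_box set0 = 0.
Proof. exact: outer_measure0. Qed.

Let lebesgue_box_ge0 A : 0 <= lebesgue_box A.
Proof. exact: outer_measure_ge0. Qed.

Let lebesgue_box_sigma_additive : semi_sigma_additive lebesgue_box.
Proof.
move=> F mF tF mUF.
by apply: (@measure_semi_sigma_additive _ _ _ (@lebesgue_Rn R n)) => // [k|];
  exact: box_measurable_lebesgue.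
Qed.

HB.instance Definition _ := isMeasure.Build _ _ _ lebesgue_box
  lebesgue_box0 lebesgue_box_ge0 lebesgue_box_sigma_additive.

End box_sigma_algebra.

Section box_measures.
Context {R : realType} {n : nat}.
Local Open Scope ereal_scope.
Implicit Types (ab : 'rV[R]_n * 'rV[R]_n).

Definition centered_box (r : R) : set 'rV[R]_n := box (const_mx (- r)%R, const_mx r).

Lemma bigcup_centered_box : \bigcup_k centered_box k%:R = setT.
Proof.
apply/seteqP; split => // x _; exists (Num.truncn `|x|).+1 => // i; rewrite !mxE.
have xi : (`|x ord0 i| <= `|x|)%R.
  rewrite [leRHS]/Num.norm /= mx_normrE; apply/bigmax_geP; right => /=.
  by exists (ord0, i).
have /andP[_ xt] := truncn_itv (normr_ge0 x).
have : (`|x ord0 i| < (Num.truncn `|x|).+1%:R)%R by exact: le_lt_trans xt.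
by rewrite ltr_norml => /andP[-> /ltW ->].
Qed.

Lemma setI_closed_box : setI_closed (range (@box R n)).
Proof.
move=> _ _ [ab _ <-] [cd _ <-].
exists (\row_i Num.max (ab.1 ord0 i) (cd.1 ord0 i),
        \row_i Num.min (ab.2 ord0 i) (cd.2 ord0 i))%R => //.
apply/seteqP; split => [x xm|x [xab xcd] i].
  by split => i; have := xm i; rewrite /= !mxE gt_max le_min => /andP[/andP[a1 c1] /andP[a2 c2]];
    apply/andP.
rewrite /= !mxE gt_max le_min.
have /andP[a1 a2] := xab i; have /andP[c1 c2] := xcd i.
by apply/andP; split; apply/andP.
Qed.

Lemma box_measure_unique (m1 m2 : {measure set (boxRn R n) -> \bar R}) :
  (forall ab, m1 (box ab) = m2 (box ab)) -> (forall ab, m1 (box ab) < +oo) ->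
  forall A, measurable A -> m1 A = m2 A.
Proof.
move=> m12 m1oo A mA.
apply: (@measure_unique _ R (boxRn R n) (range (@box R n))
  (fun k => centered_box k%:R) erefl _ _ _ m1 m2) => //.
- exact: setI_closed_box.
- exact: bigcup_centered_box.
- by move=> _ [ab _ <-].
- by move=> k; exact: m1oo.
Qed.

Lemma lebesgue_box_lty ab : (@lebesgue_box R n) (box ab) < +oo.
Proof. by rewrite (le_lt_trans (lebesgue_outer_box_le ab))// ltry. Qed.

Let sigma_finite_lebesgue_box : sigma_finite setT (@lebesgue_box R n).
Proof.
exists (fun k => centered_box k%:R); first by rewrite bigcup_centered_box.
by move=> k; split; [exact: measurable_box|exact: lebesgue_box_lty].
Qed.

HB.instance Definition _ := Measure_isSigmaFinite.Build _ _ _ (@lebesgue_box R n)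
  sigma_finite_lebesgue_box.

(** An open set is the union of the boxes with rational corners that it contains. *)
Lemma open_measurable_box (U : set 'rV[R]_n) : open U ->
  measurable (U : set (boxRn R n)).
Proof.
rewrite openE => oU.
pose q (ab : 'rV[rat]_n * 'rV[rat]_n) := (map_mx ratr ab.1, map_mx ratr ab.2) : 'rV[R]_n * 'rV[R]_n.
pose F (ab : 'rV[rat]_n * 'rV[rat]_n) : set (boxRn R n) :=
  if `[< box (q ab) `<=` U >] then box (q ab) else set0.
have -> : U = \bigcup_ab F ab.
  apply/seteqP; split => [x Ux|x [ab _]]; last first.
    by rewrite /F; case: asboolP => // /[apply].
  have /nbhs_ballP[e /= e0 eU] := oU _ Ux.
  have ea i : exists r : rat, ratr r \in `](x ord0 i - e)%R, x ord0 i[.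
    by apply: rat_in_itvoo; rewrite ltrBlDr ltrDl.
  have eb i : exists r : rat, ratr r \in `]x ord0 i, (x ord0 i + e)%R[.
    by apply: rat_in_itvoo; rewrite ltrDl.
  have [a aP] := choice ea; have [b bP] := choice eb.
  exists (\row_i a i, \row_i b i)%R => //; rewrite /F asboolT.
    move=> i; rewrite !mxE.
    have := aP i; have := bP i; rewrite !in_itv /=.
    by move=> /andP[/ltW -> _] /andP[_ ->].
  move=> y yq; apply: eU; split => // k i; rewrite (ord1 k) /ball /= ltr_norml.
  have := aP i; have := bP i; have := yq i; rewrite !mxE !in_itv/=.
  lra.
apply: countable_bigcupT_measurable; first exact: countableP.
by move=> ab; rewrite /F; case: asboolP => _; [exact: measurable_box|exact: measurable0].
Qed.

Lemma measurable_fun_borel_box d (T : measurableType d) (g : 'rV[R]_n -> T) :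
  measurable_fun [set: borelRn R n] (g : borelRn R n -> T) ->
  measurable_fun [set: boxRn R n] (g : boxRn R n -> T).
Proof.
move=> mg _ Y mY; have := mg measurableT Y mY; rewrite !setTI => mgY.
apply: mgY; split; last by move=> U; exact: open_measurable_box.
exact: sigma_algebra_measurable.
Qed.

Lemma continuous_measurable_box (g : 'rV[R]_n -> R) : continuous g ->
  measurable_fun [set: boxRn R n] (g : boxRn R n -> R).
Proof.
move=> cg; apply: (measurability _ (RGenOInfty.measurableE R)).
move=> _ [_ [r ->] <-]; rewrite setTI; apply: open_measurable_box.
by apply: open_comp; [move=> x _; exact: cg|exact: rray_open].
Qed.

Lemma measurable_coord (i : 'I_n) :
  measurable_fun [set: boxRn R n] (fun x : boxRn R n => x ord0 i).
Proof. by apply: continuous_measurable_box => x; exact: coord_continuous. Qed.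

End box_measures.

(** * Lebesgue measure as a product measure *)

Section snoc.
Context {R : realType} {n : nat}.
Implicit Types (y : 'rV[R]_n) (h : R).
Local Open Scope ereal_scope.

Lemma ord_last_ind (P : 'I_n.+1 -> Prop) :
  (forall j, P (widen_ord (leqnSn n) j)) -> P ord_max -> forall i, P i.
Proof.
move=> Pj Pmax i; have [->//|im] := eqVneq i ord_max.
have ilt : (i < n)%N by rewrite ltn_neqAle -ltnS ltn_ord andbT; exact: im.
by rewrite (_ : i = widen_ord (leqnSn n) (Ordinal ilt))//; exact: val_inj.
Qed.

Lemma snoc_widen y h j :
  @snoc R n.+1 y h ord0 (widen_ord (leqnSn n) j) = y ord0 j.
Proof. by rewrite mxE /= valK. Qed.

Lemma snoc_max y h : @snoc R n.+1 y h ord0 ord_max = h.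
Proof. by rewrite mxE /= insubN// -leqNgt. Qed.

Definition init_row (x : 'rV[R]_n.+1) : 'rV[R]_n :=
  \row_j x ord0 (widen_ord (leqnSn n) j).

Lemma preimage_snoc_box (ab : 'rV[R]_n.+1 * 'rV[R]_n.+1) :
  (fun yh : 'rV[R]_n * R => @snoc R n.+1 yh.1 yh.2) @^-1` box ab =
  box (init_row ab.1, init_row ab.2) `*`
  `](ab.1 ord0 ord_max), (ab.2 ord0 ord_max)]%classic.
Proof.
apply/seteqP; split => [[y h] /= yhab|[y h] /= [yab hab]].
  split => [j|] /=.
    rewrite [init_row ab.1 _ _]mxE [init_row ab.2 _ _]mxE.
    by have := yhab (widen_ord (leqnSn n) j); rewrite /= snoc_widen.
  by rewrite in_itv/=; have := yhab ord_max; rewrite /= snoc_max.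
elim/ord_last_ind => [j|]; last by rewrite snoc_max; move: hab; rewrite in_itv.
by rewrite snoc_widen; have := yab j; rewrite /= !mxE.
Qed.

Lemma box_volume_last (ab : 'rV[R]_n.+1 * 'rV[R]_n.+1) :
  box_volume ab = (box_volume (init_row ab.1, init_row ab.2) *
    Num.max 0 (ab.2 ord0 ord_max - ab.1 ord0 ord_max))%R.
Proof.
by rewrite /box_volume big_ord_recr/=; congr (_ * _)%R; apply: eq_bigr => j _; rewrite !mxE.
Qed.

Definition psnoc (yh : (boxRn R n * measurableTypeR R)%type) : boxRn R n.+1 :=
  @snoc R n.+1 yh.1 yh.2.

Lemma measurable_psnoc : measurable_fun setT psnoc.
Proof.
apply: (@measurability _ _ _ (boxRn R n.+1) setT psnoc (range (@box R n.+1)) erefl).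
move=> _ [_ [ab _ <-] <-]; rewrite setTI /psnoc preimage_snoc_box.
by apply: measurableX; [exact: measurable_box|exact: measurable_itv].
Qed.

(* Equal to [lebesgue_box] by [lebesgue_box_snoc]; at first it only serves to bound the
   outer measure of a box from below. *)
Definition snoc_measure : {measure set (boxRn R n.+1) -> \bar R} :=
  measure_function_pushforward__canonical__measure_function_Measure
    (@lebesgue_box R n \x @lebesgue_measure R) measurable_psnoc.

End snoc.

Section volume_of_boxes.
Context {R : realType}.
Local Open Scope ereal_scope.

Lemma lebesgue_measure_oc (a b : R) :
  lebesgue_measure (`]a, b]%classic : set R) = (Num.max 0 (b - a))%:E.
Proof.
rewrite lebesgue_measure_itv/= lte_fin; case: ltP => ab.
  by rewrite max_r ?subr_ge0 ?ltW// EFinB.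
by rewrite max_l// subr_le0.
Qed.

Lemma snoc_measure_box n (ab : 'rV[R]_n.+1 * 'rV[R]_n.+1) :
  (forall cd : 'rV[R]_n * 'rV[R]_n, lebesgue_box (box cd) = (box_volume cd)%:E) ->
  snoc_measure (box ab) = (box_volume ab)%:E.
Proof.
move=> IH; rewrite /snoc_measure /= /pushforward.
rewrite (_ : psnoc @^-1` box ab = box (init_row ab.1, init_row ab.2) `*`
  `](ab.1 ord0 ord_max), (ab.2 ord0 ord_max)]%classic); last exact: preimage_snoc_box.
rewrite product_measure1E//; last exact: measurable_box.
rewrite box_volume_last EFinM; congr (_ * _); first exact: IH.
exact: lebesgue_measure_oc.
Qed.

(** A box covers itself, which is the upper bound. The lower bound needs a measure that already has
    the right values on boxes: [snoc_measure], by induction on the dimension. Its countable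
    subadditivity bounds the volume of every cover from below. *)
Lemma lebesgue_box_box n (ab : 'rV[R]_n * 'rV[R]_n) :
  lebesgue_box (box ab) = (box_volume ab)%:E.
Proof.
elim: n => [|n IH] in ab *.
  (* In dimension [0] every box is the whole space and has volume [1], the empty product, and a
     cover contains at least one. *)
  apply/eqP; rewrite eq_le lebesgue_outer_box_le /=.
  apply: le_ereal_inf_tmp => _ [C [cC abC] <-].
  have [cd Ccd _] : (\bigcup_(ab in C) box ab) 0%R by apply: abC => -[].
  rewrite /box_volume big_ord0; apply: esum_ge; exists [set cd].
    by split => // _ ->.
  by rewrite fsbig_set1 /box_volume big_ord0.
apply/eqP; rewrite eq_le lebesgue_outer_box_le /=.
apply: le_ereal_inf_tmp => _ [C [cC abC] <-].
rewrite -(snoc_measure_box ab IH).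
have -> : box ab = \bigcup_(cd in C) (box cd `&` box ab).
  by rewrite -setI_bigcupl setIC; apply/esym/setIidl.
have mB (cd : 'rV[R]_n.+1 * 'rV[R]_n.+1) : measurable (box cd `&` box ab : set (boxRn R n.+1)).
  by apply: measurableI; exact: measurable_box.
apply: (@le_trans _ _ (\esum_(cd in C) snoc_measure (box cd `&` box ab))).
  apply: (esum_subadditive (M := @measurable _ (boxRn R n.+1)) (m := @snoc_measure R n)) => //.
  move=> G mG; apply: measure_sigma_subadditive => //.
  exact: bigcup_measurable.
apply: le_esum => cd _; rewrite -snoc_measure_box//.
by apply: le_measure; rewrite ?inE//; exact: measurable_box.
Qed.

Lemma lebesgue_box_snoc n (A : set (boxRn R n.+1)) : measurable A ->
  lebesgue_box A = snoc_measure A.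
Proof.
apply: box_measure_unique => ab; last exact: lebesgue_box_lty.
by rewrite /= lebesgue_box_box snoc_measure_box// => cd; exact: lebesgue_box_box.
Qed.

Lemma ge0_integral_snoc n (g : boxRn R n.+1 -> \bar R) :
  measurable_fun setT g -> (forall x, 0 <= g x) ->
  \int[lebesgue_box]_x g x =
  \int[lebesgue_box]_y \int[lebesgue_measure]_h g (psnoc (y, h)).
Proof.
move=> mg g0.
rewrite (eq_measure_integral (@snoc_measure R n)); last first.
  by move=> A mA _; exact: lebesgue_box_snoc.
rewrite /snoc_measure ge0_integral_pushforward//; last exact: measurable_psnoc.
rewrite preimage_setT fubini_tonelli1//.
by apply: measurableT_comp => //; exact: measurable_psnoc.
by move=> x; exact: g0.
Qed.

End volume_of_boxes.

Section row_measurability.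
Context {R : realType}.
Local Open Scope ereal_scope.

Lemma measurable_row d (T : measurableType d) n (F : T -> boxRn R n) :
  (forall i, measurable_fun setT (fun t => F t ord0 i : R)) -> measurable_fun setT F.
Proof.
move=> mF; apply: (@measurability _ _ _ (boxRn R n) setT F (range (@box R n)) erefl).
move=> _ [_ [ab _ <-] <-]; rewrite setTI.
rewrite (_ : F @^-1` box ab = \bigcap_(i in setT)
    (fun t => F t ord0 i) @^-1` `](ab.1 ord0 i), (ab.2 ord0 i)]%classic).
  by apply: fin_bigcap_measurable => // i _; rewrite -[X in measurable X]setTI; exact: mF.
apply/seteqP; split => [t abt i _|t abt i].
  by rewrite /= in_itv/=; exact: abt.
by have := abt i I; rewrite /= in_itv.
Qed.

Lemma measurable_sqrtr : measurable_fun [set: R] (@Num.sqrt R).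
Proof. by apply: continuous_measurable_fun; exact: sqrt_continuous. Qed.

Lemma measurable_invr : measurable_fun [set: R] (@GRing.inv R).
Proof.
rewrite (_ : [set: R] = [set 0%R] `|` ~` [set 0%R]); last by rewrite setUv.
apply/measurable_funU => //; first exact: measurableC.
split; first exact: measurable_fun_set1.
apply: open_continuous_measurable_fun; first by rewrite openC; exact: closed_eq.
by move=> x; rewrite inE /= => /eqP x0; exact: inv_continuous.
Qed.

Lemma measurable_enorm n : measurable_fun [set: boxRn R n] (@enorm R n : boxRn R n -> R).
Proof.
apply: measurableT_comp; first exact: measurable_sqrtr.
apply: measurable_sum => i; apply: measurable_funX; exact: measurable_coord.
Qed.

Lemma enorm_ge0 n (x : 'rV[R]_n) : (0 <= enorm x)%R.
Proof. exact: sqrtr_ge0. Qed.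

Lemma enormZ n (r : R) (x : 'rV[R]_n) : (enorm (r *: x) = `|r| * enorm x)%R.
Proof.
rewrite /enorm -sqrtr_sqr -sqrtrM ?sqr_ge0// mulr_sumr.
by congr Num.sqrt; apply: eq_bigr => i _; rewrite mxE exprMn.
Qed.

Lemma enorm_sqr n (x : 'rV[R]_n) : (enorm x ^+ 2 = \sum_(i < n) x ord0 i ^+ 2)%R.
Proof. by rewrite sqr_sqrtr// sumr_ge0// => i _; exact: sqr_ge0. Qed.

Lemma enorm_snoc n (y : 'rV[R]_n) (h : R) :
  (enorm (@snoc R n.+1 y h) ^+ 2 = enorm y ^+ 2 + h ^+ 2)%R.
Proof.
rewrite !enorm_sqr big_ord_recr/= snoc_max; congr (_ + _)%R.
by apply: eq_bigr => i _; rewrite snoc_widen.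
Qed.

End row_measurability.

(** * Translations and dilations *)

Section affine_changes_of_variable.
Context {R : realType} {n : nat}.
Local Open Scope ereal_scope.

Lemma measurable_translate (x0 : 'rV[R]_n) :
  measurable_fun setT (fun x : boxRn R n => (x0 + x)%R : boxRn R n).
Proof.
apply: measurable_row => i.
rewrite (_ : (fun _ => _) = (fun x : boxRn R n => x0 ord0 i + x ord0 i)%R).
  by apply: measurable_funD => //; exact: measurable_coord.
by apply/funext => x; rewrite mxE.
Qed.

Lemma ge0_integral_translate (x0 : 'rV[R]_n) (g : boxRn R n -> \bar R) :
  measurable_fun setT g -> (forall x, 0 <= g x) ->
  \int[lebesgue_box]_x g (x0 + x)%R = \int[lebesgue_box]_x g x.
Proof.
move=> mg g0.
pose tr (x : boxRn R n) : boxRn R n := (x0 + x)%R.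
have mtr : measurable_fun setT tr by exact: measurable_translate.
transitivity (\int[pushforward lebesgue_box tr]_x g x).
  by rewrite ge0_integral_pushforward.
apply: eq_measure_integral => A mA _.
apply: (box_measure_unique (m1 :=
  measure_function_pushforward__canonical__measure_function_Measure
    (@lebesgue_box R n) mtr)) => // ab.
- rewrite /= /pushforward (_ : tr @^-1` box ab = box (ab.1 - x0, ab.2 - x0)%R).
    rewrite !lebesgue_box_box; congr (_%:E); apply: eq_bigr => i _.
    by rewrite !mxE; congr Num.max; ring.
  apply/seteqP; split => x xab i; have := xab i; rewrite /= !mxE;
    by rewrite ltrBlDl lerBrDl.
- rewrite /= /pushforward (_ : tr @^-1` box ab = box (ab.1 - x0, ab.2 - x0)%R).
    exact: lebesgue_box_lty.
  apply/seteqP; split => x xab i; have := xab i; rewrite /= !mxE;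
    by rewrite ltrBlDl lerBrDl.
Qed.

Lemma ge0_integral_scale (r : R) (g : boxRn R n -> \bar R) : (0 < r)%R ->
  measurable_fun setT g -> (forall x, 0 <= g x) ->
  \int[lebesgue_box]_x g x = (r ^+ n)%:E * \int[lebesgue_box]_x g (r *: x)%R.
Proof.
move=> r0 mg g0.
pose sc (x : boxRn R n) : boxRn R n := (r *: x)%R.
have msc : measurable_fun setT sc.
  apply: measurable_row => i.
  rewrite (_ : (fun _ => _) = (fun x : boxRn R n => r * x ord0 i)%R).
    by apply: measurable_funM => //; exact: measurable_coord.
  by apply/funext => x; rewrite mxE.
have rn0 : (0 <= r ^+ n)%R by rewrite exprn_ge0// ltW.
have <- : \int[pushforward lebesgue_box sc]_x g x =
    \int[lebesgue_box]_x g (r *: (x : 'rV[R]_n))%R.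
  by rewrite ge0_integral_pushforward.
rewrite -[(r ^+ n)%R]/(NngNum rn0)%:num.
rewrite -(ge0_integral_mscale
  (measure_function_pushforward__canonical__measure_function_Measure
    (@lebesgue_box R n) msc))//.
apply: eq_measure_integral => A mA _.
apply: box_measure_unique => // ab; last exact: lebesgue_box_lty.
rewrite /= /mscale /= /pushforward.
rewrite (_ : sc @^-1` box ab = box (r^-1 *: ab.1, r^-1 *: ab.2)%R).
  rewrite !lebesgue_box_box -EFinM; congr (_%:E).
  rewrite /box_volume -[X in (r ^+ X)%R]card_ord -prodr_const -big_split /=.
  apply: eq_bigr => i _; rewrite !mxE -mulrBr maxr_pMr ?(ltW r0)//.
  by rewrite mulr0 mulrA divff ?gt_eqF// mul1r.
apply/seteqP; split => x xab i; have := xab i; rewrite /= !mxE.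
  by rewrite ler_pdivlMl// ltr_pdivrMl.
by rewrite ler_pdivlMl// ltr_pdivrMl.
Qed.

End affine_changes_of_variable.

(** * Image measures with a density, and substitution on the line *)

Section weighted_pushforward.
Context d d' (X : measurableType d) (Y : measurableType d') (R : realType).
Variables (mu : {measure set X -> \bar R}) (T : X -> Y) (w : X -> R).
Hypotheses (mT : measurable_fun setT T) (mw : measurable_fun setT w)
  (w0 : forall x, 0 <= w x).
Local Open Scope ereal_scope.

Let mTB B : measurable B -> measurable (T @^-1` B).
Proof. by move=> mB; rewrite -[X in measurable X]setTI; exact: mT. Qed.

(** The image under [T] of the measure with density [w] with respect to [mu]. A substitution then
    reduces to an equality of measures, which is checked on half-open intervals. *)
Definition weighted_pushforward (B : set Y) : \bar R :=
  \int[mu]_(x in T @^-1` B) (w x)%:E.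

Let weighted_pushforward0 : weighted_pushforward set0 = 0.
Proof. by rewrite /weighted_pushforward preimage_set0 integral_set0. Qed.

Let weighted_pushforward_ge0 B : 0 <= weighted_pushforward B.
Proof. by apply: integral_ge0 => x _; rewrite lee_fin. Qed.

Let weighted_pushforward_sigma_additive : semi_sigma_additive weighted_pushforward.
Proof.
move=> F mF tF mUF.
rewrite [X in _ --> X](_ : _ = \sum_(n <oo) weighted_pushforward (F n)).
  by apply/cvg_closeP; split; [exact: is_cvg_nneseries|rewrite closeE].
rewrite /weighted_pushforward preimage_bigcup ge0_integral_bigcup//.
- by move=> k; exact: mTB.
- by apply: measurable_funTS; exact/measurable_EFinP.
- by move=> x _; rewrite lee_fin.
- apply/trivIsetP => /= i j _ _ ij; rewrite -preimage_setI.
  by move/trivIsetP : tF => /(_ _ _ _ _ ij) ->//; rewrite preimage_set0.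
Qed.

HB.instance Definition _ := isMeasure.Build _ _ _ weighted_pushforward
  weighted_pushforward0 weighted_pushforward_ge0 weighted_pushforward_sigma_additive.

Definition weighted_measure : {measure set Y -> \bar R} := weighted_pushforward.

Import HBNNSimple.

Lemma ge0_integral_weighted_pushforward (f : Y -> \bar R) :
  measurable_fun setT f -> (forall y, 0 <= f y) ->
  \int[weighted_measure]_y f y = \int[mu]_x (f (T x) * (w x)%:E).
Proof.
move=> mf f0; pose g := nnsfun_approx measurableT mf.
have mgT n : measurable_fun setT (fun x => (g n (T x))%:E * (w x)%:E).
  apply: emeasurable_funM; last exact/measurable_EFinP.
  by apply/measurable_EFinP/measurableT_comp.
transitivity (limn (fun n => \int[weighted_measure]_y (g n y)%:E)).
  rewrite -monotone_convergence//.
  - by apply: eq_integral => y _; apply/esym/cvg_lim => //; exact: cvg_nnsfun_approx.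
  - by move=> n; exact/measurable_EFinP.
  - by move=> n y _; rewrite lee_fin.
  - by move=> y _ m n mn; rewrite lee_fin; exact/lefP/nd_nnsfun_approx.
transitivity (limn (fun n => \int[mu]_x ((g n (T x))%:E * (w x)%:E))); last first.
  rewrite -monotone_convergence//.
  - apply: eq_integral => x _; apply/cvg_lim => //.
    by apply: cvgeZr => //; exact: cvg_nnsfun_approx.
  - by move=> n x _; rewrite mule_ge0 ?lee_fin.
  - move=> x _ m n mn; apply: lee_wpmul2r; rewrite ?lee_fin//.
    exact/lefP/nd_nnsfun_approx.
congr (limn _); apply/funext => n.
rewrite integralT_nnsfun sintegralE.
under [RHS]eq_integral => x _.
  rewrite (fimfunE (g n)) -fsumEFin// ge0_mule_fsuml; last first.
    by move=> r; rewrite nnfun_muleindic_ge0.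
  over.
rewrite ge0_integral_fsum//; last 2 first.
- move=> r; apply: emeasurable_funM; last exact/measurable_EFinP.
  apply/measurable_EFinP/measurable_funM => //.
  by apply: (measurableT_comp _ mT).
- by move=> r x _; rewrite mule_ge0 ?lee_fin// -lee_fin nnfun_muleindic_ge0.
apply: eq_fsbigr => r; rewrite inE => -[y _ <-].
under eq_integral do rewrite EFinM -muleA.
rewrite ge0_integralZl//; last 3 first.
- apply: emeasurable_funM; last exact/measurable_EFinP.
  by apply/measurable_EFinP; apply: (measurableT_comp _ mT).
- by move=> x _; rewrite mule_ge0// lee_fin.
- by rewrite lee_fin.
congr (_ * _); rewrite /= /weighted_pushforward [LHS]integral_mkcond.
apply: eq_integral => x _; rewrite patchE indicE.
have -> : (x \in T @^-1` (g n @^-1` [set g n y])) = (T x \in g n @^-1` [set g n y]).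
  by apply/idP/idP; rewrite !inE.
by case: ifPn; rewrite ?mul1e ?mul0e.
Qed.

End weighted_pushforward.

Section one_dimensional_substitution.
Context {R : realType}.
Local Open Scope ereal_scope.
Local Notation lambda := (@lebesgue_measure R).

Lemma integral_derive_oc (F f : R -> R) (a b : R) : (a <= b)%R ->
  (forall x, (a <= x <= b)%R -> is_derive x 1%R F (f x)) ->
  {within `[a, b], continuous f} ->
  \int[lambda]_(x in `]a, b]) (f x)%:E = (F b - F a)%:E.
Proof.
rewrite le_eqVlt => /predU1P[->|ab] dF cf.
  by rewrite set_itv_ge ?integral_set0 ?subrr// bnd_simp ltxx.
have cF x : (a <= x <= b)%R -> {for x, continuous F}.
  by move=> xab; apply/differentiable_continuous/derivable1_diffP; have [] := dF x xab.
rewrite integral_itv_obnd_cbnd; last first.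
  apply/measurable_EFinP; apply: (@measurable_funS _ _ _ _ `[a, b]%classic) => //.
    exact: subset_itv_oc_cc.
  exact: subspace_continuous_measurable_fun.
rewrite (@continuous_FTC2 _ f F)//.
- split.
  + by move=> x /subset_itv_oo_cc; rewrite /= in_itv /= => /dF[].
  + by apply: cvg_at_right_filter; apply: cF; rewrite lexx ltW.
  + by apply: cvg_at_left_filter; apply: cF; rewrite lexx ltW.
- move=> x /subset_itv_oo_cc; rewrite /= in_itv /= => /dF dFx.
  by rewrite derive1E; exact: derive_val.
Qed.

(* The substitution [r = sqrt (h^2 + a^2)] on [h > 0], as the identity of
   [lebesgue_measure] on []a, +oo[] with the image of [h / r dh]; the truncation
   [Num.max 0 h] discards the negative half-line. *)
Section hyperbola.
Variable a : R.
Hypothesis a0 : (0 < a)%R.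

Let hyp (h : measurableTypeR R) : measurableTypeR R := Num.sqrt (h ^+ 2 + a ^+ 2)%R.
Let wt (h : measurableTypeR R) : R := (Num.max 0 h / hyp h)%R.

Let sq_gt0 h : (0 < h ^+ 2 + a ^+ 2)%R.
Proof. by rewrite ltr_wpDl ?sqr_ge0// exprn_gt0. Qed.

Let hyp_gt0 h : (0 < hyp h)%R. Proof. by rewrite sqrtr_gt0. Qed.

Let hyp_sqr h : (hyp h ^+ 2 = h ^+ 2 + a ^+ 2)%R.
Proof. by rewrite sqr_sqrtr// ltW. Qed.

Let measurable_hyp : measurable_fun setT hyp.
Proof.
apply: measurableT_comp; first exact: measurable_sqrtr.
by apply: measurable_funD => //; exact: measurable_funX.
Qed.

Let measurable_wt : measurable_fun setT wt.
Proof.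
apply: measurable_funM; first exact: measurable_maxr.
by apply: measurableT_comp; [exact: measurable_invr|exact: measurable_hyp].
Qed.

Let wt_ge0 h : (0 <= wt h)%R.
Proof. by rewrite divr_ge0// ?le_max ?lexx// ltW. Qed.

Let is_derive_hyp (h : R) : is_derive h 1%R hyp (h / hyp h)%R.
Proof.
have dsq : is_derive h 1%R (fun x : R => x ^+ 2 + a ^+ 2)%R (2 * h)%R.
  by apply: is_derive_eq; rewrite -[(h%:A)%R]/(h * 1)%R; ring.
have dsqrt := is_derive1_sqrt (sq_gt0 h).
rewrite (_ : h / hyp h = (2 * hyp h)^-1 * (2 * h))%R.
  exact: (@is_derive1_comp _ _ (fun x : R => x ^+ 2 + a ^+ 2)%R h _ _ dsqrt dsq).
by field; rewrite gt_eqF.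
Qed.

Let continuous_hyp : continuous hyp.
Proof.
move=> h; have [dh _] := is_derive_hyp h.
by apply/differentiable_continuous/derivable1_diffP.
Qed.

Let hyp_gt (c h : R) : (0 <= c)%R -> (0 <= h)%R ->
  (c < hyp h)%R = (c ^+ 2 < h ^+ 2 + a ^+ 2)%R.
Proof. by move=> c0 h0; rewrite -hyp_sqr ltr_pXn2r// nnegrE ltW. Qed.

Let hyp_le (d h : R) : (0 <= d)%R -> (0 <= h)%R ->
  (hyp h <= d)%R = (h ^+ 2 + a ^+ 2 <= d ^+ 2)%R.
Proof. by move=> d0 h0; rewrite -hyp_sqr ler_pXn2r// nnegrE ltW. Qed.

(** [h / hyp h] is the derivative of [hyp], so that the mass of []c, d]] is an increment of [hyp],
    between the preimages [u (Num.max c a)] and [u d]; on the positive half-line [hyp] only takes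
    values above [a]. *)
Let weighted_hyp_oc (c d : R) :
  weighted_pushforward lambda hyp wt `]c, d]%classic =
  (Num.max 0 (d - Num.max c a))%:E.
Proof.
rewrite /weighted_pushforward.
have hyp_a h : (0 < h)%R -> (a < hyp h)%R.
  by move=> h0; rewrite hyp_gt ?ltW// ltrDr exprn_gt0.
have [dca|cad] := leP d (Num.max c a).
  rewrite max_l ?subr_le0// integral0_eq// => h /=; rewrite in_itv/= => /andP[ch hd].
  rewrite /wt; have [h0|h0] := leP h 0%R; first by rewrite mul0r.
  have := le_trans hd dca; rewrite leNgt gt_max ch /=.
  by have := hyp_a _ h0 => ->.
rewrite max_r ?subr_ge0 ?ltW//.
set c' := Num.max c a in cad *.
have ac' : (a <= c')%R by rewrite le_max lexx orbT.
pose u x := Num.sqrt (x ^+ 2 - a ^+ 2)%R.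
have ux x : (a <= x)%R -> (u x ^+ 2 = x ^+ 2 - a ^+ 2)%R.
  by move=> ax; rewrite sqr_sqrtr// subr_ge0 ler_pXn2r// nnegrE ltW// (lt_le_trans a0).
have ad : (a <= d)%R by rewrite (le_trans ac')// ltW.
have c'0 : (0 <= c')%R by rewrite (le_trans _ ac')// ltW.
have d0 : (0 <= d)%R by rewrite (le_trans _ ad)// ltW.
have hu x : (a <= x)%R -> hyp (u x) = x.
  move=> ax; rewrite /hyp ux// subrK sqrtr_sqr ger0_norm//.
  by rewrite (le_trans _ ax)// ltW.
have ucd : (u c' <= u d)%R.
  rewrite ler_wsqrtr// lerB// ler_pXn2r ?nnegrE//; exact: ltW.
transitivity (\int[lambda]_(h in `]u c', u d]) (h / hyp h)%:E).
  rewrite integral_mkcond [RHS]integral_mkcond; apply: eq_integral => h _.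
  rewrite !patchE; have [h0|h0] := leP h 0%R.
    rewrite [X in _ = X]ifN; last first.
      rewrite notin_setE /= in_itv /= => /andP[+ _].
      by rewrite ltNge (le_trans h0)// sqrtr_ge0.
    by case: ifP => //; rewrite /wt max_l// mul0r.
  have -> : (h \in hyp @^-1` `]c, d]%classic) = (h \in `]u c', u d]%classic).
    apply/idP/idP; rewrite !inE /= !in_itv /=.
      move=> /andP[ch hd].
      have c'h : (c' < hyp h)%R by rewrite gt_max ch hyp_a.
      apply/andP; split.
        rewrite -(ltr_pXn2r (n := 2))// ?nnegrE ?sqrtr_ge0 ?(ltW h0)// ux//.
        by rewrite ltrBlDr -hyp_gt// ltW.
      rewrite -(ler_pXn2r (n := 2))// ?nnegrE ?sqrtr_ge0 ?(ltW h0)// ux//.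
      by rewrite lerBrDr -hyp_le// ltW.
    move=> /andP[ch hd].
    have c'h : (c' < hyp h)%R.
      rewrite hyp_gt ?(ltW h0)//.
      by rewrite -ltrBlDr -ux// ltr_pXn2r// ?nnegrE ?sqrtr_ge0 ?(ltW h0).
    rewrite (le_lt_trans _ c'h) ?le_max ?lexx//=.
    rewrite hyp_le ?(ltW h0)//.
    by rewrite -lerBrDr -ux// ler_pXn2r// ?nnegrE ?sqrtr_ge0 ?(ltW h0).
  by rewrite /wt max_r// ltW.
rewrite (@integral_derive_oc hyp (fun h => h / hyp h)%R _ _ ucd
  (fun x _ => is_derive_hyp x)) ?hu//.
apply: continuous_subspaceT => x; apply: cvgM; first exact: cvg_id.
by apply: cvgV; [rewrite gt_eqF|exact: continuous_hyp].
Qed.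

Lemma ge0_integral_hyperbola (f : R -> \bar R) :
  measurable_fun setT f -> (forall r, 0 <= f r) ->
  \int[lambda]_(h in `]0%R, +oo[) f h =
  \int[lambda]_(r in `]a, +oo[)
    (f (Num.sqrt (r ^+ 2 - a ^+ 2)) * (r / Num.sqrt (r ^+ 2 - a ^+ 2))%:E).
Proof.
move=> mf f0.
(* The image of the weighted measure lives on []a, +oo[]. Adding Lebesgue measure on []-oo, a]]
   gives a measure that can be compared with [lebesgue_measure] on the whole line. *)
pose wa : measurableTypeR R -> R := \1_(`]-oo, a]%classic).
have mwa : measurable_fun setT wa by exact: measurable_indic.
have wa0 h : (0 <= wa h)%R by [].
have mid : measurable_fun setT (@idfun (measurableTypeR R)) by exact: measurable_id.
pose m : {measure set (measurableTypeR R) -> \bar R} := measure_add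
  (weighted_measure lambda measurable_hyp measurable_wt wt_ge0)
  (weighted_measure lambda mid mwa wa0).
have lm A : measurable A -> lambda A = m A.
  apply: lebesgue_measure_unique => _ [[c d] _ <-] /=.
  rewrite [RHS](measure_addE _ _ _) [X in _ = X + _]weighted_hyp_oc.
  rewrite [X in _ = _ + X](_ : _ = lambda `]c, (Num.min d a)]%classic); last first.
    rewrite /= /weighted_pushforward preimage_id integral_indic//.
    congr lambda; apply/seteqP; split => x /=; rewrite !in_itv /= le_min.
      by move=> [-> /andP[-> ->]].
    by move=> /andP[-> /andP[-> ->]].
  rewrite !lebesgue_measure_oc -EFinD; congr (_%:E).
  rewrite /Num.max /Num.min.
  by case: (ltP c a) => ?; case: (ltP d a) => ?; do 3? case: ifPn;
    rewrite -?leNgt; lra.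
pose psi r := if (a < r)%R then
    f (Num.sqrt (r ^+ 2 - a ^+ 2)) * (r / Num.sqrt (r ^+ 2 - a ^+ 2))%:E else 0.
have mpsi : measurable_fun setT psi.
  apply: measurable_fun_ifT => //; first exact: measurable_fun_ltr.
  have mu : measurable_fun setT (fun r : R => Num.sqrt (r ^+ 2 - a ^+ 2)%R).
    apply: measurableT_comp; first exact: measurable_sqrtr.
    by apply: measurable_funB => //; exact: measurable_funX.
  apply: emeasurable_funM; first exact: measurableT_comp.
  apply/measurable_EFinP/measurable_funM => //.
  by apply: measurableT_comp; first exact: measurable_invr.
have psi0 r : 0 <= psi r.
  rewrite /psi; case: ifPn => // ar; rewrite mule_ge0// lee_fin divr_ge0//.
  by rewrite ltW// (lt_trans a0).
transitivity (\int[lambda]_r psi r); last first.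
  rewrite [RHS]integral_mkcond; apply: eq_integral => r _.
  by rewrite patchE /psi mem_setE in_itv /= andbT.
rewrite [RHS](eq_measure_integral m); last by move=> A mA _; exact: lm.
rewrite [RHS]ge0_integral_measure_add//.
rewrite [X in _ = X + _](_ : _ = \int[lambda]_h (psi (hyp h) * (wt h)%:E)); last first.
  exact: (ge0_integral_weighted_pushforward lambda measurable_hyp measurable_wt wt_ge0).
rewrite [X in _ = _ + X](_ : _ = 0) ?adde0; last first.
  rewrite ge0_integral_weighted_pushforward// integral0_eq// => r _ /=.
  rewrite /psi /wa indicE mem_setE in_itv /=; case: ltP => ar; last by rewrite mul0e.
  by rewrite mule0.
rewrite integral_mkcond; apply: eq_integral => h _.
rewrite patchE mem_setE in_itv /= andbT /wt.
have [h0|h0] := leP h 0%R; first by rewrite mul0r mule0.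
rewrite /psi hyp_gt ?ltW// ltrDr exprn_gt0// hyp_sqr addrK sqrtr_sqr gtr0_norm//.
rewrite -muleA -EFinM.
rewrite (_ : hyp h / h * _ = 1)%R ?mule1//.
by field; rewrite !gt_eqF.
Qed.

End hyperbola.

End one_dimensional_substitution.

(** * Polar coordinates *)

Section polar_coordinates.
Context {R : realType}.
Local Open Scope ereal_scope.
Local Notation lambda := (@lebesgue_measure R).

Lemma ge0_integral_lebesgue_Rn n (f : boxRn R n -> \bar R) :
  measurable_fun setT f -> (forall x, 0 <= f x) ->
  \int[@lebesgue_Rn R n]_x f x = \int[@lebesgue_box R n]_x f x.
Proof.
move=> mf f0.
pose j : lebRn R n -> boxRn R n := idfun.
have mj : measurable_fun setT j.
  by move=> _ A mA; rewrite setTI; exact: box_measurable_lebesgue.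
transitivity (\int[pushforward (@lebesgue_Rn R n) j]_x f x).
  by rewrite ge0_integral_pushforward.
exact: eq_measure_integral.
Qed.

Lemma ge0_integral_reflect (f : R -> \bar R) :
  measurable_fun setT f -> (forall r, 0 <= f r) ->
  \int[lambda]_h f h = \int[lambda]_(h in `]0%R, +oo[) (f h + f (- h)%R).
Proof.
move=> mf f0.
have mfN : measurable_fun setT (fun h : R => f (- h)%R) by exact: measurableT_comp.
have -> : [set: R] = `]-oo, 0%R] `|` `]0%R, +oo[ :> set R.
  by apply/seteqP; split => // x _ /=; rewrite !in_itv/= andbT; case: leP; [left|right].
rewrite ge0_integral_setU//; first last.
- rewrite disj_set2E; apply/eqP/seteqP; split => // x /=.
  by rewrite !in_itv /= andbT => -[]; case: leP.
- exact: measurable_funTS.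
rewrite ge0_integralD//; try exact: measurable_funTS.
rewrite addeC; congr (_ + _).
have := ge0_integration_by_substitution0 mfN (fun r => f0 (- r)%R).
under [X in _ = X -> _]eq_integral do rewrite opprK.
by move=> <-; rewrite integral_itv_obnd_cbnd//; exact: measurable_funTS.
Qed.

(** For fixed [y] with [|y| = a], the half-lines [h > 0] and [h < 0] are both parametrized by the
    radius. The hyperbola degenerates for [a = 0], where [k = r] and the weight is [1]. *)
Lemma ge0_integral_sphere_section (a : R) (f : R -> \bar R) : (0 <= a)%R ->
  measurable_fun setT f -> (forall r, 0 <= f r) ->
  \int[lambda]_h f h = \int[lambda]_(r in `]a, +oo[)
    (let k := Num.sqrt (r ^+ 2 - a ^+ 2) in (f k + f (- k)%R) * (r / k)%:E).
Proof.
move=> a_ge0 mf f0; rewrite ge0_integral_reflect//.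
have mfN : measurable_fun setT (fun h : R => f (- h)%R) by exact: measurableT_comp.
move: a_ge0; rewrite le_eqVlt => /predU1P[<-|a0].
  apply: eq_integral => r; rewrite mem_setE in_itv /= andbT => r0.
  rewrite expr0n/= subr0 sqrtr_sqr gtr0_norm// divff ?gt_eqF//.
  by rewrite mule1.
rewrite (ge0_integral_hyperbola a0)//.
- exact: emeasurable_funD.
- by move=> r; rewrite adde_ge0.
Qed.

Section polar.
Context {m : nat} (x0 : 'rV[R]_m.+1) (g : boxRn R m.+1 -> \bar R).
Hypotheses (mg : measurable_fun setT g) (g0 : forall x, 0 <= g x).

(** The integrand of [sphere_integral], extended by [0] so as to be a function on the whole product
    space. *)
Definition sphere_integrand (y : 'rV[R]_m) (r : R) : \bar R :=
  if (enorm y < r)%R then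
    let k := Num.sqrt (r ^+ 2 - enorm y ^+ 2) in
    (g (x0 + @snoc R m.+1 y k)%R + g (x0 + @snoc R m.+1 y (- k))%R) * (r / k)%:E
  else 0.

Lemma sphere_integrand_ge0 y r : 0 <= sphere_integrand y r.
Proof.
rewrite /sphere_integrand; case: ifPn => // yr; rewrite mule_ge0 ?adde_ge0//.
by rewrite lee_fin divr_ge0 ?sqrtr_ge0// (le_trans (enorm_ge0 y))// ltW.
Qed.

Let half (z : (boxRn R m * measurableTypeR R)%type) : R :=
  Num.sqrt (z.2 ^+ 2 - enorm (z.1 : 'rV[R]_m) ^+ 2)%R.

Let measurable_half : measurable_fun setT half.
Proof.
apply: measurableT_comp; first exact: measurable_sqrtr.
apply: measurable_funB; apply: measurable_funX => //.
by apply: measurableT_comp; first exact: measurable_enorm.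
Qed.

Lemma measurable_translated_snoc d (T : measurableType d) (y : T -> boxRn R m)
    (h : T -> R) : measurable_fun setT y -> measurable_fun setT h ->
  measurable_fun setT (fun t => (x0 + @snoc R m.+1 (y t) (h t))%R : boxRn R m.+1).
Proof.
move=> my mh; apply: measurable_row => i; move: i; apply: ord_last_ind => [i|].
  under eq_fun do rewrite mxE snoc_widen.
  apply: measurable_funD => //.
  exact: (measurableT_comp (measurable_coord i) my).
by under eq_fun do rewrite mxE snoc_max; exact: measurable_funD.
Qed.

Lemma measurable_sphere_integrand : measurable_fun setT
  (fun z : (boxRn R m * measurableTypeR R)%type => sphere_integrand z.1 z.2).
Proof.
have m1 := @measurable_fst _ _ (boxRn R m) (measurableTypeR R).
apply: measurable_fun_ifT => //.
  apply: measurable_fun_ltr => //.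
  by apply: measurableT_comp; first exact: measurable_enorm.
apply: emeasurable_funM.
  apply: emeasurable_funD; apply: (measurableT_comp mg);
    apply: measurable_translated_snoc => //.
  exact: measurableT_comp.
apply/measurable_EFinP/measurable_funM => //.
by apply: measurableT_comp; first exact: measurable_invr.
Qed.

Lemma sphere_integralE r :
  sphere_integral x0 r g = \int[@lebesgue_box R m]_y sphere_integrand y r.
Proof.
rewrite -ge0_integral_lebesgue_Rn; last by move=> y; exact: sphere_integrand_ge0.
- rewrite /sphere_integral [LHS]integral_mkcond; apply: eq_integral => y _.
  by rewrite patchE /sphere_integrand mem_setE.
- exact: (measurableT_comp measurable_sphere_integrand (pair2_measurable r)).
Qed.

Lemma measurable_sphere_integral : measurable_fun setT (fun r : R => sphere_integral x0 r g).
Proof.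
under eq_fun do rewrite sphere_integralE.
apply: (measurable_fun_fubini_tonelli_G (m1 := @lebesgue_box R m)
  (fun z : (boxRn R m * measurableTypeR R)%type => sphere_integrand z.1 z.2)).
- exact: measurable_sphere_integrand.
- by move=> z; exact: sphere_integrand_ge0.
Qed.

Lemma sphere_integral_ge0 r : 0 <= sphere_integral x0 r g.
Proof. by rewrite sphere_integralE integral_ge0// => y _; exact: sphere_integrand_ge0. Qed.

(** After a translation, Fubini's theorem splits [x] into [(y, h)]; for each [y] the variable [h] is
    replaced by the radius, and the order of integration is exchanged back. *)
Theorem ge0_integral_polar :
  \int[@lebesgue_box R m.+1]_x g x = \int[lambda]_r sphere_integral x0 r g.
Proof.
rewrite -(ge0_integral_translate x0 mg g0).
rewrite ge0_integral_snoc//; last first.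
  by apply: (measurableT_comp mg); exact: measurable_translate.
under [RHS]eq_integral do rewrite sphere_integralE.
rewrite -(fubini_tonelli
  (fun z : (boxRn R m * measurableTypeR R)%type => sphere_integrand z.1 z.2)); last 2 first.
- exact: measurable_sphere_integrand.
- by move=> z; exact: sphere_integrand_ge0.
apply: eq_integral => y _.
rewrite (ge0_integral_sphere_section (enorm_ge0 y)); last 2 first.
- apply: (measurableT_comp mg).
  by apply: (measurable_translated_snoc (y := cst y) (h := id)).
- by [].
rewrite integral_mkcond; apply: eq_integral => r _.
by rewrite patchE /sphere_integrand mem_setE in_itv /= andbT.
Qed.

End polar.
End polar_coordinates.

(** * Comparison and scaling of surface integrals, and integration along rays *)

Section sphere_integrals.
Context {R : realType} {m : nat}.
Local Open Scope ereal_scope.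
Local Notation lambda := (@lebesgue_measure R).
Implicit Types (y : 'rV[R]_m) (r : R).

(** The integral of a nonnegative function is a supremum over its simple minorants, and a minorant
    of [f] is one of [f']. It is stated without measurability so as to apply to [Q] on a single
    sphere. *)
Lemma ge0_le_integralW d (T : measurableType d) (mu : {measure set T -> \bar R})
    (D : set T) (f f' : T -> \bar R) : (forall x, D x -> 0 <= f x) ->
  (forall x, D x -> f x <= f' x) ->
  \int[mu]_(x in D) f x <= \int[mu]_(x in D) f' x.
Proof.
move=> f0 ff'; rewrite !ge0_integralE//; last first.
  by move=> x Dx; exact: le_trans (f0 _ Dx) (ff' _ Dx).
apply: ereal_sup_le => _ [h hf <-]; exists h => // x.
apply: le_trans (hf x) _; rewrite !patchE; case: ifPn => // /set_mem Dx.
exact: ff'.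
Qed.

Lemma snoc_scale y r h : @snoc R m.+1 (r *: y)%R (r * h)%R = (r *: @snoc R m.+1 y h)%R.
Proof.
apply/rowP; apply: ord_last_ind => [j|].
  by rewrite [RHS]mxE !snoc_widen mxE.
by rewrite [RHS]mxE !snoc_max.
Qed.

Lemma enorm_snoc_half y r (k := Num.sqrt (r ^+ 2 - enorm y ^+ 2)%R) :
  (enorm y < r)%R ->
  enorm (@snoc R m.+1 y k) = r /\ enorm (@snoc R m.+1 y (- k)%R) = r.
Proof.
move=> yr; have r0 : (0 <= r)%R by rewrite (le_trans (enorm_ge0 y))// ltW.
have kE : (k ^+ 2 = r ^+ 2 - enorm y ^+ 2)%R.
  by rewrite sqr_sqrtr// subr_ge0 ler_pXn2r ?nnegrE ?enorm_ge0// ltW.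
split; apply/eqP; rewrite -(@eqrXn2 _ 2)// ?enorm_ge0//;
  by rewrite enorm_snoc ?sqrrN kE; apply/eqP; ring.
Qed.

Lemma le_sphere_integral (x0 : 'rV[R]_m.+1) r (g g' : 'rV[R]_m.+1 -> \bar R) :
  (forall x, sphere x0 r x -> 0 <= g x) ->
  (forall x, sphere x0 r x -> g x <= g' x) ->
  sphere_integral x0 r g <= sphere_integral x0 r g'.
Proof.
move=> g0 gg'; have sph y : (enorm y < r)%R ->
    let k := Num.sqrt (r ^+ 2 - enorm y ^+ 2) in
    sphere x0 r (x0 + @snoc R m.+1 y k)%R /\ sphere x0 r (x0 + @snoc R m.+1 y (- k))%R.
  by move=> /enorm_snoc_half[h1 h2] /=; rewrite /sphere /= ![(x0 + _)%R]addrC !addrK.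
have rk y : (enorm y < r)%R ->
    0 <= (r / Num.sqrt (r ^+ 2 - enorm y ^+ 2))%:E.
  move=> yr; rewrite lee_fin divr_ge0 ?sqrtr_ge0//.
  by rewrite (le_trans (enorm_ge0 y))// ltW.
apply: ge0_le_integralW => y /= yr; have [s1 s2] := sph y yr.
  by rewrite mule_ge0 ?rk// adde_ge0// g0.
by rewrite lee_wpmul2r ?rk// leeD// gg'.
Qed.

Lemma eq_sphere_integral (x0 : 'rV[R]_m.+1) r (g g' : 'rV[R]_m.+1 -> \bar R) :
  (forall x, sphere x0 r x -> 0 <= g x) ->
  (forall x, sphere x0 r x -> g x = g' x) ->
  sphere_integral x0 r g = sphere_integral x0 r g'.
Proof.
move=> g0 gg'; apply/eqP; rewrite eq_le.
by rewrite !le_sphere_integral// => x xr; rewrite -gg'// g0.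
Qed.

Lemma measurable_sphere_integrand_section (x0 : 'rV[R]_m.+1)
    (g : boxRn R m.+1 -> \bar R) r : measurable_fun setT g ->
  measurable_fun setT (fun y : boxRn R m => sphere_integrand x0 g y r).
Proof.
by move=> mg; exact: (measurableT_comp (measurable_sphere_integrand x0 mg) (pair2_measurable r)).
Qed.

Lemma sphere_integral_scale (x0 : 'rV[R]_m.+1) r (g : boxRn R m.+1 -> \bar R) : (0 < r)%R ->
  measurable_fun setT g -> (forall x, 0 <= g x) ->
  sphere_integral x0 r g =
  (r ^+ m)%:E * \int[@lebesgue_box R m]_y
     sphere_integrand 0 (fun x => g (x0 + r *: (x : 'rV[R]_m.+1))%R) y 1.
Proof.
move=> r0 mg g0; rewrite (sphere_integralE x0 mg g0).
have mF : measurable_fun setT (fun y : boxRn R m => sphere_integrand x0 g y r).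
  exact: measurable_sphere_integrand_section.
have F0 y : 0 <= sphere_integrand x0 g y r by exact: sphere_integrand_ge0.
rewrite (ge0_integral_scale r0 mF F0).
congr (_ * _); apply: eq_integral => y _; rewrite /sphere_integrand.
rewrite enormZ gtr0_norm// gtr_pMr//; case: ifPn => // y1.
have -> : (Num.sqrt (r ^+ 2 - (r * enorm y) ^+ 2) =
    r * Num.sqrt (1 ^+ 2 - enorm y ^+ 2))%R.
  rewrite (_ : r ^+ 2 - _ = r ^+ 2 * (1 ^+ 2 - enorm y ^+ 2))%R; last by ring.
  by rewrite sqrtrM ?sqr_ge0// sqrtr_sqr gtr0_norm.
set k := Num.sqrt (1 ^+ 2 - _)%R.
rewrite -[(- (r * k))%R]mulrN !snoc_scale !add0r; congr (_ * _%:E).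
by rewrite invfM mulrA divff ?gt_eqF.
Qed.

Lemma measurable_line (x0 t : 'rV[R]_m.+1) :
  measurable_fun setT (fun r : R => (x0 + r *: t)%R : boxRn R m.+1).
Proof.
apply: measurable_row => i; under eq_fun do rewrite !mxE.
by apply: measurable_funD => //; exact: measurable_funM.
Qed.

Lemma measurable_dilation (x0 : 'rV[R]_m.+1) r : measurable_fun setT
  (fun x : boxRn R m.+1 => (x0 + r *: (x : 'rV[R]_m.+1))%R : boxRn R m.+1).
Proof.
apply: measurable_row => i.
rewrite (_ : (fun _ => _) = (fun x : boxRn R m.+1 => x0 ord0 i + r * x ord0 i)%R).
  by apply: measurable_funD => //; apply: measurable_funM => //; exact: measurable_coord.
by apply/funext => x; rewrite !mxE.
Qed.

Lemma unit_sphere_areaE : @unit_sphere_area R m.+1 =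
  \int[@lebesgue_box R m]_y sphere_integrand 0 (cst 1) y 1.
Proof. by rewrite /unit_sphere_area sphere_integralE. Qed.

Lemma sphere_integral_cst (x0 : 'rV[R]_m.+1) r : (0 < r)%R ->
  sphere_integral x0 r (cst 1) = (r ^+ m)%:E * @unit_sphere_area R m.+1.
Proof. by move=> r0; rewrite sphere_integral_scale// unit_sphere_areaE. Qed.

(** Scaling the sphere of radius [r] to the unit sphere brings out [r^m]. After an exchange of the
    integrals, each [y] in the unit disc contributes the integrals along the two rays with
    directions [snoc y k] and [snoc y (- k)]. *)
Theorem radial_lower_bound (x0 : 'rV[R]_m.+1) (g : boxRn R m.+1 -> \bar R) (c : R) :
  measurable_fun setT g -> (forall x, 0 <= g x) -> (0 <= c)%R ->
  (forall t, enorm t = 1%R ->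
    c%:E <= \int[lambda]_(r in `]0%R, +oo[) ((r ^+ m)%:E * g (x0 + r *: t)%R)) ->
  c%:E * @unit_sphere_area R m.+1 <= \int[@lebesgue_box R m.+1]_x g x.
Proof.
move=> mg g0 c0 cg; rewrite (ge0_integral_polar x0)//.
(* [Num.max 0 r] makes [h] nonnegative for every real [r]. *)
pose h r (x : 'rV[R]_m.+1) := (Num.max 0 r ^+ m)%:E * g (x0 + r *: x)%R.
have h0 r x : 0 <= h r x.
  by rewrite mule_ge0// lee_fin exprn_ge0// le_max lexx.
pose G (z : (boxRn R m * measurableTypeR R)%type) : \bar R :=
  if (0 < z.2)%R then sphere_integrand 0 (h z.2) z.1 1 else 0.
have mh (kappa : (boxRn R m * measurableTypeR R)%type -> R) :
    measurable_fun setT kappa ->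
    measurable_fun setT (fun z : (boxRn R m * measurableTypeR R)%type =>
      h z.2 (0 + @snoc R m.+1 z.1 (kappa z))%R).
  move=> mk; apply: emeasurable_funM.
    by apply/measurable_EFinP/measurable_funX; exact: measurable_maxr.
  apply: (measurableT_comp mg); apply: measurable_row => i.
  rewrite (_ : (fun _ => _) = (fun z : (boxRn R m * measurableTypeR R)%type =>
    x0 ord0 i + z.2 * (0 + @snoc R m.+1 z.1 (kappa z) : 'rV[R]_m.+1) ord0 i)%R); last first.
    by apply/funext => z; rewrite [LHS]mxE [X in (_ + X = _)%R]mxE.
  apply: measurable_funD => //; apply: measurable_funM => //.
  apply: (measurableT_comp (measurable_coord i)).
  exact: (measurable_translated_snoc 0 measurable_fst mk).
have mhalf : measurable_fun setT (fun z : (boxRn R m * measurableTypeR R)%type =>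
    Num.sqrt (1 ^+ 2 - enorm (z.1 : 'rV[R]_m) ^+ 2)%R).
  apply: measurableT_comp; first exact: measurable_sqrtr.
  apply: measurable_funB; first by [].
  apply: measurable_funX; exact: (measurableT_comp (@measurable_enorm R m) measurable_fst).
have mG : measurable_fun setT G.
  apply: measurable_fun_ifT => //; first exact: measurable_fun_ltr.
  apply: measurable_fun_ifT => //.
    apply: measurable_fun_ltr => //.
    exact: (measurableT_comp (@measurable_enorm R m) measurable_fst).
  apply: emeasurable_funM; last first.
    apply/measurable_EFinP/measurable_funM => //.
    by apply: measurableT_comp; first exact: measurable_invr.
  by apply: emeasurable_funD; apply: mh => //; exact: measurableT_comp.
have G0 z : 0 <= G z.
  by rewrite /G; case: ifP => // _; apply: sphere_integrand_ge0 => x; exact: h0.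
apply: (@le_trans _ _ (\int[lambda]_r \int[@lebesgue_box R m]_y G (y, r))); last first.
  apply: ge0_le_integralW => r _; first exact: integral_ge0.
  have [r0|r0] := boolP (0 < r)%R; last first.
    by rewrite /G /= (negbTE r0) integral0; exact: sphere_integral_ge0.
  rewrite /G /= r0.
  rewrite (sphere_integral_scale x0 r0)//.
  set S := fun y => sphere_integrand 0 (fun x => g (x0 + r *: (x : 'rV[R]_m.+1))%R) y 1.
  have mS : measurable_fun setT (S : boxRn R m -> \bar R).
    apply: measurable_sphere_integrand_section.
    exact: (measurableT_comp mg (measurable_dilation x0 r)).
  have S0 y : 0 <= S y by exact: sphere_integrand_ge0.
  have rm0 : 0 <= (r ^+ m)%:E by rewrite lee_fin exprn_ge0// ltW.
  rewrite (_ : _ * _ = \int[@lebesgue_box R m]_y ((r ^+ m)%:E * S y)); last first.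
    by rewrite ge0_integralZl.
  rewrite le_eqVlt; apply/orP; left; apply/eqP; apply: eq_integral => y _.
  rewrite /S /sphere_integrand; case: ifPn => [y1|]; last by rewrite mule0.
  by rewrite muleA ge0_muleDr// /h max_r// ltW.
rewrite -(fubini_tonelli G)// unit_sphere_areaE.
set S := fun y => sphere_integrand 0 (cst 1) y 1.
have mS : measurable_fun setT (S : boxRn R m -> \bar R).
  by apply: measurable_sphere_integrand_section; exact: measurable_cst.
have S0 y : 0 <= S y by exact: sphere_integrand_ge0.
rewrite (_ : _ * _ = \int[@lebesgue_box R m]_y (c%:E * S y)); last first.
  by rewrite ge0_integralZl.
rewrite /S {mS S0 S}.
apply: ge0_le_integralW => y _.
  by rewrite mule_ge0// sphere_integrand_ge0.
have [y1|y1] := ltP (enorm y) 1%R; last first.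
  rewrite /sphere_integrand ltNge y1/= mule0; exact: integral_ge0.
have [n1 n2] := enorm_snoc_half y1.
set k := Num.sqrt (1 ^+ 2 - enorm y ^+ 2)%R in n1 n2.
have k0 : (0 <= 1 / k)%R by rewrite divr_ge0 ?sqrtr_ge0.
have mr (t : 'rV[R]_m.+1) : measurable_fun (`]0%R, +oo[%classic : set R)
    (fun r : R => (r ^+ m)%:E * g (x0 + r *: t)%R).
  apply: measurable_funTS; apply: emeasurable_funM.
    by apply/measurable_EFinP; exact: measurable_funX.
  exact: (measurableT_comp mg (measurable_line x0 t)).
apply: (@le_trans _ _ (\int[lambda]_(r in `]0%R, +oo[)
   (((r ^+ m)%:E * g (x0 + r *: @snoc R m.+1 y k)%R +
    (r ^+ m)%:E * g (x0 + r *: @snoc R m.+1 y (- k))%R) * (1 / k)%:E))); last first.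
  rewrite integral_mkcond; apply: ge0_le_integralW => r _.
    rewrite patchE mem_setE in_itv/= andbT; case: ifPn => // r0.
    by rewrite mule_ge0 ?lee_fin// adde_ge0// mule_ge0// lee_fin exprn_ge0// ltW.
  rewrite patchE mem_setE in_itv/= andbT /G /=; case: ifPn => // r0.
  by rewrite /sphere_integrand y1 /= -/k !add0r /h max_r// ltW.
have kE0 : 0 <= (1 / k)%:E by rewrite lee_fin.
have pos t (r : R) : (`]0%R, +oo[%classic : set R) r -> 0 <= (r ^+ m)%:E * g (x0 + r *: t)%R.
  by rewrite /= in_itv /= andbT => r0; rewrite mule_ge0// lee_fin exprn_ge0// ltW.
rewrite ge0_integralZr//.
- rewrite ge0_integralD//; do ?[exact: mr | by move=> r; exact: pos].
  rewrite /sphere_integrand y1 /= -/k muleA lee_wpmul2r ?lee_fin//.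
  by rewrite ge0_muleDr ?lee_fin// mule1 leeD// cg.
- by apply: emeasurable_funD; exact: mr.
- by move=> r r0; rewrite adde_ge0 ?pos.
Qed.

End sphere_integrals.

(** * The area of the unit sphere is positive and finite *)

Section unit_sphere_area.
Context {R : realType} {m : nat}.
Local Open Scope ereal_scope.
Local Notation lambda := (@lebesgue_measure R).

Lemma coord_le_enorm n (x : 'rV[R]_n) i : (`|x ord0 i| <= enorm x)%R.
Proof.
rewrite -sqrtr_sqr ler_wsqrtr// (bigD1 i)//= lerDl sumr_ge0// => j _.
exact: sqr_ge0.
Qed.

Lemma unit_sphere_area_gt0 : 0 < @unit_sphere_area R m.+1.
Proof.
(* The cube of half-side [a] lies in the open unit disc because [m a^2 < 1], and there the integrand
   is at least [1]. *)
rewrite unit_sphere_areaE; pose a : R := (m.+1%:R)^-1%R.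
have a0 : (0 < a)%R by rewrite invr_gt0.
apply: (@lt_le_trans _ _ (\int[@lebesgue_box R m]_y (\1_(centered_box a) y)%:E)).
  rewrite integral_indic ?setIT//; last exact: measurable_box.
  rewrite [X in _ < X]lebesgue_box_box lte_fin /box_volume prodr_gt0// => i _.
  by rewrite !mxE opprK lt_max addr_gt0 ?orbT.
apply: ge0_le_integralW => y _; first by rewrite lee_fin.
rewrite indicE; case: (boolP (y \in _)) => [/set_mem ya|_]; last first.
  exact: sphere_integrand_ge0.
have y1 : (enorm y < 1)%R.
  rewrite -(@ltr_pXn2r _ 2)// ?nnegrE ?enorm_ge0// enorm_sqr expr1n.
  apply: (@le_lt_trans _ _ (\sum_(i < m) a ^+ 2)%R).
    apply: ler_sum => i _; rewrite -[X in (X <= _)%R]real_normK ?num_real//.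
    rewrite ler_pXn2r ?nnegrE// ?(ltW a0)// ler_norml.
    by have := ya i; rewrite !mxE => /andP[/ltW -> ->].
  rewrite sumr_const card_ord -mulr_natl /a exprVn ltr_pdivrMr ?exprn_gt0// mul1r.
  by rewrite -natrX ltr_nat expnS expn1 mulSn ltn_addr.
rewrite /sphere_integrand y1 /= -EFinD -EFinM lee_fin.
set k := Num.sqrt _.
have k0 : (0 < k)%R.
  by rewrite sqrtr_gt0 subr_gt0 ltr_pXn2r ?nnegrE ?enorm_ge0.
have k1 : (k <= 1)%R.
  by rewrite -[leRHS]sqrtr1 ler_wsqrtr// expr1n gerBl sqr_ge0.
rewrite (@le_trans _ _ (1 / k)%R)//.
  by rewrite ler_pdivlMr// mul1r.
by rewrite mulrDl !mul1r lerDl invr_ge0 ltW.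
Qed.

(** The spheres of radius between [1] and [2] have area at least that of the unit sphere, and they
    fill a bounded shell. *)
Lemma unit_sphere_area_lty : @unit_sphere_area R m.+1 < +oo.
Proof.
pose A : set (boxRn R m.+1) := annulus 0 1 2.
have mA : measurable A.
  rewrite (_ : A = @enorm R m.+1 @^-1` `]1%R, 2%R[%classic); last first.
    by apply/seteqP; split => x; rewrite /A /annulus /= in_itv /= subr0.
  by rewrite -[X in measurable X]setTI; apply: measurable_enorm.
have mI : measurable_fun setT (fun x => (\1_A x)%:E : \bar R).
  by apply/measurable_EFinP; exact: measurable_indic.
apply: (@le_lt_trans _ _ (\int[@lebesgue_box R m.+1]_x (\1_A x)%:E)); last first.
  rewrite integral_indic// setIT.
  apply: (le_lt_trans _ (lebesgue_box_lty (const_mx (- 2)%R, const_mx 2%R))).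
  apply: le_measure; rewrite ?inE//; first exact: measurable_box.
  move=> x /= /andP[_]; rewrite subr0 => x2 i; rewrite !mxE.
  have := le_lt_trans (coord_le_enorm x i) x2.
  by rewrite ltr_norml => /andP[-> /ltW].
rewrite (ge0_integral_polar 0)//.
apply: (@le_trans _ _ (\int[lambda]_(r in `]1%R, 2%R[) @unit_sphere_area R m.+1)).
  have l12 : lambda (`]1%R, 2%R[%classic : set R) = 1.
    rewrite lebesgue_measure_itv/= lte_fin ltr1n -EFinB.
    by congr (_%:E); ring.
  by rewrite integral_cst// [X in _ * X]l12 mule1.
rewrite integral_mkcond; apply: ge0_le_integralW => r _.
  by rewrite patchE; case: ifP => // _; exact/ltW/unit_sphere_area_gt0.
rewrite patchE mem_setE in_itv /=; case: ifPn => [/andP[r1 r2]|_]; last first.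
  exact: sphere_integral_ge0.
have r0 : (0 < r)%R by exact: lt_trans r1.
rewrite (@eq_sphere_integral _ _ 0 r (fun x => (\1_A x)%:E) (cst 1))//; last first.
  move=> x /= xr; rewrite indicE mem_set//= /A /annulus /=.
  by move: xr; rewrite /sphere /= => ->; rewrite r1 r2.
rewrite sphere_integral_cst// -[leLHS]mul1e lee_wpmul2r//.
  exact/ltW/unit_sphere_area_gt0.
by rewrite lee_fin exprn_ege1// ltW.
Qed.

End unit_sphere_area.

(** * Borel approximation from below *)

Section borel_minorants.
Context {R : realType} {n : nat}.
Local Open Scope ereal_scope.

Lemma countable_bigcup_measurable d (T : measurableType d) (I : pointedType)
    (C : set I) (F : I -> set T) : countable C ->
  (forall c, C c -> measurable (F c)) -> measurable (\bigcup_(c in C) F c).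
Proof.
move=> /countable_bijP[B]; rewrite card_eq_sym => /card_set_bijP[e [eC _ eB]] mF.
rewrite (_ : \bigcup_(c in C) F c = \bigcup_(k in B) F (e k)).
  by apply: bigcup_measurable => k Bk; apply/mF/eC.
apply/seteqP; split => [x [c /eB[k Bk <-] Fx]|x [k Bk Fx]]; first by exists k.
by exists (e k) => //; exact: eC.
Qed.

Lemma borel_hull (E : set 'rV[R]_n) : lebesgue_outer E < +oo ->
  exists H : set (boxRn R n),
    [/\ measurable H, E `<=` H & lebesgue_outer H = lebesgue_outer E].
Proof.
move=> Eoo; have Efin : lebesgue_outer E \is a fin_num.
  by rewrite ge0_fin_numE// outer_measure_ge0.
have cov k : exists U : set (boxRn R n), [/\ measurable U, E `<=` U &
    lebesgue_outer U <= lebesgue_outer E + (k.+1%:R^-1)%:E].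
  have k0 : (0 < k.+1%:R^-1 :> R)%R by rewrite invr_gt0.
  have [_ [C [cC EC] <-] /ltW CE] := lb_ereal_inf_adherent k0 Efin.
  exists (\bigcup_(ab in C) box ab); split => //.
    by apply: countable_bigcup_measurable => // ab _; exact: measurable_box.
  by apply: le_trans CE; exact: lebesgue_outer_cover.
have [U UP] := choice cov.
exists (\bigcap_k U k); split.
- by apply: bigcap_measurableType => k _; have [] := UP k.
- by move=> x Ex k _; have [_ + _] := UP k; apply.
apply/eqP; rewrite eq_le; apply/andP; split; last first.
  by apply: le_outer_measure => x Ex k _; have [_ + _] := UP k; apply.
apply/lee_addgt0Pr => e e0.
pose k := Num.truncn e^-1.
have [_ _ Uk] := UP k.
apply: (le_trans _ (le_trans Uk _)).
  by apply: le_outer_measure => x; apply.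
rewrite leeD2l// lee_fin -[leRHS]invrK lef_pV2 ?posrE ?invr_gt0//.
have e10 : (0 <= e^-1)%R by rewrite invr_ge0 ltW.
by have /andP[_ /ltW] := truncn_itv e10.
Qed.

(** The complement, in the bounded box [Q], of a Borel hull of the rest of [Q]; boundedness makes
    the measures finite, so that they can be subtracted. *)
Lemma borel_kernel (r : R) (A : set (lebRn R n)) : measurable A ->
  A `<=` centered_box r ->
  exists B : set (boxRn R n), [/\ measurable B, B `<=` A & lebesgue_box B = lebesgue_Rn A].
Proof.
move=> mA Ar; pose Q := @centered_box R n r.
have mQ : measurable (Q : set (boxRn R n)) by exact: measurable_box.
have Qoo : lebesgue_outer Q < +oo by exact: lebesgue_box_lty.
have QE : lebesgue_outer Q = lebesgue_outer A + lebesgue_outer (Q `\` A).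
  by rewrite (mA Q); congr (lebesgue_outer _ + _); exact/setIidr.
have QAoo : lebesgue_outer (Q `\` A) < +oo.
  by apply: le_lt_trans Qoo; apply: le_outer_measure; exact: subDsetl.
have [H [mH QAH HE]] := borel_hull QAoo.
exists (Q `\` H); split.
- exact: measurableD.
- by move=> x [Qx Hx]; apply: contrapT => Ax; apply/Hx/QAH.
have QH : lebesgue_box (Q `&` H : set (boxRn R n)) = lebesgue_outer (Q `\` A).
  apply/eqP; rewrite eq_le; apply/andP; split.
    by rewrite -HE; apply: le_outer_measure; exact: subIsetr.
  by apply: le_outer_measure => x [Qx Ax]; split => //; apply: QAH.
have QAfin : lebesgue_outer (Q `\` A) \is a fin_num.
  by rewrite ge0_fin_numE// outer_measure_ge0.
have -> : lebesgue_box (Q `\` H : set (boxRn R n)) =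
    lebesgue_box (Q : set (boxRn R n)) - lebesgue_box (Q `&` H : set (boxRn R n)).
  exact: measureD.
by rewrite QH [X in X - _]QE addeK.
Qed.

Import HBNNSimple.

Lemma borel_simple_minorant (r : R) (h : {nnsfun (lebRn R n) >-> R}) :
  (forall x, ~ centered_box r x -> h x = 0%R) ->
  exists s : boxRn R n -> \bar R, [/\ measurable_fun setT s,
    forall x, 0 <= s x, forall x, s x <= (h x)%:E &
    \int[@lebesgue_box R n]_x s x = sintegral (@lebesgue_Rn R n) h].
Proof.
move=> h0.
(* Only the values [v > 0] need a kernel: the level set of [0] may be unbounded, and it contributes
   [0] to the integral. *)
have ker (v : R) : exists B : set (boxRn R n), (0 < v)%R -> [/\ measurable B,
    B `<=` h @^-1` [set v] & lebesgue_box B = lebesgue_Rn (h @^-1` [set v])].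
  have [v0|v0] := ltP 0%R v; last by exists set0.
  have mv : measurable (h @^-1` [set v] : set (lebRn R n)) by exact: measurable_sfunP.
  have [|B BP] := borel_kernel mv (r := r).
    move=> x /= hx; apply: contrapT => /h0 hx0; move: v0.
    by rewrite -hx hx0 ltxx.
  by exists B.
have [B0 B0P] := choice ker.
pose B (v : R) : set (boxRn R n) := if (0 < v)%R then B0 v else set0.
have mB (v : R) : measurable (B v).
  by rewrite /B; case: ifPn => [v0|_]; [have [] := B0P _ v0|].
have Bh (v : R) : B v `<=` h @^-1` [set v].
  by rewrite /B; case: ifPn => [v0|_]; [have [] := B0P _ v0|].
have lB (v : R) : v%:E * lebesgue_box (B v) = v%:E * lebesgue_Rn (h @^-1` [set v]).
  rewrite /B; case: ltgtP => [v0|v0|<-]; last by rewrite !mul0e.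
    by congr (_ * _); have [] := B0P _ v0.
  by congr (_ * _); rewrite preimage_nnfun0.
pose t (v : R) (x : boxRn R n) : \bar R := (v * \1_(B v) x)%:E.
have rg0 (v : R) : (range h) v -> (0 <= v)%R by move=> [x _ <-].
have t0 (v : R) x : (range h) v -> 0 <= t v x.
  by move=> /rg0 v0; rewrite lee_fin mulr_ge0.
exists (fun x => \sum_(v \in range h) t v x); split.
- apply: emeasurable_fsum => // v.
  by apply/measurable_EFinP; apply: measurable_funM => //; exact: measurable_indic.
- move=> x; rewrite fsbig_finite//= big_seq sume_ge0// => v.
  by rewrite in_fset_set// inE => /t0.
- move=> x; rewrite fimfunE -fsumEFin//; apply: lee_fsum => // v /rg0 v0.
  rewrite /t lee_fin ler_wpM2l// !indicE ler_nat.
  by case: (boolP (x \in B v)) => [/set_mem/Bh xv|//]; rewrite mem_set.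
rewrite sintegralE.
have mt (v : R) : measurable_fun setT (t v).
  by apply/measurable_EFinP; apply: measurable_funM => //; exact: measurable_indic.
rewrite ge0_integral_fsum//.
apply: eq_fsbigr => v; rewrite inE => /rg0 v0; rewrite -lB /t.
under eq_integral do rewrite EFinM.
rewrite ge0_integralZl//.
- by rewrite integral_indic// setIT.
- by apply/measurable_EFinP; exact: measurable_indic.
- move=> v x _; rewrite /t /B lee_fin; case: ltP => v0; last first.
    by rewrite indicE in_set0 mulr0.
  by rewrite mulr_ge0// ltW.
Qed.
End borel_minorants.

Section polar_upper_bound.
Context {R : realType} {m : nat}.
Local Open Scope ereal_scope.
Local Notation lambda := (@lebesgue_measure R).

Import HBNNSimple.

(* The integral over [lebesgue_Rn] is the supremum of the integrals of its simple
   minorants, and these have Borel minorants with the same integral: no regularity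
   of the sections of [Q] is needed. *)
Theorem polar_upper_bound (x0 : 'rV[R]_m.+1) (r1 r2 : R)
    (Q : 'rV[R]_m.+1 -> \bar R) (phi B : R -> R) :
  (0 < r1)%R -> (forall x, 0 <= Q x) ->
  (forall r, (r1 < r < r2)%R -> (0 < phi r)%R) ->
  (forall r, (r1 < r < r2)%R -> (0 <= B r)%R) ->
  measurable_fun (`]r1, r2[%classic : set R) phi ->
  measurable_fun (`]r1, r2[%classic : set R) B ->
  {ae lambda, forall r, (r1 < r < r2)%R -> sphere_integral x0 r Q <= (B r)%:E} ->
  \int[@lebesgue_Rn R m.+1]_(x in annulus x0 r1 r2) (Q x * (phi (enorm (x - x0)))%:E)
  <= \int[lambda]_(r in `]r1, r2[) (phi r * B r)%:E.
Proof.
move=> r10 Q0 phi0 B0 mphi mB QB.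
rewrite ge0_integralE; last first.
  move=> x /= /phi0 phx; rewrite mule_ge0// lee_fin.
  exact: ltW.
apply: ge_ereal_sup => _ [h hG <-].
have hout x : ~ annulus x0 r1 r2 x -> h x = 0%R.
  move=> xA; apply/eqP; rewrite eq_le; apply/andP; split => //.
  by have := hG x; rewrite patchE memNset.
have [s [ms s0 sh <-]] : exists s : boxRn R m.+1 -> \bar R,
    [/\ measurable_fun setT s, forall x, 0 <= s x, forall x, s x <= (h x)%:E &
    \int[@lebesgue_box R m.+1]_x s x = sintegral (@lebesgue_Rn R m.+1) h].
  apply: (@borel_simple_minorant _ _ (enorm x0 + r2 + 1)%R) => x xc; apply: hout.
  apply: contra_not xc => /andP[_ xr] i; rewrite !mxE.
  have xi : (`|x ord0 i| < enorm x0 + r2 + 1)%R.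
    have -> : x ord0 i = ((x - x0) ord0 i + x0 ord0 i)%R by rewrite !mxE subrK.
    rewrite (le_lt_trans (ler_normD _ _))//.
    have := coord_le_enorm (x - x0) i; have := coord_le_enorm x0 i; lra.
  by move: xi; rewrite ltr_norml => /andP[-> /ltW].
rewrite (ge0_integral_polar x0)//.
rewrite [leRHS]integral_mkcond.
apply: ae_ge0_le_integral => //.
- by move=> r _; exact: sphere_integral_ge0.
- exact: measurable_sphere_integral.
- move=> r _; rewrite patchE mem_setE in_itv /=; case: ifP => // rr.
  by rewrite lee_fin mulr_ge0 ?B0// ltW// phi0.
- apply/(measurable_restrictT _ _).1 => //.
  by apply/measurable_EFinP; exact: measurable_funM.
case: QB => N [mN N0 QB]; exists N; split => // r /= nle.
apply: QB => /= QB; apply: nle => _.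
rewrite patchE mem_setE in_itv /=; case: ifPn => rr; last first.
  rewrite (@eq_sphere_integral _ _ _ _ s (cst 0))//.
    rewrite /sphere_integral integral0_eq// => y _ /=.
    by rewrite adde0 mul0e.
  move=> x; rewrite /sphere /= => xr.
  apply/eqP; rewrite eq_le s0 andbT (le_trans (sh x))// lee_fin hout//.
  by rewrite /annulus /= xr; exact/negP.
have phr := phi0 _ rr.
(* The factor [phi r] is taken out of the integral of the Borel function [s], whose sections are
   measurable; only then is [s / phi r] compared with [Q] on the sphere. *)
have -> : sphere_integral x0 r s =
    (phi r)%:E * sphere_integral x0 r (fun x => ((phi r)^-1)%:E * s x).
  rewrite sphere_integralE//.
  rewrite sphere_integralE//; last 2 first.
  - exact: measurable_funeM.
  - by move=> x; rewrite mule_ge0// lee_fin invr_ge0 ltW.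
  rewrite -ge0_integralZl//; last 3 first.
  - by apply: measurable_sphere_integrand_section; exact: measurable_funeM.
  - move=> y _; apply: sphere_integrand_ge0 => x.
    by rewrite mule_ge0// lee_fin invr_ge0 ltW.
  - by rewrite lee_fin ltW.
  apply: eq_integral => y _; rewrite /sphere_integrand; case: ifPn => yr; last by rewrite mule0.
  rewrite -ge0_muleDr// !muleA -EFinM divff ?gt_eqF// mul1e//.
rewrite EFinM lee_wpmul2l ?lee_fin ?(ltW phr)//.
apply: le_trans (QB rr); apply: le_sphere_integral.
  by move=> x _; rewrite mule_ge0// lee_fin invr_ge0 ltW.
move=> x; rewrite /sphere /= => xr.
rewrite lee_pdivrMl// (le_trans (sh x))// (le_trans (hG x))//.
rewrite patchE mem_set ?xr; last by rewrite /annulus /= xr.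
by rewrite muleC.
Qed.

End polar_upper_bound.

(** * Bounds for the modulus *)

Section segments.
Context {R : realType} {m : nat}.
Local Notation n := m.+1.
Local Open Scope ereal_scope.
Local Notation lambda := (@lebesgue_measure R).

Lemma ge0_integral_shift (a : R) (f : R -> \bar R) :
  measurable_fun setT f -> (forall x, 0 <= f x) ->
  \int[lambda]_x f (a + x)%R = \int[lambda]_x f x.
Proof.
move=> mf f0.
have ma : measurable_fun [set: measurableTypeR R] (fun x : R => (a + x)%R : measurableTypeR R).
  exact: measurable_funD.
pose mu : {measure set (measurableTypeR R) -> \bar R} :=
  measure_function_pushforward__canonical__measure_function_Measure lambda ma.
transitivity (\int[mu]_x f x); first by rewrite ge0_integral_pushforward.
apply: eq_measure_integral => A mA _; apply/esym.
apply: (@lebesgue_measure_unique _ mu) => //.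
move=> _ [[c d] _ <-] /=; rewrite /mu /= /pushforward.
rewrite (_ : _ @^-1` _ = `](c - a)%R, (d - a)%R]%classic); last first.
  by apply/seteqP; split => x /=; rewrite !in_itv /= ltrBlDl lerBrDl.
rewrite !lebesgue_measure_oc; congr (_%:E).
by congr Num.max; ring.
Qed.

Definition ray (y t : 'rV[R]_n) (s : R) : 'rV[R]_n := (y + s *: t)%R.

Lemma continuous_ray y t : continuous (ray y t).
Proof.
move=> s; apply: (@cvgD _ _ _ (nbhs s) _ (cst y) (fun s => s *: t)%R); first exact: cvg_cst.
by exact: scalel_continuous.
Qed.

Variables (y t : 'rV[R]_n).
Hypothesis t1 : enorm t = 1%R.

Lemma arc_length_ray (a b : R) : (a <= b)%R -> arc_length (ray y t) a b = (b - a)%:E.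
Proof.
move=> ab; rewrite /arc_length.
rewrite (_ : [set _ | s in _] = [set (b - a)%:E]) ?ereal_sup1//.
have sumE s : itv_partition a b s ->
    (\sum_(0 <= i < size s) enorm (ray y t (nth b (a :: s) i.+1) - ray y t (nth b (a :: s) i)))%R
      = (b - a)%R.
  move=> abs.
  under eq_big_nat => i /andP[_ si].
    rewrite /ray opprD addrACA subrr add0r -scalerBl enormZ t1 mulr1 ger0_norm; last first.
      rewrite subr_ge0; apply: (nondecreasing_fun_itv_partition (f := idfun) _ abs si).
      by move=> ? ? _ _.
    over.
  by rewrite telescope_sumr//= (itv_partition_nth_size _ abs).
apply/seteqP; split => [_ [s abs <-]|_ ->].
  by rewrite (sumE _ abs).
move: ab; rewrite le_eqVlt => /predU1P[ab|ab].
  by exists [::]; [rewrite ab; split|rewrite /= big_nil ab subrr].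
by exists [:: b]; rewrite ?sumE//; exact: itv_partition1.
Qed.

Lemma curve_integral_ray (g : @curve R n) (rho : 'rV[R]_n -> \bar R) :
  cfun g = ray y t -> measurable_fun setT (rho \o ray y t) -> (forall x, 0 <= rho x) ->
  curve_integral g rho = \int[lambda]_(s in `[cleft g, cright g]) rho (ray y t s).
Proof.
move=> gE mrho rho0; have lr := ltW (cleft_lt_right g).
rewrite /curve_integral gE arc_length_ray//=.
rewrite [RHS]integral_mkcond [LHS]integral_mkcond.
rewrite -[RHS](ge0_integral_shift (cleft g)); last 2 first.
- apply/(measurable_restrictT _ _).1 => //; exact: measurable_funTS.
- by move=> x; rewrite patchE; case: ifP.
apply: eq_integral => s _; rewrite !patchE !mem_setE !in_itv /=.
rewrite lerDl -lerBrDl; case: ifPn => // /andP[s0 sl].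
(* On a ray with unit direction, arc length [s] is reached at the only time [cleft g + s]. *)
congr rho; rewrite /arc_param gE (xget_unique _ (x := (cleft g + s)%R))//.
  split; first by rewrite lerDl s0 -lerBrDl sl.
  by rewrite arc_length_ray ?lerDl// addrC addKr.
move=> u [/andP[lu ur]]; rewrite arc_length_ray// => -[<-].
by rewrite addrC subrK.
Qed.

End segments.

(** * Exit times of rays from the images of balls *)

Section exit_times.
Context {R : realType} {m : nat}.
Local Notation n := m.+1.
Implicit Types (x t : 'rV[R]_n).

Lemma continuous_enorm_dist x1 : continuous (fun x : 'rV[R]_n => enorm (x - x1)).
Proof.
move=> x; apply: (@continuous_comp _ _ _ (fun x : 'rV[R]_n => \sum_(i < n) (x - x1) ord0 i ^+ 2)
  Num.sqrt); last exact: sqrt_continuous.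
pose F i (x : 'rV[R]_n) : R := (x - x1) ord0 i ^+ 2.
have cF i : continuous (F i).
  move=> z.
  have cz : u - x1 @[u --> z] --> z - x1.
    by apply: (@cvgB _ _ _ (nbhs z) _ id (cst x1)); [exact: cvg_id|exact: cvg_cst].
  have ci := cvg_comp _ _ cz (@coord_continuous _ _ _ ord0 i (z - x1)).
  exact: (cvg_comp _ _ ci (@exprn_continuous _ 2 _)).
by apply: (@continuous_big _ _ _ _ _ _ _ (index_enum 'I_n) F) => [|i _];
  [exact: add_continuous|exact: cF].
Qed.

Lemma norm_le_enorm x : `|x| <= enorm x.
Proof. by apply: normr_rV_le => [|i]; [exact: enorm_ge0|exact: coord_le_enorm]. Qed.

Lemma compact_eball x1 r : compact [set x : 'rV[R]_n | enorm (x - x1) <= r].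
Proof.
apply: (@subclosed_compact _ _ [set x : 'rV[R]_n | `|x - x1| <= r]).
- rewrite (_ : [set _ | _] = (fun x : 'rV[R]_n => enorm (x - x1)) @^-1` [set y | y <= r])//.
  by apply: preimage_closed; [move=> x _; exact: continuous_enorm_dist|exact: closed_le].
- exact: compact_cube.
- by move=> x /= xr; exact: le_trans (norm_le_enorm _) xr.
Qed.

Lemma open_eball x1 r : open [set x : 'rV[R]_n | enorm (x - x1) < r].
Proof.
rewrite (_ : [set _ | _] = (fun x : 'rV[R]_n => enorm (x - x1)) @^-1` [set y | y < r])//.
by apply: open_comp => [x _|]; [exact: continuous_enorm_dist|exact: open_lt].
Qed.

Variables (f g : 'rV[R]_n -> 'rV[R]_n) (x0 : 'rV[R]_n).
Hypotheses (cf : continuous f) (fK : forall x, g (f x) = x)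
  (cg : {within range f, continuous g}).

Local Notation image_ball r := (f @` [set x | enorm (x - x0) < r]).

Lemma open_image_ball r : open (image_ball r).
Proof. by apply: (invariance_of_domain cf fK cg); exact: open_eball. Qed.

Lemma image_ball_center r : 0 < r -> image_ball r (f x0).
Proof. by move=> r0; exists x0 => //=; rewrite subrr -(scale0r 0) enormZ normr0 mul0r. Qed.

Lemma image_ball_neighborhood r : 0 < r ->
  exists2 e, 0 < e & forall t s, enorm t = 1 -> 0 <= s < e -> image_ball r (ray (f x0) t s).
Proof.
move=> r0; have : nbhs (f x0) (image_ball r).
  by apply: open_nbhs_nbhs; split; [exact: open_image_ball|exact: image_ball_center].
move=> /nbhs_normP[e /= e0 be].
exists e => // t s t1 /andP[s0 se].
apply: be; rewrite /ball_ /= /ray opprD addNKr normrN.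
by apply: le_lt_trans (norm_le_enorm _) _; rewrite enormZ t1 mulr1 ger0_norm.
Qed.

Lemma exit_time t r L : enorm t = 1 -> 0 < r ->
  (forall x, enorm (x - x0) <= r -> enorm (f x - f x0) <= L) ->
  exists s, [/\ 0 < s <= L, (f @` sphere x0 r) (ray (f x0) t s) &
    forall u, 0 <= u < s -> image_ball r (ray (f x0) t u)].
Proof.
move=> t1 r0 fL.
have raynorm s : 0 <= s -> enorm (ray (f x0) t s - f x0) = s.
  by move=> s0; rewrite /ray addrAC subrr add0r enormZ t1 mulr1 ger0_norm.
have L0 : 0 <= L.
  by apply: le_trans (fL x0 _); rewrite ?enorm_ge0// subrr -(scale0r 0) enormZ normr0 mul0r ltW.
pose A := [set s | 0 <= s /\ ~ image_ball r (ray (f x0) t s)].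
have AL : A (L + 1).
  split; first by rewrite addr_ge0.
  move=> [x /= /ltW /fL + fx]; rewrite fx raynorm ?addr_ge0//.
  by rewrite leNgt ltrDl ltr01.
have hA : has_inf A by split; [exists (L + 1)|exists 0 => s []].
(* [s] is the first time at which the ray is outside the image of the open ball. It exists because
   at distance [L + 1] from [f x0] the ray has left the image, and it is not yet inside at [s]
   because the image is open. *)
pose s := inf A.
have s0 : 0 <= s by apply: lb_le_inf => [|? []//]; exists (L + 1).
have before u : 0 <= u < s -> image_ball r (ray (f x0) t u).
  move=> /andP[u0 us]; apply: contrapT => nu.
  by have := ge_inf hA.2 (conj u0 nu : A u); rewrite leNgt us.
have ns : ~ image_ball r (ray (f x0) t s).
  move=> bs; have : nbhs s (ray (f x0) t @^-1` image_ball r).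
    apply: open_nbhs_nbhs; split => //.
    by apply: open_comp => [u _|]; [exact: continuous_ray|exact: open_image_ball].
  move=> /nbhs_normP[e /= e0 be].
  have [u Au us] := inf_adherent e0 hA.
  have su := ge_inf hA.2 Au.
  case: Au => _; apply; apply: be => /=; rewrite ltr_distlC.
  by rewrite (lt_le_trans _ su) ?us// ltrBlDr ltrDl.
have sp : 0 < s.
  rewrite lt_neqAle s0 andbT; apply/eqP => s00; apply: ns; rewrite -s00 /ray scale0r addr0.
  exact: image_ball_center.
(* As a limit of earlier points of the ray, the point at time [s] lies in the image of the closed
   ball, which is compact. *)
have [x xr fx] : (f @` [set x | enorm (x - x0) <= r]) (ray (f x0) t s).
  set C := f @` _.
  have clC : closed C.
    apply: compact_closed; first exact: norm_hausdorff.
    by apply: continuous_compact; [exact: continuous_subspaceT|exact: compact_eball].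
  apply: contrapT => nC.
  have : nbhs s (ray (f x0) t @^-1` (~` C)).
    apply: open_nbhs_nbhs; split => //; apply: open_comp; last by rewrite openC.
    by move=> u _; exact: continuous_ray.
  move=> /nbhs_normP[e /= e0 be].
  pose u := Num.max 0 (s - e / 2).
  have us : 0 <= u < s.
    by rewrite /u le_max lexx /= gt_max sp ltrBlDr ltrDl divr_gt0.
  have [z zr fz] := before u us.
  apply: (be u); last by exists z => //=; exact: ltW.
  case/andP: us => u0 us.
  rewrite /= gtr0_norm ?subr_gt0// /u ltrBlDr -ltrBlDl lt_max; apply/orP; right.
  by rewrite ltrD2l ltrN2 ltr_pdivrMr// ltr_pMr// ltr1n.
exists s; split => //.
  by rewrite sp -(raynorm s)// -fx; exact: fL.
exists x => //; apply/eqP; rewrite eq_le xr leNgt /=.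
by apply/negP => xr'; apply: ns; exists x.
Qed.

Local Open Scope ereal_scope.
Local Notation lambda := (@lebesgue_measure R).

(** The curve is the part of the ray between its exit times for [r1] and [r2]. The bound [e] is
    chosen before [rho] and [t]: a ball around [f x0] inside the image of [B(x0, r1)] gives the same
    [e] for all directions. *)
Lemma admissible_ray (r1 r2 L : R) : (0 < r1 < r2)%R ->
  (forall x, enorm (x - x0) <= r2 -> enorm (f x - f x0) <= L)%R ->
  exists2 e : R, (0 < e)%R &
  forall (rho : 'rV[R]_n -> \bar R) t, enorm t = 1%R ->
  admissible (joining (f @` sphere x0 r1) (f @` sphere x0 r2) (f @` setT)) rho ->
  1 <= \int[lambda]_(s in `[e, L]) rho (ray (f x0) t s).
Proof.
move=> /andP[r10 r12] fL; have r20 := lt_trans r10 r12.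
have finj : injective f by exact: can_inj fK.
have [e e0 be] := image_ball_neighborhood r10.
exists e => // rho t t1 [mrho rho0 arho].
have [s1 [/andP[s10 s1L] [x1 x1r fx1] before1]] :
    exists s, [/\ (0 < s <= L)%R, (f @` sphere x0 r1) (ray (f x0) t s) &
      forall u, (0 <= u < s)%R -> image_ball r1 (ray (f x0) t u)].
  by apply: exit_time => // x /le_trans xr; apply/fL/xr/ltW.
have [s2 [/andP[s20 s2L] [x2 x2r fx2] before2]] := exit_time t1 r20 fL.
have es1 : (e <= s1)%R.
  rewrite leNgt; apply/negP => s1e.
  have [|x /= xr fx] := be t s1 t1; first by rewrite ltW.
  by move: xr; rewrite (finj x x1) ?fx//; rewrite x1r ltxx.
have s12 : (s1 < s2)%R.
  rewrite ltNge; apply/negP; rewrite le_eqVlt => /predU1P[s21|s21].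
    have : x2 = x1 by apply: finj; rewrite fx1 fx2 s21.
    by move=> x21; move: x1r x2r r12; rewrite /sphere /= x21 => -> ->; rewrite ltxx.
  have [|x /= xr fx] := before1 s2; first by rewrite ltW.
  by move: xr; rewrite (finj x x2) ?fx// x2r ltNge (ltW r12).
(* The ordering of [e], [s1] and [s2] came from injectivity: a point of the image of a sphere is not
   in the image of a smaller or equal open ball. *)
have cray : {within `[s1, s2], continuous (ray (f x0) t)}.
  by apply: continuous_subspaceT; exact: continuous_ray.
pose gam := Curve s12 cray.
have mray : measurable_fun setT (rho \o ray (f x0) t).
  exact: (measurableT_comp (measurable_fun_borel_box mrho) (measurable_line _ _)).
have : 1 <= curve_integral gam rho.
  apply: arho; first split.
  - by exists x1.
  - by exists x2.
  - move=> u /= /andP[s1u us2]; have [|x _ <-] := before2 u; last by exists x.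
    by rewrite us2 andbT ltW// (lt_trans s10).
  by rewrite /rectifiable /= arc_length_ray ?ltW// ltry.
rewrite (@curve_integral_ray _ _ (f x0) t t1)//= => /le_trans; apply.
apply: ge0_subset_integral => //.
- exact: measurable_funTS.
- by move=> u; rewrite /= !in_itv /= => /andP[s1u us2]; rewrite (le_trans es1)// (le_trans us2).
Qed.

End exit_times.

(** * The extremal density on a ray *)

Section radial_extremal.
Context {R : realType}.
Local Open Scope ereal_scope.
Local Notation lambda := (@lebesgue_measure R).

Lemma continuous_powR_itv (a b q : R) : (0 < a)%R ->
  {within `[a, b], continuous (fun x : R => x `^ q)%R}.
Proof.
move=> a0; apply: continuous_in_subspaceT => x /set_mem; rewrite /= in_itv /= => /andP[ax _].
have x0 : (0 < x)%R by exact: lt_le_trans ax.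
by apply/differentiable_continuous/derivable1_diffP; have [] := is_derive1_powR q x0.
Qed.

Lemma integral_powR (a b q : R) : (0 < a)%R -> (a <= b)%R -> q != 0%R ->
  \int[lambda]_(x in `]a, b]) (x `^ (q - 1))%:E = ((b `^ q - a `^ q) / q)%:E.
Proof.
move=> a0 ab q0.
have dF x : (a <= x <= b)%R -> is_derive x 1%R (fun x => q^-1 * x `^ q)%R (x `^ (q - 1))%R.
  move=> /andP[ax _]; have x0 : (0 < x)%R by exact: lt_le_trans ax.
  apply: is_derive_eq; first exact: (is_deriveZ q^-1%R (is_derive1_powR q x0)).
  by rewrite /GRing.scale/= mulKf.
rewrite (integral_derive_oc ab dF); last exact: continuous_powR_itv.
by congr (_%:E); ring.
Qed.

Lemma integral_powRN1 (a b : R) : (0 < a)%R -> (a <= b)%R ->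
  \int[lambda]_(x in `]a, b]) (x `^ (- 1))%:E = (ln (b / a))%:E.
Proof.
move=> a0 ab; have b0 := lt_le_trans a0 ab.
have dF x : (a <= x <= b)%R -> is_derive x 1%R (@ln R) (x `^ (- 1))%R.
  move=> /andP[ax _]; have x0 : (0 < x)%R by exact: lt_le_trans ax.
  by rewrite powR_inv1 ?ltW//; exact: is_derive1_ln.
rewrite (integral_derive_oc ab dF); last exact: continuous_powR_itv.
by rewrite ln_div// posrE.
Qed.

(* Equality holds for [a = C s^(-m / (p - 1))], the extremal density of the radial
   problem. *)
Lemma radial_young (m : nat) (p C s a : R) :
  (1 < p)%R -> (0 < C)%R -> (0 < s)%R -> (0 <= a)%R ->
  (p * C `^ (p - 1) * a <= s ^+ m * a `^ p +
    (p - 1) * C `^ (p - 1) * (C * s `^ (- (m%:R / (p - 1)))))%R.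
Proof.
move=> p1 C0 s0 a0; have p0 : (0 < p)%R by lra.
have pN1 : (0 < p - 1)%R by lra.
have q0 : (0 < p / (p - 1))%R by rewrite divr_gt0.
have pq : (p^-1 + (p / (p - 1))^-1 = 1)%R by field; rewrite !gt_eqF.
(* The two factors for Young's inequality: their product is [C^(p-1) a], and their powers [p] and
   [p / (p-1)] give [s^m a^p] and a multiple of the extremal density. *)
have A0 : (0 <= s `^ (m%:R / p) * a)%R by rewrite mulr_ge0// powR_ge0.
have B0 : (0 <= C `^ (p - 1) * s `^ (- (m%:R / p)))%R by rewrite mulr_ge0 ?powR_ge0.
have := conjugate_powR A0 B0 p0 q0 pq.
have -> : (s `^ (m%:R / p) * a * (C `^ (p - 1) * s `^ (- (m%:R / p))) = C `^ (p - 1) * a)%R.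
  by rewrite powRN; field; rewrite gt_eqF// powR_gt0.
have -> : ((s `^ (m%:R / p) * a) `^ p = s ^+ m * a `^ p)%R.
  by rewrite powRM ?powR_ge0// -powRrM divfK ?gt_eqF// powR_mulrn// ltW.
have -> : ((C `^ (p - 1) * s `^ (- (m%:R / p))) `^ (p / (p - 1)) =
    C `^ (p - 1) * (C * s `^ (- (m%:R / (p - 1)))))%R.
  rewrite powRM ?powR_ge0// -!powRrM [RHS]mulrA; congr (_ * _)%R.
    rewrite [RHS]mulrC mulr_powRB1 ?(ltW C0)//; congr (_ `^ _)%R.
    by field; rewrite gt_eqF.
  by congr (_ `^ _)%R; field; rewrite !gt_eqF.
move/(ler_wpM2l (ltW p0)) => H; rewrite -mulrA (le_trans H)// le_eqVlt; apply/orP; left.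
by apply/eqP; field; rewrite !gt_eqF.
Qed.

(** Integrating [radial_young] gives [p c <= I + (p - 1) c] as soon as [h] has integral at least [1]
    and the extremal density [tau] at most [1]; hence [I >= c = C^(p-1)]. *)
Lemma weighted_ray_bound (m : nat) (p L e : R) (h : R -> \bar R) :
  (m.+1%:R < p)%R -> (0 < e)%R -> measurable_fun setT h -> (forall s, 0 <= h s) ->
  1 <= \int[lambda]_(s in `[e, L]) h s ->
  (((p - m.+1%:R) / (p - 1)) `^ (p - 1) * L `^ (m.+1%:R - p))%:E <=
  \int[lambda]_(s in `]0%R, +oo[) ((s ^+ m)%:E * h s `^ p).
Proof.
move=> np e0 mh h0 ih.
have p1 : (1 < p)%R by apply: le_lt_trans np; rewrite ler1n.
have pN1 : (0 < p - 1)%R by lra.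
set gam := ((p - m.+1%:R) / (p - 1))%R.
have gam0 : (0 < gam)%R by rewrite divr_gt0// subr_gt0.
have eL : (e <= L)%R.
  rewrite leNgt; apply/negP => Le; move: ih; rewrite set_itv_ge ?bnd_simp -?ltNge//.
  by rewrite integral_set0 lee_fin ler10.
have L0 := lt_le_trans e0 eL.
(* This constant gives [tau] the integral [1] over []0, L]]; over [[e, L]] the integral is
   [1 - (e / L)^gam]. *)
pose C := (gam * L `^ (- gam))%R.
have C0 : (0 < C)%R by rewrite mulr_gt0// powR_gt0.
have -> : (gam `^ (p - 1) * L `^ (m.+1%:R - p) = C `^ (p - 1))%R.
  rewrite [RHS]powRM ?powR_ge0 ?(ltW gam0)// -powRrM; congr (_ * _ `^ _)%R.
  by rewrite /gam; field; rewrite gt_eqF.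
set c := (C `^ (p - 1))%R; have c0 : (0 < c)%R by exact: powR_gt0.
pose tau s := (C * s `^ (- (m%:R / (p - 1))))%R.
have tau0 s : (0 <= tau s)%R by rewrite mulr_ge0 ?powR_ge0// ltW.
have mtau : measurable_fun setT tau.
  by apply: measurable_funM => //; exact: measurable_powR.
have itau : \int[lambda]_(s in `[e, L]) (tau s)%:E <= 1.
  rewrite -integral_itv_obnd_cbnd; last by apply/measurable_EFinP; exact: measurable_funTS.
  under eq_integral do rewrite EFinM.
  rewrite ge0_integralZl//; last 3 first.
  - by apply/measurable_EFinP; apply: measurable_funTS; exact: measurable_powR.
  - by move=> s _; rewrite lee_fin powR_ge0.
  - by rewrite lee_fin ltW.
  have -> : (- (m%:R / (p - 1)) = gam - 1)%R.
    by rewrite /gam -natr1; field; rewrite gt_eqF.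
  rewrite integral_powR ?gt_eqF// -EFinM lee_fin /C mulrACA.
  rewrite [X in (X <= 1)%R](_ : _ = 1 - L `^ (- gam) * e `^ gam)%R.
    by rewrite gerBl mulr_ge0 ?powR_ge0.
  rewrite powRN; field; rewrite !gt_eqF// powR_gt0//.
pose I := \int[lambda]_(s in `[e, L]) ((s ^+ m)%:E * h s `^ p).
have mI : measurable_fun setT (fun s : R => (s ^+ m)%:E * h s `^ p).
  apply: emeasurable_funM; first by apply/measurable_EFinP; exact: measurable_funX.
  exact: (measurableT_comp (measurable_poweR _)).
have I0 s : `[e, L]%classic s -> 0 <= (s ^+ m)%:E * h s `^ p.
  rewrite /= in_itv /= => /andP[es _]; rewrite mule_ge0 ?poweR_ge0//.
  by rewrite lee_fin exprn_ge0// ltW// (lt_le_trans e0).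
apply: (@le_trans _ _ I); last first.
  apply: ge0_subset_integral => //.
  - exact: measurable_funTS.
  - move=> s; rewrite /= in_itv /= andbT => s0.
    by rewrite mule_ge0 ?poweR_ge0// lee_fin exprn_ge0// ltW.
  - move=> s; rewrite /= !in_itv /= andbT => /andP[es _]; exact: lt_le_trans es.
have : (p * c)%:E <= I + ((p - 1) * c)%:E.
  have ptau : \int[lambda]_(s in `[e, L]) ((p - 1) * c * tau s)%:E <= ((p - 1) * c)%:E.
    under eq_integral do rewrite EFinM.
    rewrite ge0_integralZl//; last 3 first.
    - by apply/measurable_EFinP; exact: measurable_funTS.
    - by move=> s _; rewrite lee_fin.
    - by rewrite lee_fin mulr_ge0// ltW.
    by rewrite -[leRHS]mule1 lee_wpmul2l// lee_fin mulr_ge0// ltW.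
  apply: (le_trans _ (leeD2l _ ptau)).
  apply: (@le_trans _ _ (\int[lambda]_(s in `[e, L]) ((p * c)%:E * h s))).
    rewrite ge0_integralZl//; last 2 first.
    - exact: measurable_funTS.
    - by rewrite lee_fin mulr_ge0 ?(ltW c0)//; lra.
    by rewrite lee_pemulr// lee_fin mulr_ge0 ?(ltW c0)//; lra.
  rewrite /I -ge0_integralD//; last 3 first.
  - exact: measurable_funTS.
  - by move=> s _; rewrite lee_fin mulr_ge0// mulr_ge0 ?(ltW c0) ?(ltW pN1).
  - by apply/measurable_EFinP/measurable_funM => //; exact: measurable_funTS.
  apply: ge0_le_integralW => s; rewrite /= in_itv /= => /andP[es _].
    by rewrite mule_ge0// lee_fin mulr_ge0 ?(ltW c0)//; lra.
  have s0 := lt_le_trans e0 es.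
  have := h0 s; case: (h s) => [a|_|//]; rewrite ?lee_fin.
    by move=> a0; exact: radial_young.
  rewrite poweRyr ?gt_eqF//; last by lra.
  by rewrite [X in _ <= X + _]gt0_muley ?addye ?leey// lte_fin exprn_gt0.
have : 0 <= I by exact: integral_ge0.
case: I => [i||] // _; last by move=> _; exact: leey.
by rewrite -EFinD !lee_fin; lra.
Qed.

End radial_extremal.

Section modulus_lower_bound.
Context {R : realType} {m : nat}.
Local Notation n := m.+1.
Variables (f g : 'rV[R]_n -> 'rV[R]_n) (x0 : 'rV[R]_n).
Hypotheses (cf : continuous f) (fK : forall x, g (f x) = x)
  (cg : {within range f, continuous g}).
Local Open Scope ereal_scope.

Theorem modulus_lower_bound (p r1 r2 L : R) : (n%:R < p)%R -> (0 < r1 < r2)%R ->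
  (forall x, enorm (x - x0) <= r2 -> enorm (f x - f x0) <= L)%R ->
  (((p - n%:R) / (p - 1)) `^ (p - 1) * L `^ (n%:R - p))%:E * @unit_sphere_area R n <=
  modulus p (joining (f @` sphere x0 r1) (f @` sphere x0 r2) (f @` setT)).
Proof.
move=> np r12 fL; have [e e0 he] := admissible_ray cf fK cg r12 fL.
apply: le_ereal_inf_tmp => _ [rho arho <-]; have [mrho rho0 _] := arho.
have mrhop : measurable_fun setT (fun x : boxRn R n => rho x `^ p).
  exact: (measurableT_comp (measurable_poweR p) (measurable_fun_borel_box mrho)).
rewrite ge0_integral_lebesgue_Rn//; last by move=> x; exact: poweR_ge0.
apply: (radial_lower_bound (x0 := f x0)) => //.
- by move=> x; exact: poweR_ge0.
- by rewrite mulr_ge0// powR_ge0.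
move=> t t1.
apply: (@weighted_ray_bound _ m p L e (fun s => rho (ray (f x0) t s))) => //.
- exact: (measurableT_comp (measurable_fun_borel_box mrho) (measurable_line _ _)).
- exact: he.
Qed.

End modulus_lower_bound.

Section modulus_upper_bound.
Context {R : realType} {m : nat}.
Local Notation n := m.+1.
Local Open Scope ereal_scope.
Local Notation lambda := (@lebesgue_measure R).

Lemma measurable_fun_completed (D : set (measurableTypeR R)) (h : R -> \bar R) :
  measurable D -> measurable_fun D (h : measurableTypeR R -> \bar R) ->
  measurable_fun (D : set (lebR R)) h.
Proof. by move=> mD mh _ Y mY; apply: sub_caratheodory; exact: mh. Qed.

Lemma ge0_integral_completed_lebesgue (D : set (measurableTypeR R)) (h : R -> \bar R) :
  measurable D -> measurable_fun D (h : measurableTypeR R -> \bar R) ->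
  (forall x, D x -> 0 <= h x) ->
  \int[@completed_lebesgue_measure R]_(x in D) h x = \int[lambda]_(x in D) h x.
Proof.
move=> mD mh h0.
pose j : lebR R -> measurableTypeR R := idfun.
have mj : measurable_fun setT j.
  by move=> _ A mA; rewrite setTI; exact: sub_caratheodory.
rewrite [LHS]integral_mkcond [RHS]integral_mkcond.
have mhD : measurable_fun [set: measurableTypeR R] (h \_ D).
  exact/(measurable_restrictT _ _).1.
transitivity (\int[pushforward (@completed_lebesgue_measure R) j]_x (h \_ D) x).
  rewrite ge0_integral_pushforward// => x.
  by rewrite patchE; case: ifPn => // /set_mem /h0.
exact: eq_measure_integral.
Qed.

Lemma dist_to_frontier_setT (x0 : 'rV[R]_n) : dist_to_set x0 (frontier setT) = +oo.
Proof. by rewrite /dist_to_set /frontier closureT interiorT setDv image_set0 ereal_inf0. Qed.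

(** The exponent [beta = (m + alpha) / (p - 1)] satisfies [m + alpha - beta p = - beta]. So [eta^p]
    times the bound on the spherical integral of [Q] is again a multiple of [r^(-beta)], whose
    integral is [J]. *)
Theorem modulus_upper_bound (p : R) (x0 : 'rV[R]_n) (Q : 'rV[R]_n -> \bar R)
    (f : 'rV[R]_n -> 'rV[R]_n) (alpha r0 r1 K J : R) :
  (1 < p)%R -> (forall x, 0 <= Q x) -> ring_homeomorphism p setT x0 Q f ->
  (0 < r0 < r1)%R -> (0 < K)%R -> (0 < J)%R ->
  {ae lambda, forall t : R, (r0 <= t)%R -> spherical_mean Q x0 t <= (K * t `^ alpha)%:E} ->
  \int[lambda]_(x in `]r0, r1]) (x `^ (- ((m%:R + alpha) / (p - 1))))%:E = J%:E ->
  modulus p (joining (f @` sphere x0 r0) (f @` sphere x0 r1) (f @` setT)) <=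
  (K * J `^ (1 - p))%:E * @unit_sphere_area R n.
Proof.
move=> p1 Q0 [_ _ _ hf] /andP[r00 r01] K0 J0 hq iJ.
set beta := ((m%:R + alpha) / (p - 1))%R in iJ *.
have pN1 : (0 < p - 1)%R by rewrite subr_gt0.
have [w w0 wE] : exists2 w : R, (0 < w)%R & @unit_sphere_area R n = w%:E.
  have := @unit_sphere_area_gt0 R m; have := @unit_sphere_area_lty R m.
  by case: unit_sphere_area => // w _ w0; exists w.
pose eta r : R := (J^-1 * r `^ (- beta))%R.
have eta0 r : (0 < r)%R -> (0 < eta r)%R.
  by move=> rp; rewrite mulr_gt0 ?invr_gt0 ?powR_gt0.
have meta : measurable_fun setT eta by apply: measurable_funM => //; exact: measurable_powR.
have iJo : \int[lambda]_(x in `]r0, r1[) (x `^ (- beta))%:E = J%:E.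
  rewrite -iJ integral_itv_bndo_bndc//; apply/measurable_EFinP.
  by apply: measurable_funTS; exact: measurable_powR.
have pos r : `]r0, r1[%classic r -> (0 < r)%R.
  by rewrite /= in_itv /= => /andP[+ _]; exact: lt_trans.
apply: le_trans.
  apply: (hf r0 r1 r00 r01 _ (fun r => (eta r)%:E)).
  - by rewrite dist_to_frontier_setT ltry.
  - apply: measurable_fun_completed => //; apply/measurable_EFinP.
    exact: measurable_funTS.
  - by move=> r rr; rewrite lee_fin ltW// eta0// pos//= in_itv.
  rewrite ge0_integral_completed_lebesgue//; last 2 first.
  - by apply/measurable_EFinP; exact: measurable_funTS.
  - by move=> r rr; rewrite lee_fin ltW// eta0// pos.
  under eq_integral do rewrite EFinM.
  rewrite ge0_integralZl//; last 3 first.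
  - by apply/measurable_EFinP; apply: measurable_funTS; exact: measurable_powR.
  - by move=> r _; rewrite lee_fin powR_ge0.
  - by rewrite lee_fin invr_ge0 ltW.
  by rewrite iJo -EFinM mulVf// gt_eqF.
under eq_integral do rewrite poweR_EFin.
apply: le_trans.
  apply: (@polar_upper_bound _ m x0 r0 r1 Q (fun r => eta r `^ p)%R
    (fun r => K * r `^ alpha * (w * r ^+ m))%R) => //.
  - by move=> r rr; apply: powR_gt0; apply: eta0; apply: pos; rewrite /= in_itv.
  - move=> r rr; rewrite !mulr_ge0 ?powR_ge0 ?(ltW w0) ?(ltW K0)// exprn_ge0//.
    by apply/ltW/pos; rewrite /= in_itv.
  - by apply: measurable_funTS; exact: (measurableT_comp (measurable_powR p) meta).
  - apply: measurable_funTS; apply: measurable_funM.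
      by apply: measurable_funM => //; exact: measurable_powR.
    by apply: measurable_funM => //; exact: measurable_funX.
  case: hq => N [mN N0 hq]; exists N; split => // r /= nr; apply: hq => /= hr; apply: nr => rr.
  have rp : (0 < r)%R by apply: pos; rewrite /= in_itv.
  have wr : (0 < w * r ^+ m)%R by rewrite mulr_gt0// exprn_gt0.
  have := hr _; rewrite /spherical_mean wE -EFinM inver (gt_eqF wr) lee_pdivrMr//.
  by rewrite -EFinM; apply; case/andP: rr => /ltW.
rewrite wE -EFinM.
have -> : (K * J `^ (1 - p) * w = K * w * J `^ (- p) * J)%R.
  rewrite addrC powRD; last by rewrite (gt_eqF J0) implybT.
  by rewrite powRr1 ?(ltW J0)//; ring.
rewrite [leRHS]EFinM -iJo -ge0_integralZl//; last 3 first.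
- by apply/measurable_EFinP; apply: measurable_funTS; exact: measurable_powR.
- by move=> r _; rewrite lee_fin powR_ge0.
- by rewrite lee_fin !mulr_ge0 ?powR_ge0// ltW.
rewrite le_eqVlt; apply/orP; left; apply/eqP; apply: eq_integral => r /set_mem /pos rp.
rewrite -EFinM; congr (_%:E).
rewrite /eta powRM ?powR_ge0 ?invr_ge0 ?(ltW J0)//.
have -> : (J^-1 `^ p = J `^ (- p))%R.
  by rewrite -powR_inv1 ?(ltW J0)// -powRrM mulN1r.
rewrite -powRrM.
have -> : (r `^ (- beta) = r `^ (- beta * p) * (r `^ alpha * r ^+ m))%R.
  rewrite -powR_mulrn ?(ltW rp)// -!powRD ?(gt_eqF rp) ?implybT//.
  by congr (_ `^ _)%R; rewrite /beta; field; rewrite gt_eqF.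
by ring.
Qed.

End modulus_upper_bound.

(** * Comparison of the two bounds, and limits *)

Section distortion.
Context {R : realType} {m : nat}.
Local Notation n := m.+1.
Local Open Scope ereal_scope.
Local Notation lambda := (@lebesgue_measure R).

Theorem max_distortion_lower_bound (p : R) (x0 : 'rV[R]_n) (Q : 'rV[R]_n -> \bar R)
    (f : 'rV[R]_n -> 'rV[R]_n) (alpha r0 r1 K J : R) :
  (n%:R < p)%R -> (forall x, 0 <= Q x) -> ring_homeomorphism p setT x0 Q f ->
  (0 < r0 < r1)%R -> (0 < K)%R -> (0 < J)%R ->
  {ae lambda, forall t : R, (r0 <= t)%R -> spherical_mean Q x0 t <= (K * t `^ alpha)%:E} ->
  \int[lambda]_(x in `]r0, r1]) (x `^ (- ((m%:R + alpha) / (p - 1))))%:E = J%:E ->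
  (K `^ (1 / (n%:R - p)) * ((p - n%:R) / (p - 1) * J) `^ ((p - 1) / (p - n%:R)))%:E
    <= max_distortion x0 f r1.
Proof.
move=> np Q0 hf r01 K0 J0 hq iJ.
have p1 : (1 < p)%R by apply: le_lt_trans np; rewrite ler1n.
have pN1 : (0 < p - 1)%R by rewrite subr_gt0.
have d0 : (0 < p - n%:R)%R by rewrite subr_gt0.
have up := modulus_upper_bound p1 Q0 hf r01 K0 J0 hq iJ.
have [_ _ [/(continuous_subspace_setT f).2 cf [g [gK cg]]] _] := hf.
have fK x : g (f x) = x by exact: gK.
set gam := ((p - n%:R) / (p - 1))%R.
have gam0 : (0 < gam)%R by rewrite divr_gt0.
have bound L : (0 < L)%R ->
    (forall x, enorm (x - x0) <= r1 -> enorm (f x - f x0) <= L)%R ->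
    (K `^ (1 / (n%:R - p)) * (gam * J) `^ ((p - 1) / (p - n%:R)) <= L)%R.
  move=> L0 fL.
  have := le_trans (modulus_lower_bound cf fK cg np r01 fL) up.
  have w0 := @unit_sphere_area_gt0 R m; have woo := @unit_sphere_area_lty R m.
  (* The area of the unit sphere cancels, being positive and finite. *)
  rewrite lee_pmul2r//; last by rewrite ge0_fin_numE// ltW.
  rewrite lee_fin -/gam => H.
  have {}H : (K^-1 * (gam * J) `^ (p - 1) <= L `^ (p - n%:R))%R.
    rewrite ler_pdivrMl// powRM ?(ltW gam0) ?(ltW J0)//.
    have LE : (L `^ (n%:R - p) = (L `^ (p - n%:R))^-1)%R by rewrite -powRN opprB.
    have JE : (J `^ (1 - p) = (J `^ (p - 1))^-1)%R by rewrite -powRN opprB.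
    move: H; rewrite LE JE ler_pdivrMr ?powR_gt0// mulrAC ler_pdivlMr ?powR_gt0//.
  have dd : (0 <= (p - n%:R)^-1)%R by rewrite invr_ge0 ltW.
  have := ge0_ler_powR dd _ _ H.
  rewrite -powRrM divff ?gt_eqF// powRr1 ?(ltW L0)//.
  rewrite [((K^-1 * _) `^ _)%R]powRM ?powR_ge0 ?invr_ge0 ?(ltW K0)//.
  rewrite -powRrM -powR_inv1 ?(ltW K0)// -powRrM.
  have -> : (- 1 * (p - n%:R)^-1 = 1 / (n%:R - p))%R.
    by rewrite mulN1r mul1r -[in RHS]opprB invrN.
  by apply; rewrite nnegrE ?powR_ge0// mulr_ge0 ?powR_ge0// invr_ge0 ltW.
set b := (_ * _)%R in bound *.
have M0 : 0 <= max_distortion x0 f r1.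
  apply: ereal_sup_ge; exists 0%R => //.
  exists x0 => /=; rewrite subrr -(scale0r 0) enormZ normr0 mul0r//.
  by case/andP: r01 => /lt_trans + /[dup] => /[apply] /ltW.
have fM x : (enorm (x - x0) <= r1)%R -> (enorm (f x - f x0))%:E <= max_distortion x0 f r1.
  by move=> xr; apply: ereal_sup_ubound; exists x.
case: (max_distortion x0 f r1) M0 fM => [M| |]//; last by move=> _ _; exact: leey.
(* [bound] asks for a positive [L], and the supremum [M] is only known to be nonnegative; it is
   applied to [M + e]. *)
rewrite !lee_fin => M0 fM; apply/ler_addgt0Pr => e e0; apply: bound.
  exact: ltr_wpDl.
by move=> x /fM; rewrite lee_fin => /le_trans; apply; rewrite lerDl ltW.
Qed.

Lemma limf_einf_ge_cvg (F : R -> \bar R) (u : R -> R) (c : R) :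
  u x @[x --> +oo%R] --> c -> (\forall r \near +oo%R, (u r)%:E <= F r) ->
  c%:E <= limf_einf F (pinfty_nbhs R).
Proof.
move=> uc uF; rewrite limf_einfE; apply/lee_subgt0Pr => e e0.
pose A := [set r | (c - e)%:E <= F r].
have FA : pinfty_nbhs R A.
  have : \forall r \near +oo%R, (c - e < u r)%R.
    by apply: (cvgr_gt c uc); rewrite ltrBlDr ltrDl.
  apply: filterS2 uF => r ur cu; rewrite /A /=.
  by apply: le_trans ur; rewrite lee_fin ltW.
apply: (@le_trans _ _ (ereal_inf (F @` A))).
  by apply: le_ereal_inf_tmp => _ [r Ar <-]; rewrite -EFinB.
by apply: ereal_sup_ubound; exists A.
Qed.

Lemma cvg_one_sub_powR (v : R -> R) (k : R) :
  v x @[x --> +oo%R] --> (0 : R)%R -> ((1 - v x) `^ k)%R @[x --> +oo%R] --> (1 : R)%R.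
Proof.
move=> v0; have c1 : {for 1%R, continuous (fun x : R => x `^ k)%R}.
  by apply/differentiable_continuous/derivable1_diffP; have [] := is_derive1_powR k (@ltr01 R).
have v1 : (1 - v x)%R @[x --> +oo%R] --> (1 : R)%R.
  by rewrite -[X in _ --> X]subr0; apply: cvgB => //; exact: cvg_cst.
by have := cvg_comp _ _ v1 c1; rewrite powR1.
Qed.

Lemma cvg_ratio_powR (a q : R) : (0 < a)%R -> (0 < q)%R ->
  ((a / x) `^ q)%R @[x --> +oo%R] --> (0 : R)%R.
Proof.
move=> a0 q0; apply/cvgrPdist_lt => e e0.
have ae0 : (0 < a / e `^ q^-1)%R by rewrite divr_gt0// powR_gt0.
near=> x.
have x0 : (0 < x)%R by near: x; apply: nbhs_pinfty_gt; exact: num_real.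
have ax : (a / e `^ q^-1 < x)%R by near: x; apply: nbhs_pinfty_gt; exact: num_real.
rewrite sub0r normrN ger0_norm ?powR_ge0//.
rewrite [ltRHS](_ : e = ((e `^ q^-1) `^ q)%R); last first.
  by rewrite -powRrM mulVf ?gt_eqF// powRr1// ltW.
rewrite gt0_ltr_powR// ?nnegrE ?powR_ge0 ?divr_ge0 ?ltW//.
by rewrite ltr_pdivrMr// mulrC -ltr_pdivrMr ?powR_gt0.
Unshelve. all: by end_near. Qed.

Lemma cvg_ratio_ln (a : R) : (a / ln x)%R @[x --> +oo%R] --> (0 : R)%R.
Proof.
apply/cvgrPdist_lt => e e0.
near=> x.
have ax : (expR (`|a| / e) < x)%R by near: x; apply: nbhs_pinfty_gt; exact: num_real.
have x0 : (0 < x)%R by exact: lt_trans (expR_gt0 _) ax.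
have lx : (`|a| / e < ln x)%R by rewrite -[ltLHS]expRK ltr_ln ?posrE ?expR_gt0.
have l0 : (0 < ln x)%R by apply: le_lt_trans lx; rewrite divr_ge0// ltW.
rewrite sub0r normrN normrM normfV (gtr0_norm l0) ltr_pdivrMr//.
by rewrite mulrC -ltr_pdivrMr.
Unshelve. all: by end_near. Qed.

End distortion.

Theorem theorem2p1 (R : realType) (n : nat) (hn : (2 <= n)%N)
    (p : R) (hp : n%:R < p) (x0 : 'rV[R]_n)
    (Q : 'rV[R]_n -> \bar R) (hQ : measurable_fun [set: lebRn R n] Q)
    (hQ0 : forall x, (0 <= Q x)%E)
    (f : 'rV[R]_n -> 'rV[R]_n) (hf : ring_homeomorphism p setT x0 Q f)
    (alpha r0 K : R) (hr0 : 0 < r0) (hK : 0 < K)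
    (hq : {ae (@lebesgue_measure R), forall t : R, r0 <= t ->
            (spherical_mean Q x0 t <= (K * t `^ alpha)%:E)%E}) :
  (0 <= alpha < p - n%:R ->
    let c := K `^ (1 / (n%:R - p)) *
             ((p - n%:R) / (p - n%:R - alpha)) `^ ((p - 1) / (p - n%:R)) in
    0 < c /\
    (c%:E <= limf_einf
       (fun r : R => max_distortion x0 f r /
          (r `^ ((p - n%:R - alpha) / (p - n%:R)))%:E) (pinfty_nbhs R))%E) /\
  (alpha = p - n%:R ->
    let c := K `^ (1 / (n%:R - p)) *
             ((p - n%:R) / (p - 1)) `^ ((p - 1) / (p - n%:R)) in
    0 < c /\
    (c%:E <= limf_einf
       (fun r : R => max_distortion x0 f r /
          (ln r `^ ((p - 1) / (p - n%:R)))%:E) (pinfty_nbhs R))%E).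
Proof.
case: n hn hp x0 Q hQ hQ0 f hf hq => [//|m] hn np x0 Q hQ Q0 f hf hq.
have p1 : 1 < p by apply: le_lt_trans np; rewrite ler1n.
have pN1 : 0 < p - 1 by rewrite subr_gt0.
have d0 : 0 < p - m.+1%:R by rewrite subr_gt0.
have mn : m%:R = m.+1%:R - 1 :> R by rewrite -natr1 addrK.
pose kap := (p - 1) / (p - m.+1%:R).
have Kp : 0 < K `^ (1 / (m.+1%:R - p)) by exact: powR_gt0.
split=> [/andP[alpha0 alphad] c|alphad c].
  have da : 0 < p - m.+1%:R - alpha by rewrite subr_gt0.
  have c0 : 0 < c by rewrite mulr_gt0// powR_gt0// divr_gt0.
  split=> //.
  (* [q] is [1 - beta] for the exponent [beta] of the test function. Then [q * kap] is the exponent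
     of [r] in the claim, and [(p - n) / (p - 1) / q] is the base of the power in [c]. *)
  pose q := (p - m.+1%:R - alpha) / (p - 1).
  have q0 : 0 < q by rewrite divr_gt0.
  (* As [J = r^q (1 - (r0 / r)^q) / q], this is exactly the lower bound for the distortion divided
     by the power of [r]. *)
  apply: (@limf_einf_ge_cvg _ _ (fun r => c * (1 - (r0 / r) `^ q) `^ kap)).
    rewrite -[X in _ --> X]mulr1; apply: cvgM; first exact: cvg_cst.
    by apply: cvg_one_sub_powR; exact: cvg_ratio_powR.
  near=> r.
  have r0r : r0 < r by near: r; apply: nbhs_pinfty_gt; exact: num_real.
  have rp := lt_trans hr0 r0r.
  have dq : 0 < 1 - (r0 / r) `^ q.
    have r0r1 : r0 / r < 1 by rewrite ltr_pdivrMr// mul1r.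
    have := gt0_ltr_powR q0 _ _ r0r1; rewrite powR1 subr_gt0; apply; rewrite nnegrE//.
    by rewrite divr_ge0// ltW.
  pose J := (r `^ q - r0 `^ q) / q.
  have JE : J = r `^ q * (1 - (r0 / r) `^ q) / q.
    have E : r0 `^ q = r `^ q * (r0 / r) `^ q.
      by rewrite -powRM ?divr_ge0 ?(ltW rp) ?(ltW hr0)// mulrC divfK ?gt_eqF.
    by rewrite /J E; ring.
  have J0 : 0 < J by rewrite JE divr_gt0// mulr_gt0// powR_gt0.
  have rk : 0 < r `^ ((p - m.+1%:R - alpha) / (p - m.+1%:R)) by exact: powR_gt0.
  rewrite inver (gt_eqF rk) lee_pdivlMr// -EFinM.
  apply: le_trans (max_distortion_lower_bound np Q0 hf _ hK J0 hq _); last 2 first.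
  - by rewrite hr0.
  - rewrite -(integral_powR hr0 (ltW r0r)) ?gt_eqF//.
    apply: eq_integral => x _; congr (_ `^ _)%:E.
    by rewrite /q mn; field; rewrite gt_eqF.
  rewrite lee_fin le_eqVlt; apply/orP; left; apply/eqP.
  rewrite /c -[LHS]mulrA -[LHS]mulrA; congr (_ * _).
  have -> : (p - m.+1%:R) / (p - 1) * J =
      (p - m.+1%:R) / (p - m.+1%:R - alpha) * (r `^ q * (1 - (r0 / r) `^ q)).
    by rewrite JE [q^-1]invf_div; field; rewrite nat1r !gt_eqF.
  rewrite -/kap [RHS]powRM ?divr_ge0 ?mulr_ge0 ?powR_ge0 ?(ltW d0) ?(ltW da) ?(ltW dq)//.
  rewrite [X in _ = _ * X]powRM ?powR_ge0 ?(ltW dq)// -[X in _ = _ * (X * _)]powRrM.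
  rewrite [X in _ = _ * X]mulrC; congr (_ * (_ * _ `^ _)).
  by rewrite /q /kap; field; rewrite ?nat1r !gt_eqF.
have c0 : 0 < c by rewrite mulr_gt0// powR_gt0// divr_gt0.
split=> //.
(* Now [beta = 1], so that [J = ln r - ln r0], and the correction factor compares [J] with
   [ln r]. *)
apply: (@limf_einf_ge_cvg _ _ (fun r => c * (1 - ln r0 / ln r) `^ kap)).
  rewrite -[X in _ --> X]mulr1; apply: cvgM; first exact: cvg_cst.
  by apply: cvg_one_sub_powR; exact: cvg_ratio_ln.
near=> r.
have r0r : r0 < r by near: r; apply: nbhs_pinfty_gt; exact: num_real.
have r1 : 1 < r by near: r; apply: nbhs_pinfty_gt; exact: num_real.
have rp := lt_trans hr0 r0r.
have lr : 0 < ln r by exact: ln_gt0.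
have lr0 : ln r0 < ln r by rewrite ltr_ln// posrE.
pose J := ln (r / r0).
have JE : J = ln r * (1 - ln r0 / ln r).
  by rewrite /J ln_div ?posrE//; field; rewrite gt_eqF.
have J0 : 0 < J by rewrite /J ln_div ?posrE// subr_gt0.
have rk : 0 < ln r `^ kap by exact: powR_gt0.
rewrite inver (gt_eqF rk) lee_pdivlMr// -EFinM.
apply: le_trans (max_distortion_lower_bound np Q0 hf _ hK J0 hq _); last 2 first.
- by rewrite hr0.
- rewrite -(integral_powRN1 hr0 (ltW r0r)).
  apply: eq_integral => x _; congr (_ `^ _)%:E.
  by rewrite alphad mn; field; rewrite gt_eqF.
rewrite lee_fin le_eqVlt; apply/orP; left; apply/eqP.
rewrite /c -[LHS]mulrA -[LHS]mulrA; congr (_ * _).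
have -> : (p - m.+1%:R) / (p - 1) * J =
    (p - m.+1%:R) / (p - 1) * (ln r * (1 - ln r0 / ln r)) by rewrite JE.
have ge1 : 0 <= 1 - ln r0 / ln r.
  by rewrite subr_ge0 ler_pdivrMr// mul1r ltW.
rewrite -/kap [RHS]powRM ?divr_ge0 ?mulr_ge0 ?(ltW d0) ?(ltW pN1) ?(ltW lr)//.
by rewrite [X in _ = _ * X]powRM ?(ltW lr)// [X in _ = _ * X]mulrC.
Unshelve. all: by end_near. Qed.
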